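(* Let $k\ge1$ be such that $\lambda_k$ is a simple eigenvalue. Assume that $g\in C^1(\mathbb R)$ is bounded, that $u\,g(u)>0$ for all $u\in\mathbb R\setminus\{0\}$, that $g'(u)\le c_0$ for all $u\in\mathbb R$ and some constant $c_0>0$, and that $$\liminf_{u\to\infty}g(u)>0,\qquad \limsup_{u\to-\infty}g(u)<0.$$ Assume that $f\in L^2(\Omega)$ satisfies $\int_\Omega f(x)\varphi_k(x)\,dx=0$. Then the problem $$\Delta u+\lambda_ku+g(u)=f(x)\ \text{ in }\Omega,\qquad u=0\ \text{ on }\partial\Omega$$ has a solution $u\in H^2(\Omega)\cap H^1_0(\Omega)$.
   Context: $\Omega\subset\mathbb R^m$ is a smooth bounded domain. $0<\lambda_1<\lambda_2\le\lambda_3\le\dots\to\infty$ are the eigenvalues of $-\Delta$ on $\Omega$ with zero Dirichlet boundary condition, repeated according to multiplicity, and $\varphi_1,\varphi_2,\dots$ are corresponding eigenfunctions forming an orthonormal basis of $L^2(\Omega)$. Equations are understood almost everywhere in $\Omega$. *)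

(* Defs.v *)
From HB Require Import structures.
From mathcomp Require Import all_boot all_order all_algebra.
From mathcomp Require Import all_classical all_reals all_analysis.

Set Implicit Arguments.
Unset Strict Implicit.
Unset Printing Implicit Defensive.

Import Order.TTheory GRing.Theory Num.Theory.
Import numFieldNormedType.Exports.

Local Open Scope classical_set_scope.
Local Open Scope ring_scope.

(* 'rV[R]_n with the sigma-algebra generated by the coordinates, which is the
   Borel sigma-algebra (see open_measurable_rV below). *)
Section rV_measurable.
Context {R : realType} (n : nat).

Definition rV_coord (i : 'I_n) (x : 'rV[R]_n) : measurableTypeR R := x ord0 i.

Let rV_set0 : g_sigma_preimage rV_coord set0.
Proof. exact: sigma_algebra0. Qed.

Let rV_setC A : g_sigma_preimage rV_coord A ->
  g_sigma_preimage rV_coord (~` A).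
Proof. exact: sigma_algebraC. Qed.

Let rV_bigcup (F : _^nat) : (forall i, g_sigma_preimage rV_coord (F i)) ->
  g_sigma_preimage rV_coord (\bigcup_i (F i)).
Proof. exact: sigma_algebra_bigcup. Qed.

Definition rV_display : measure_display.
Proof. exact: default_measure_display. Qed.

HB.instance Definition _ := @isMeasurable.Build rV_display
  'rV[R]_n (g_sigma_preimage rV_coord) rV_set0 rV_setC rV_bigcup.
End rV_measurable.

Section rV_measurable_fun.
Context {R : realType} d (T : measurableType d) (n : nat).

Lemma measurable_rV_coord (i : 'I_n) : measurable_fun setT (@rV_coord R n i).
Proof.
move=> _ Y mY; rewrite setTI; apply: sub_sigma_algebra => /=.
rewrite -bigcup_seq/=; exists i => /=; first by rewrite mem_index_enum.
by exists Y => //; rewrite setTI.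
Qed.

Lemma measurable_fun_rV (f : T -> 'rV[R]_n) :
  (forall i, measurable_fun setT (rV_coord i \o f)) -> measurable_fun setT f.
Proof.
move=> mf; apply: (measurability
  (\big[setU/set0]_(i < n)
     preimage_set_system setT (@rV_coord R n i) measurable)).
  by [].
move=> _ [A + <-]; rewrite -bigcup_seq /= => -[i _ [B mB <-]].
by rewrite setTI -comp_preimage; exact: mf.
Qed.

End rV_measurable_fun.

Section rV_lebesgue.
Context {R : realType}.

Definition rV_cons n (p : measurableTypeR R * 'rV[R]_n) : 'rV[R]_n.+1 :=
  row_mx (const_mx p.1 : 'rV_1) p.2.

Definition rV_uncons n (x : 'rV[R]_n.+1) : measurableTypeR R * 'rV[R]_n :=
  (x ord0 ord0, rsubmx (x : 'rV_(1 + n))).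

Lemma rV_cons0 n p : @rV_cons n p ord0 ord0 = p.1.
Proof.
rewrite /rV_cons; have -> : ord0 = lshift n (ord0 : 'I_1) by exact: val_inj.
by rewrite (row_mxEl (const_mx p.1 : 'rV_1) p.2) mxE.
Qed.

Lemma rV_consS n p (j : 'I_n) : @rV_cons n p ord0 (lift ord0 j) = p.2 ord0 j.
Proof.
rewrite -rshift1; exact: (row_mxEr (const_mx p.1 : 'rV_1) p.2).
Qed.

Lemma rV_consK n : cancel (@rV_cons n) (@rV_uncons n).
Proof.
case=> a v; rewrite /rV_uncons rV_cons0; congr pair.
exact: (row_mxKr (const_mx a : 'rV_1) v).
Qed.

Lemma measurable_rV_cons n : measurable_fun setT (@rV_cons n).
Proof.
apply: measurable_fun_rV => i; rewrite /rV_coord /comp.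
case: (unliftP ord0 i) => [j ->|->].
  under eq_fun do rewrite rV_consS.
  exact: (measurableT_comp (measurable_rV_coord j) measurable_snd).
under eq_fun do rewrite rV_cons0.
exact: measurable_fst.
Qed.

Lemma measurable_rV_uncons n : measurable_fun setT (@rV_uncons n).
Proof.
apply/measurable_fun_pairP; split; first exact: measurable_rV_coord.
apply: measurable_fun_rV => i; rewrite /rV_coord /comp /=.
under eq_fun do rewrite mxE.
exact: (@measurable_rV_coord R n.+1 (rshift 1 i)).
Qed.

Section rV_cons_measure.
Variables (n : nat) (mu : {sigma_finite_measure set 'rV[R]_n -> \bar R}).

Definition rV_cons_measure : set 'rV[R]_n.+1 -> \bar R :=
  pushforward (lebesgue_measure \x mu)%E (@rV_cons n).

Let mu0 : rV_cons_measure set0 = 0%E.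
Proof. by rewrite /rV_cons_measure /pushforward preimage_set0 measure0. Qed.

Let mu_ge0 A : (0 <= rV_cons_measure A)%E.
Proof. exact: (measure_ge0 (lebesgue_measure \x mu)%E). Qed.

Let mu_sigma_additive : semi_sigma_additive rV_cons_measure.
Proof.
move=> F mF tF mUF; rewrite /rV_cons_measure /pushforward preimage_bigcup.
have mcons A : measurable A -> measurable (@rV_cons n @^-1` A).
  by move=> mA; rewrite -[X in measurable X]setTI; exact: measurable_rV_cons.
apply: measure_semi_sigma_additive.
- by move=> k; exact: mcons.
- apply/trivIsetP => /= i j _ _ ij; rewrite -preimage_setI.
  by move/trivIsetP : tF => /(_ _ _ _ _ ij) ->//; rewrite preimage_set0.
- by rewrite -preimage_bigcup; exact: mcons.
Qed.

HB.instance Definition _ := isMeasure.Build _ _ _ rV_cons_measure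
  mu0 mu_ge0 mu_sigma_additive.

Let mu_sigma_finite : sigma_finite setT rV_cons_measure.
Proof.
have /sigma_finiteP[F [TF ndF Foo]] := sigma_finiteT (@lebesgue_measure R).
have /sigma_finiteP[G [TG ndG Goo]] := sigma_finiteT mu.
exists (fun k => @rV_uncons n @^-1` (F k `*` G k)).
  rewrite -preimage_bigcup -(preimage_setT (@rV_uncons n)); congr (_ @^-1` _).
  rewrite -setXTT TF TG predeqE => -[x y]; split.
    move=> [/= [i _ Fix] [j _ Gjy]]; exists (maxn i j) => //; split.
    - by move: x Fix; exact/subsetPset/ndF/leq_maxl.
    - by move: y Gjy; exact/subsetPset/ndG/leq_maxr.
  by move=> [i _ []/= ? ?]; split; exists i.
move=> k; have [mF Fk] := Foo k; have [mG Gk] := Goo k; split.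
  by rewrite -[X in measurable X]setTI; apply: measurable_rV_uncons => //;
    exact: measurableX.
rewrite /rV_cons_measure /pushforward.
have -> : @rV_cons n @^-1` (@rV_uncons n @^-1` (F k `*` G k)) = F k `*` G k.
  rewrite -comp_preimage (_ : @rV_uncons n \o @rV_cons n = id) //.
  by apply/funext => p; exact: rV_consK.
by rewrite product_measure1E// lte_mul_pinfty// ge0_fin_numE.
Qed.

HB.instance Definition _ := Measure_isSigmaFinite.Build _ _ _ rV_cons_measure
  mu_sigma_finite.

End rV_cons_measure.

(* Lebesgue measure on R^n; rV_lebesgue_box below characterizes it. *)
Fixpoint rV_lebesgue n : {sigma_finite_measure set 'rV[R]_n -> \bar R} :=
  if n is n'.+1 then rV_cons_measure (rV_lebesgue n')
  else dirac (0 : 'rV[R]_0).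

End rV_lebesgue.

Lemma rV_lebesgue_box (R : realType) n (A : 'I_n -> set (measurableTypeR R)) :
  (forall i, measurable (A i)) ->
  rV_lebesgue n [set x : 'rV[R]_n | forall i, A i (x ord0 i)] =
  (\prod_(i < n) lebesgue_measure (A i))%E.
Proof.
elim: n A => [A _|n IHn A mA] /=.
  by rewrite big_ord0 diracE mem_set// => -[].
rewrite big_ord_recl -(IHn (fun i => A (lift ord0 i))) //= /rV_cons_measure.
rewrite /pushforward; set B := (X in rV_lebesgue n X).
have -> : @rV_cons R n @^-1` [set x | forall i, A i (x ord0 i)] = A ord0 `*` B.
  rewrite predeqE => p; split=> [Ap|[/= A0 AS] i].
    split=> [|i] /=; first by rewrite -(rV_cons0 p); exact: Ap.
    by rewrite -rV_consS; exact: Ap.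
  by case: (unliftP ord0 i) => [j ->|->]; rewrite (rV_consS, rV_cons0)//;
    exact: AS.
rewrite product_measure1E//.
have -> : B = \bigcap_(i in [set: 'I_n]) (rV_coord i @^-1` A (lift ord0 i)).
  by rewrite predeqE => x; split=> [h i _|h i]; exact: h.
apply: fin_bigcap_measurable => // i _.
by rewrite -[X in measurable X]setTI; exact: measurable_rV_coord.
Qed.

Lemma open_measurable_rV (R : realType) n (U : set 'rV[R]_n) :
  open U -> measurable U.
Proof.
move=> oU.
pose c (p : 'rV[rat]_n * nat) : 'rV[R]_n := map_mx ratr p.1.
pose r (p : 'rV[rat]_n * nat) : R := p.2.+1%:R^-1.
pose D := [set p | ball (c p) (r p) `<=` U].
have r0 p : 0 < r p by rewrite invr_gt0.
have -> : U = \bigcup_(p in D) ball (c p) (r p).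
  apply/seteqP; split=> [x Ux|x [p Dp]]; last exact: Dp.
  have /nbhs_ballP[e /= e0 xeU] : nbhs x U by exact: open_nbhs_nbhs.
  have [k] : exists k, 0 + k.+1%:R^-1 < e / 2.
    by apply: ltr_add_invr; rewrite divr_gt0.
  rewrite add0r => ke.
  have /choice[q qx] (i : 'I_n) :
      exists q : rat, `|x ord0 i - ratr q| < k.+1%:R^-1 :> R.
    have /rat_in_itvoo[q] : x ord0 i - k.+1%:R^-1 < x ord0 i + k.+1%:R^-1.
      by rewrite ltrD2l (lt_trans (y := 0))// ?oppr_lt0 invr_gt0.
    by rewrite in_itv /= -ltr_distlC => ?; exists q.
  have xc : ball (c (\row_i q i, k)) (k.+1%:R^-1) x.
    split; first exact: (r0 (0, k)).
    by move=> i j; rewrite /c !mxE ord1 /ball /= distrC qx.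
  exists (\row_i q i, k) => // y yc; apply: xeU.
  apply: (@le_ball _ _ _ (k.+1%:R^-1 + k.+1%:R^-1)).
    by rewrite (splitr e) lerD// ltW.
  exact: ball_triangle (ball_sym xc) yc.
rewrite bigcup_mkcond; apply: countable_bigcupT_measurable => // p.
case: ifPn => // _.
have -> : ball (c p) (r p) =
    \bigcap_(i in [set: 'I_n]) (rV_coord i @^-1` ball (c p ord0 i) (r p)).
  rewrite predeqE => x; split=> [[_ h] i _|h]; first exact: h.
  by split=> // i j; rewrite ord1; exact: h.
apply: fin_bigcap_measurable => // i _.
rewrite -[X in measurable X]setTI; apply: measurable_rV_coord => //.
by apply: measurable_realfun.open_measurable; exact: ball_open.
Qed.

Section domains.
Context {R : realType}.

Definition partial m (i : 'I_m) (f : 'rV[R]_m -> R) : 'rV[R]_m -> R :=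
  fun x => 'D_(delta_mx ord0 i) f x.

(* The multi-index of an iterated partial derivative is given as the list of
   the variables with respect to which one differentiates. *)
Definition partials m (s : seq 'I_m) (f : 'rV[R]_m -> R) : 'rV[R]_m -> R :=
  foldr (@partial m) f s.

Fixpoint Ck m (k : nat) (f : 'rV[R]_m -> R) : Prop :=
  continuous f /\
  if k is k'.+1 then
    (forall i x, derivable f x (delta_mx ord0 i)) /\
    (forall i, Ck k' (partial i f))
  else True.

Definition Cinfty m (f : 'rV[R]_m -> R) : Prop := forall k, Ck k f.

(* Near each boundary point, after relabelling and reorienting the coordinate
   axes, Omega is the region above the graph of a smooth function of the other
   m - 1 coordinates; col' i x is x without its i-th coordinate. *)
Definition smooth_boundary m (Omega : set 'rV[R]_m) : Prop :=
  forall x0, (closure Omega `\` Omega) x0 ->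
  exists (i : 'I_m) (reversed : bool) (gamma : 'rV[R]_m.-1 -> R) (r : R),
    [/\ 0 < r, Cinfty gamma &
      forall x, ball x0 r x ->
        (Omega x <-> gamma (col' i x) < (-1) ^+ reversed * x ord0 i)].

Definition smooth_bounded_domain m (Omega : set 'rV[R]_m) : Prop :=
  [/\ open Omega, Omega !=set0, connected Omega, bounded_set Omega &
      smooth_boundary Omega].

End domains.

Section sobolev.
Context {R : realType} {m : nat} (Omega : set 'rV[R]_m).

Local Notation mu := (@rV_lebesgue R m).
Implicit Types (u v w f phi : 'rV[R]_m -> R) (lam : R).

Definition test_function phi : Prop :=
  Cinfty phi /\
  (compact (closure [set x | phi x != 0]) /\
   closure [set x | phi x != 0] `<=` Omega).

Definition L2 u : Prop :=
  measurable_fun Omega u /\ (\int[mu]_(x in Omega) ((u x) ^+ 2)%:E < +oo)%E.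

Definition L2_inner u v : R := \int[mu]_(x in Omega) (u x * v x).

Definition weak_partials (s : seq 'I_m) u v : Prop :=
  forall phi, test_function phi ->
    \int[mu]_(x in Omega) (u x * partials s phi x) =
    (-1) ^+ size s * \int[mu]_(x in Omega) (v x * phi x).

Definition sobolev (k : nat) u : Prop :=
  L2 u /\
  forall s : seq 'I_m, (size s <= k)%N -> exists v, L2 v /\ weak_partials s u v.

(* The closure of the test functions in H^1(Omega). *)
Definition sobolev10 u : Prop :=
  sobolev 1 u /\
  exists Du : 'I_m -> 'rV[R]_m -> R,
    (forall i, L2 (Du i) /\ weak_partials [:: i] u (Du i)) /\
    forall eps : R, 0 < eps -> exists phi, test_function phi /\
      (\int[mu]_(x in Omega) ((u x - phi x) ^+ 2 +
         \sum_(i < m) (Du i x - partial i phi x) ^+ 2)%:E < eps%:E)%E.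

Definition weak_laplacian u w : Prop :=
  exists v : 'I_m -> 'rV[R]_m -> R,
    (forall i, L2 (v i) /\ weak_partials [:: i; i] u (v i)) /\
    forall x, w x = \sum_(i < m) v i x.

(* u solves Delta u + F(u) = f almost everywhere in Omega; u = 0 on the boundary
   is the membership in H^1_0. *)
Definition dirichlet_solution (F : R -> R) f u : Prop :=
  [/\ sobolev 2 u, sobolev10 u &
      exists w, weak_laplacian u w /\
        {ae mu, forall x, Omega x -> w x + F (u x) = f x}].

Definition dirichlet_eigenfunction lam u : Prop :=
  dirichlet_solution (fun y => lam * y) (cst 0) u /\
  ~ {ae mu, forall x, Omega x -> u x = 0}.

Definition simple_eigenvalue lam : Prop :=
  exists2 u, dirichlet_eigenfunction lam u &
    forall v, dirichlet_eigenfunction lam v ->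
      exists c : R, {ae mu, forall x, Omega x -> v x = c * u x}.

Definition orthonormal_basis (phi : nat -> 'rV[R]_m -> R) : Prop :=
  [/\ forall i, L2 (phi i),
      forall i j, L2_inner (phi i) (phi j) = (i == j)%:R &
      forall h, L2 h ->
        (\int[mu]_(x in Omega)
           ((h x - \sum_(i < n) L2_inner h (phi i) * phi i x) ^+ 2)%:E
         @[n --> \oo] --> 0)%E].

(* Indices start at 0: lam i and phi i are the (i+1)-st eigenvalue and
   eigenfunction. Since the phi i form a basis of L^2(Omega), lam lists all
   eigenvalues with their multiplicities. *)
Definition dirichlet_eigenbasis (lam : nat -> R) (phi : nat -> 'rV[R]_m -> R) :
    Prop :=
  [/\ 0 < lam 0%N /\ lam 0%N < lam 1%N,
      forall i, lam i.+1 <= lam i.+2,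
      lam i @[i --> \oo] --> +oo,
      forall i, dirichlet_eigenfunction (lam i) (phi i) &
      orthonormal_basis phi].

End sobolev.

Definition C1 {R : realType} (g : R -> R) : Prop :=
  (forall x, derivable g x 1) /\ continuous (derive1 g).

(* Main.v *)
Require Import Defs.
From mathcomp Require Import all_boot all_order all_algebra all_fingroup.
From mathcomp Require Import all_classical all_reals all_analysis.
From mathcomp Require Import measurable_realfun.
From mathcomp Require Import zify ring lra.

(* Landesman-Lazer argument. In the span of finitely many eigenfunctions, the
   projected problem is solvable by the Poincare-Miranda theorem: on a large
   box the component along phi_k is controlled by the sign of g at infinity,
   and the others by the gap between lam_k and the rest of the spectrum. The
   Poincare-Miranda theorem itself follows from a mod 2 count over the
   simplices of Kuhn's triangulation of a cube, which does not change when the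
   labels are modified away from the faces. The approximations have a limit u
   in L^2, whose expansion shows that it solves the equation weakly in H^1_0.
   As for the second derivatives, the functional chi |-> <d_a u, d_b chi> is
   bounded in the L^2 norm of the test function chi: in directions tangent to
   the boundary by difference quotients along measure-preserving shears that
   map the graphs x_i = gamma(x') + c to themselves, and in the remaining
   direction by the equation. The Riesz representation, built from the
   eigenbasis, then gives u in H^2. *)

Set Implicit Arguments.
Unset Strict Implicit.
Unset Printing Implicit Defensive.

Import Order.TTheory GRing.Theory Num.Theory.
Import numFieldNormedType.Exports.

Local Open Scope classical_set_scope.
Local Open Scope ring_scope.

(** * The Poincare-Miranda theorem *)

(** Functions on Omega are extended by zero to R^m, where the shears act as isometries of L^2;
    membership in H^1_0 is approximation by test functions. Compactness comes from the spectrum: by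
    Bessel's inequality the numbers (lam_k - lam_j) c_j are square summable with a bound that
    depends only on sup |g|, |Omega| and f, and lam_k - lam_j is unbounded, so the tails of all
    approximations are uniformly small. The coefficient along phi_k alone escapes this estimate, and
    it is what the behaviour of g at infinity controls. In the regularity part, the difference
    quotient is taken of a test function psi close to the localized solution, because its quotients
    are again test functions and may be inserted in the weak equation; shifts along the boundary
    keep their supports inside Omega. The price is an error of the size of the gradient distance
    divided by |h|. It is harmless because psi tends to the solution at fixed h, and h tends to 0
    only afterwards. *)

Lemma bump_neqS (t j : nat) : j != t ->
  (bump t j != t.+1) && ((bump t j).+1 != t.+1).
Proof. by rewrite /bump; case: (leqP t j) => /=; lia. Qed.

(** * A mod 2 degree for labellings of a grid *)

Section cubical_degree.
Variables (N p : nat).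
Let n := N.+1.
Let q := p.+1.
Implicit Types (x : {ffun 'I_n -> 'I_q}) (s : 'S_n) (y : 'I_n -> nat).
Implicit Types (L : 'I_n -> ('I_n -> nat) -> 'F_2).

(** [s i] is the time at which coordinate i is raised: t runs along the path of vertices of a Kuhn
    simplex, from the corner y of a unit cube (t = 0) to the opposite corner (t = n). *)
Definition kuhn_vertex y s (t : nat) : 'I_n -> nat :=
  fun i => (y i + (s i < t)%N)%N.

(** This is the cup product of the coboundaries of the labels, in the Alexander-Whitney form on
    ordered vertices, evaluated on the mod 2 fundamental class of the cube. A simplex counts if, for
    every k, label k changes along the k-th edge of its path. *)
Definition cubical_degree L : 'F_2 :=
  \sum_(x : {ffun 'I_n -> 'I_q}) \sum_(s : 'S_n) \prod_k
    (L k (kuhn_vertex (fun i => x i) s k.+1) + L k (kuhn_vertex (fun i => x i) s k)).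

Lemma addF2 (a : 'F_2) : a + a = 0.
Proof. by case: a => -[|[|//]] ?; apply/val_inj. Qed.

Lemma eqF2 (a b : 'F_2) : a + b = 0 -> a = b.
Proof.
by move=> ab0; rewrite -[RHS]add0r -ab0 -addrA addF2 addr0.
Qed.

(** The transposition exchanges even and odd permutations, so the sum consists of two equal halves,
    which cancel in ['F_2]. *)
Lemma sum_perm_tperm0 (g : 'S_n -> 'F_2) (i j : 'I_n) : i != j ->
  (forall s, g (s * tperm i j)%g = g s) -> \sum_s g s = 0.
Proof.
move=> ij gE; rewrite (bigID (@odd_perm _)) /=.
rewrite [X in _ + X](reindex_inj (mulIg (tperm i j))) /=.
rewrite [X in _ + X](eq_big (@odd_perm _) g) ?addF2//.
by move=> s; rewrite odd_permM odd_tperm ij addbT negbK.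
Qed.

Definition omitted_sum L (M : ('I_n -> nat) -> 'F_2) (k : 'I_n) (m t : nat) :
    'F_2 :=
  \sum_(x : {ffun 'I_n -> 'I_q}) \sum_(s : 'S_n) M (kuhn_vertex (fun i => x i) s m) *
    \prod_(j < N) (L (lift k j) (kuhn_vertex (fun i => x i) s (bump t j).+1) +
                   L (lift k j) (kuhn_vertex (fun i => x i) s (bump t j))).

(* Adding the summands for t and t.+1 erases the vertex number t.+1, so that the
   sum is invariant under exchanging the steps t and t.+1. *)
Lemma omitted_sumS L M k (m t : nat) : (t < N)%N -> m != t.+1 ->
  omitted_sum L M k m t = omitted_sum L M k m t.+1.
Proof.
move=> tN mt; apply: eqF2.
rewrite /omitted_sum -big_split /=; apply: big1 => x _.
rewrite -big_split /=.
have t1n : (t.+1 < n)%N by [].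
have tn : (t < n)%N by exact: ltn_trans t1n.
pose i1 : 'I_n := Ordinal tn; pose i2 : 'I_n := Ordinal t1n.
have i12 : i1 != i2 by rewrite -val_eqE /= neq_ltn ltnSn.
pose v s r := kuhn_vertex (fun i => x i) s r.
have vE s r : r != t.+1 -> v (s * tperm i1 i2)%g r = v s r.
  move=> rt; apply/funext => i; rewrite /v /kuhn_vertex permM; congr (_ + _)%N.
  case: tpermP => [->|->|//] /=; congr nat_of_bool; lia.
pose j0 : 'I_N := Ordinal tN.
pose g s := M (v s m) * ((L (lift k j0) (v s t.+2) + L (lift k j0) (v s t)) *
  \prod_(j < N | j != j0)
    (L (lift k j) (v s (bump t j).+1) + L (lift k j) (v s (bump t j)))).
rewrite (eq_bigr g) => [|s _]; last first.
  rewrite -mulrDr /g; congr (_ * _).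
  rewrite (bigD1 j0)//= [X in _ + X](bigD1 j0)//=.
  have -> : bump t t = t.+1 by rewrite /bump leqnn.
  have -> : bump t.+1 t = t by rewrite /bump ltnn.
  rewrite [X in _ + _ * X](eq_bigr (fun j : 'I_N =>
    L (lift k j) (v s (bump t j).+1) + L (lift k j) (v s (bump t j)))).
    rewrite -mulrDl; congr (_ * _); rewrite -addrA; congr (_ + _).
    by rewrite addrA addF2 add0r.
  move=> j; rewrite -val_eqE /= => jt.
  by have -> : bump t.+1 j = bump t j by rewrite /bump; lia.
apply: (sum_perm_tperm0 i12) => s; rewrite /g !vE//; [|lia..].
congr (_ * (_ * _)); apply: eq_bigr => j; rewrite -val_eqE /= => jt.
by have /andP[? ?] := bump_neqS jt; rewrite !vE.
Qed.

(** M sits at the upper end of the passed edge, so this edge is moved down: the vertices erased on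
    the way have numbers at most k. *)
Lemma omitted_sum_first L M k : omitted_sum L M k k.+1 k = omitted_sum L M k k.+1 0.
Proof.
have kN : (k <= N)%N by rewrite -ltnS.
have H r : (r <= k)%N -> omitted_sum L M k k.+1 r = omitted_sum L M k k.+1 0.
  elim: r => // r IH rk; rewrite -IH ?(ltnW rk)//.
  by symmetry; apply: omitted_sumS; lia.
exact: H.
Qed.

(** M sits at the lower end, so the passed edge is moved up: the erased vertices have numbers above
    k. *)
Lemma omitted_sum_last L M k : omitted_sum L M k k k = omitted_sum L M k k N.
Proof.
have kN : (k <= N)%N by have := ltn_ord k.
rewrite -{2}(subKn kN).
suff H r : (r <= N - k)%N -> omitted_sum L M k k (N - r) = omitted_sum L M k k N.
  by rewrite H// ; lia.
elim: r => [|r IH] rk; first by rewrite subn0.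
rewrite -IH; last exact: ltnW.
have -> : (N - r = (N - r.+1).+1)%N by lia.
by apply: omitted_sumS; lia.
Qed.

Definition upd_label L k M : 'I_n -> ('I_n -> nat) -> 'F_2 :=
  fun i => if i == k then M else L i.

Lemma cubical_degree_upd L k M :
  cubical_degree (upd_label L k M) =
  omitted_sum L M k k.+1 k + omitted_sum L M k k k.
Proof.
rewrite /omitted_sum -big_split /=; apply: eq_bigr => x _.
rewrite -big_split /=; apply: eq_bigr => s _.
rewrite -mulrDl (bigD1_ord k)//= /upd_label eqxx; congr (_ * _).
by apply: eq_bigr => j _; rewrite eq_sym (negbTE (neq_lift _ _)).
Qed.

Let rot : 'S_n := perm (@ord_pred_inj n).

Lemma rotE i : rot i = (if i == 0 :> nat then N else i.-1) :> nat.
Proof.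
rewrite permE /=; case: (nat_of_ord i) (ltn_ord i) => [|j] jn /=.
  by rewrite modn_small.
by rewrite modnDr modn_small// ltnW.
Qed.

(** The facet without vertex 0 of a simplex is the facet without the last vertex of its neighbour:
    the first step becomes the last one, and the base is raised in the coordinate of that step. *)
Lemma kuhn_vertex_rot y s t : (t <= N)%N ->
  kuhn_vertex y s t.+1 =
  kuhn_vertex (fun i => y i + ((s * rot)%g i == ord_max))%N (s * rot)%g t.
Proof.
move=> tN; apply/funext => i; rewrite /kuhn_vertex -addnA; congr (_ + _)%N.
rewrite -val_eqE /= permM rotE; case: ifP => [/eqP ->|] /=.
  by rewrite eqxx (ltnNge N) tN.
by have := ltn_ord (s i); rewrite /n; case: (nat_of_ord (s i)) => // j; lia.
Qed.

Definition sperner_label L := forall i y,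
  (y i = 0%N -> L i y = 0) /\ (y i = q -> L i y = 1).

(** The two sides run over the facets without vertex 0 and those without the last vertex; an
    interior facet of this kind occurs once on each side. A facet in a face of direction d
    contributes 0, since label d is constant there or, if d = k, since M vanishes there. *)
Lemma omitted_sum_extremes L M k : sperner_label L ->
  (forall y, y k = 0%N \/ y k = q -> M y = 0) ->
  omitted_sum L M k k.+1 0 = omitted_sum L M k k N.
Proof.
move=> labL M0; rewrite /omitted_sum exchange_big /= [RHS]exchange_big /=.
pose Q (y : 'I_n -> nat) s := M (kuhn_vertex y s k) *
    \prod_(j < N) (L (lift k j) (kuhn_vertex y s j.+1) +
                   L (lift k j) (kuhn_vertex y s j)).
rewrite [RHS](eq_bigr (fun s => \sum_(x : {ffun 'I_n -> 'I_q}) Q (fun i => x i) s)); last first.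
  move=> s _; apply: eq_bigr => x _; congr (_ * _); apply: eq_bigr => j _.
  by rewrite /bump leqNgt ltn_ord.
rewrite [RHS](reindex_inj (mulIg rot)) /=; apply: eq_bigr => s _.
set s' := (s * rot)%g; pose d := (s'^-1)%g ord_max.
have Q0 (y : 'I_n -> nat) : y d = 0%N \/ y d = q -> Q y s' = 0.
  move=> yd; have vd t : (t <= N)%N -> kuhn_vertex y s' t d = y d.
    by move=> tN; rewrite /kuhn_vertex permKV /= ltnNge tN addn0.
  rewrite /Q; case: (unliftP k d) => [j|] dE; last first.
      have kN : (k <= N)%N by rewrite -ltnS.
    by rewrite M0 ?mul0r//; move: (vd k kN) yd; rewrite dE => ->.
  have [c lc] : exists c, forall t, (t <= N)%N -> L d (kuhn_vertex y s' t) = c.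
    by case: yd => yd; [exists 0|exists 1] => t tN;
      have [l0 l1] := labL d (kuhn_vertex y s' t); [apply: l0|apply: l1]; rewrite vd.
  by rewrite (bigD1 j)//= -dE !lc ?addF2 ?mul0r ?mulr0// ltnW.
(* The shift is cyclic in order to be bijective; where it wraps around, both summands belong to
   faces and vanish by [Q0]. *)
pose sh (x : {ffun 'I_n -> 'I_q}) : {ffun 'I_n -> 'I_q} :=
  [ffun i => if i == d then ordS (x i) else x i].
have sh_inj : injective sh.
  move=> x x' /ffunP xx'; apply/ffunP => i; have := xx' i; rewrite !ffunE.
  by case: ifP => // _ /ordS_inj.
rewrite [RHS](reindex_inj sh_inj) /=; apply: eq_bigr => x _.
transitivity (Q (fun i => x i + (i == d))%N s').
  have vE t : (t <= N)%N -> kuhn_vertex (fun i => x i) s t.+1 =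
      kuhn_vertex (fun i => x i + (i == d))%N s' t.
    move=> tN; rewrite kuhn_vertex_rot//; congr kuhn_vertex; apply/funext => i.
    by rewrite -(inj_eq (@perm_inj _ s') i d) permKV.
  congr (_ * _); first by rewrite vE// -ltnS.
  by apply: eq_bigr => j _; rewrite /bump /= !add1n !vE// ltnW.
have [xd|xd] := eqVneq (x d).+1 q.
  rewrite !Q0//; first by left; rewrite /sh ffunE eqxx /= xd modnn.
  by right; rewrite eqxx addn1.
congr (Q _ _); apply/funext => i; rewrite /sh ffunE; case: eqVneq => [->|] /=.
  by rewrite addn1 modn_small// ltn_neqAle xd ltn_ord.
by rewrite addn0.
Qed.

(** By linearity the difference of the two degrees involves only M + L k, which vanishes on the two
    faces of direction k. The passed edges are moved to the two ends of the path, where the two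
    halves agree and cancel. *)
Lemma cubical_degree_upd_eq L k M :
  sperner_label L -> sperner_label (upd_label L k M) ->
  cubical_degree (upd_label L k M) = cubical_degree L.
Proof.
move=> labL labM; apply: eqF2.
have {2}-> : L = upd_label L k (L k).
  by apply/funext => i; rewrite /upd_label; case: eqVneq => // ->.
rewrite !cubical_degree_upd addrACA.
have omD m t : omitted_sum L M k m t + omitted_sum L (L k) k m t =
    omitted_sum L (fun y => M y + L k y) k m t.
  rewrite /omitted_sum -big_split; apply: eq_bigr => x _ /=.
  by rewrite -big_split; apply: eq_bigr => s _ /=; rewrite mulrDl.
rewrite !omD omitted_sum_first omitted_sum_last omitted_sum_extremes ?addF2//.
move=> y; have [l0 l1] := labL k y; have := labM k y.
rewrite /upd_label eqxx => -[l0' l1'] [yk|yk].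
  by rewrite l0' // l0 // addr0.
by rewrite l1' // l1 //; exact: addF2.
Qed.

Definition std_label : 'I_n -> ('I_n -> nat) -> 'F_2 := fun i y => (y i != 0%N)%:R.

(** Standard label k changes along edge k only if x k = 0 and s k = k; hence exactly one simplex
    counts, the one with x = 0 and s = 1. *)
Lemma cubical_degree_std : cubical_degree std_label = 1.
Proof.
rewrite /cubical_degree (bigD1 [ffun=> ord0])//= (bigD1 1%g)//=.
rewrite [X in X + _ + _]big1 => [|k _]; last first.
  by rewrite /std_label /kuhn_vertex ffunE perm1 ltnSn ltnn /= addr0.
rewrite [X in _ + X + _]big1 => [|s s1]; last first.
  have [k sk] : exists k, s k != k.
    apply/existsP; apply: contraR s1 => /existsPn sE.
    by apply/eqP/permP => k; rewrite perm1; apply/eqP; have := sE k; rewrite negbK.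
  rewrite (bigD1 k)//= /std_label /kuhn_vertex ffunE /= !add0n ltnS.
  suff -> : (s k <= k)%N = (s k < k)%N by rewrite addF2 mul0r.
  by rewrite [RHS]ltn_neqAle -val_eqE /= in sk *; rewrite sk.
rewrite addr0 [X in _ + X]big1 ?addr0// => x x0; rewrite big1// => s _.
have [k xk] : exists k, x k != ord0.
  apply/existsP; apply: contraR x0 => /existsPn sE.
  by apply/eqP/ffunP => k; rewrite ffunE; apply/eqP; have := sE k; rewrite negbK.
rewrite (bigD1 k)//= /std_label /kuhn_vertex !addn_eq0.
by rewrite -val_eqE /= in xk; rewrite (negbTE xk) /= addF2 mul0r.
Qed.

(** [Lr r] has the labels below r replaced by standard ones; each further replacement preserves the
    degree. *)
Theorem cubical_degree1 L : sperner_label L -> cubical_degree L = 1.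
Proof.
move=> labL; pose Lr (r : nat) (i : 'I_n) := if (i < r)%N then std_label i else L i.
have labstd : sperner_label std_label.
  by move=> i y; split=> yi; rewrite /std_label yi.
have labr r : sperner_label (Lr r) by rewrite /Lr => i y; case: ifP => _.
have LrS (k : 'I_n) : Lr k.+1 = upd_label (Lr k) k (std_label k).
  apply/funext => i; rewrite /upd_label /Lr; have [->|ik] := eqVneq i k.
    by rewrite ltnSn.
  by rewrite ltnS leq_eqVlt val_eqE (negbTE ik).
have <- : Lr 0 = L by [].
rewrite -cubical_degree_std; have -> : std_label = Lr n.
  by apply/funext => i; rewrite /Lr ltn_ord.
have : (n <= n)%N by []; move: {1 3}n; elim=> // r IH rn.
rewrite IH; last exact: ltnW.
by rewrite (LrS (Ordinal rn)) cubical_degree_upd_eq// -LrS.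
Qed.

Corollary exists_full_cube L : sperner_label L ->
  exists x : {ffun 'I_n -> 'I_q}, forall i, exists y y' : 'I_n -> nat,
    [/\ forall j, (x j <= y j <= (x j).+1)%N, forall j, (x j <= y' j <= (x j).+1)%N &
    L i y <> L i y'].
Proof.
move=> /cubical_degree1 d1.
have /negP : cubical_degree L != 0 by rewrite d1.
apply: contra_notP => /forallNP noc; apply/eqP.
rewrite /cubical_degree big1// => x _; rewrite big1// => s _.
have /existsNP[i ni] := noc x.
rewrite (bigD1 i)//=; suff -> : L i (kuhn_vertex (fun i => x i) s i.+1) =
    L i (kuhn_vertex (fun i => x i) s i) by rewrite addF2 mul0r.
apply: contra_notP ni => ni.
have vle t j : (x j <= kuhn_vertex (fun i => x i) s t j <= (x j).+1)%N.
  by rewrite /kuhn_vertex; case: (_ < _)%N; rewrite ?addn0 ?addn1 ?leqnn leqnSn.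
by exists (kuhn_vertex (fun i => x i) s i.+1), (kuhn_vertex (fun i => x i) s i).
Qed.

End cubical_degree.

(** * Zeros of continuous maps by refinement of the grid *)

Section miranda.
Context {R : realType} (N : nat).
Let n := N.+1.
Variables (F : 'rV[R]_n -> 'I_n -> R) (r : 'I_n -> R).
Hypothesis r_gt0 : forall i, 0 < r i.
Let box := [set c : 'rV[R]_n | forall i, - r i <= c ord0 i <= r i].
Hypothesis F_cont : forall i, continuous (F ^~ i).
Hypothesis F_left : forall c i, box c -> c ord0 i = - r i -> F c i < 0.
Hypothesis F_right : forall c i, box c -> c ord0 i = r i -> 0 < F c i.

Theorem poincare_miranda : exists2 c, box c & forall i, F c i = 0.
Proof.
pose pt (p : nat) (y : 'I_n -> nat) : 'rV[R]_n :=
  \row_i (- r i + ((y i)%:R / p.+1%:R) * (r i *+ 2)).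
have pt_box p y : (forall i, (y i <= p.+1)%N) -> box (pt p y).
  move=> yp i; rewrite mxE lerDl; have yi := yp i.
  have p0 : 0 < p.+1%:R :> R by rewrite ltr0n.
  rewrite mulr_ge0 ?divr_ge0//= ?mulrn_wge0 ?(ltW (r_gt0 i))//.
  rewrite addrC -lerBrDr opprK -mulr2n ger_pMl ?pmulrn_rgt0//.
  by rewrite ler_pdivrMr// mul1r ler_nat.
(* [sperner_label] speaks of all y, also of those that leave the grid in another coordinate, where
   the signs on the faces say nothing. There the label is read off from [y i] alone. *)
pose lab (p : nat) (i : 'I_n) (y : 'I_n -> nat) : 'F_2 :=
  if `[< forall j, (y j <= p.+1)%N >] then (0 < F (pt p y) i)%R%:R
  else (y i == p.+1)%:R.
have lab_ok p : sperner_label p (lab p).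
  move=> i y; rewrite /lab; case: asboolP => yp; split=> yi; last by rewrite yi eqxx.
  - rewrite ltNge ltW// F_left//; first exact: pt_box.
    by rewrite mxE yi mul0r mul0r addr0.
  - rewrite F_right//; first exact: pt_box.
    by rewrite mxE yi divff ?pnatr_eq0// mul1r mulr2n addrA addNr add0r.
  - by rewrite yi.
have /choice[x xP] (p : nat) : exists x : 'I_n -> nat, (forall i, (x i <= p)%N) /\
    forall i, exists y y' : 'I_n -> nat,
    [/\ forall j, (x j <= y j <= (x j).+1)%N,
        forall j, (x j <= y' j <= (x j).+1)%N & lab p i y <> lab p i y'].
  have [x xP] := exists_full_cube (lab_ok p).
  by exists (fun i => x i); split => // i; rewrite -ltnS.
have xp p i : (x p i <= p)%N by have [+ _] := xP p; exact.
pose c p := pt p (fun i => x p i).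
have c_box p : box (c p) by apply: pt_box => i; exact: leqW.
have box_compact : compact box.
  have := @rV_compact R n (fun i => `[- r i, r i]%classic) (fun i => @segment_compact _ _ _).
  by congr compact; apply/seteqP; split=> z zi i; have := zi i; rewrite /= in_itv.
have [z [zbox zc]] : box `&` cluster (c @ \oo) !=set0.
  by apply: box_compact; exists 0%N => // p _; exact: c_box.
exists z => // i.
(* z is a cluster point of the corners of the cubes and the mesh tends to 0, so some whole cube
   enters any given neighbourhood of z. *)
have near_cube (A : set 'rV[R]_n) : nbhs z A -> exists p, forall y,
    (forall j, (x p j <= y j <= (x p j).+1)%N) -> A (pt p y).
  move=> /nbhs_ballP[e /= e0 eA].
  pose rmax := \sum_j r j.
  have rj j : r j <= rmax.
    by rewrite /rmax (bigD1 j)//= lerDl sumr_ge0// => ? _; exact: ltW.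
  have rmax0 : 0 < rmax by exact: lt_le_trans (r_gt0 ord0) (rj ord0).
  have [p0 p0e] : exists p0, forall p, (p0 <= p)%N -> (rmax *+ 2) / p.+1%:R < e / 2.
    have e2 : 0 < e / 2 by rewrite divr_gt0.
    exists (Num.bound (rmax *+ 2 / (e / 2))) => p pp.
    rewrite ltr_pdivrMr ?ltr0n// mulrC -ltr_pdivrMr//.
    apply: (lt_le_trans (archi_boundP _)).
      by rewrite divr_ge0 ?mulrn_wge0// ltW.
    by rewrite ler_nat leqW.
  have /zc/(_ (nbhsx_ballx z (e / 2) _))[] :
      (c @ \oo) [set w | exists2 p, (p0 <= p)%N & w = c p].
  - by exists p0 => //= p pp; exists p.
  - by rewrite divr_gt0.
  move=> _ [[p pp ->] zcp]; exists p => y yx; apply: eA.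
  have [_ zcp'] := zcp; split => // i' j; rewrite ord1.
  have := zcp' ord0 j; rewrite /ball /= => zj.
  have -> : z ord0 j - pt p y ord0 j = (z ord0 j - c p ord0 j) + (c p ord0 j - pt p y ord0 j).
    by rewrite addrA subrK.
  rewrite (le_lt_trans (ler_normD _ _))// (splitr e) ltrD//.
  rewrite !mxE opprD addrACA subrr add0r -mulrBl -mulrBl.
  apply: le_lt_trans (p0e p pp); rewrite !normrM normfV.
  rewrite mulrAC [`|p.+1%:R|]ger0_norm ?ler0n// ler_pM2r ?invr_gt0 ?ltr0n//.
  rewrite [`|r j *+ 2|]ger0_norm ?mulrn_wge0 ?(ltW (r_gt0 j))//.
  rewrite -[leRHS]mul1r ler_pM ?mulrn_wge0 ?(ltW (r_gt0 j)) ?lerMn2r ?rj//.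
  have /andP[y1 y2] := yx j; rewrite distrC -natrB// ger0_norm ?ler0n//.
  by rewrite (ler_nat _ _ 1); lia.
have both p : exists y y', [/\ (forall j, (x p j <= y j <= (x p j).+1)%N),
    (forall j, (x p j <= y' j <= (x p j).+1)%N), 0 < F (pt p y) i & F (pt p y') i <= 0].
  have [y [y' [yx yx' ll]]] := (xP p).2 i.
  have le_p (y0 : 'I_n -> nat) : (forall j, (x p j <= y0 j <= (x p j).+1)%N) ->
      forall j, (y0 j <= p.+1)%N.
    by move=> y0x j; have /andP[_ /leq_trans] := y0x j; apply; rewrite ltnS.
  move: ll; rewrite /lab !asboolT; [|exact: le_p..].
  case: (ltP 0 (F (pt p y) i)); case: (ltP 0 (F (pt p y') i)) => // Fy Fy' _.
    by exists y, y'.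
  by exists y', y.
(* A strict sign of [F z i] would persist on a whole small cube, against [both]. *)
apply/eqP; rewrite eq_le; apply/andP; split; rewrite leNgt; apply/negP => Fz.
  have /cvgr_gt/(_ 0 Fz)/near_cube[p pA] := @F_cont i z.
  have [y [y' [yx yx' _]]] := both p.
  by rewrite leNgt => /negP; apply; exact: pA.
have /cvgr_lt/(_ 0 Fz)/near_cube[p pA] := @F_cont i z.
have [y [y' [yx yx' + _]]] := both p.
by rewrite ltNge => /negP; apply; apply: ltW; exact: pA.
Unshelve. all: by end_near. Qed.

End miranda.

(** * The space L^2 *)

Lemma quadratic_ge0_discr (R : realFieldType) (a b c : R) : 0 <= a -> 0 <= c ->
  (forall t, 0 <= a + 2 * t * b + t ^+ 2 * c) -> b ^+ 2 <= a * c.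
Proof.
move=> a0 c0 q0; move: c0; rewrite le_eqVlt => /predU1P[c0|c0]; last first.
  have := q0 (- b / c).
  have -> : a + 2 * (- b / c) * b + (- b / c) ^+ 2 * c = a - b ^+ 2 / c.
    by field; rewrite gt_eqF.
  by rewrite subr_ge0 ler_pdivrMr.
rewrite -c0 mulr0; have [->|b0] := eqVneq b 0; first by rewrite expr0n.
(* For c = 0 the expression is affine in t; if b is nonzero, this t gives it the value -1. *)
have := q0 (- (a + 1) / (2 * b)).
have -> : a + 2 * (- (a + 1) / (2 * b)) * b + (- (a + 1) / (2 * b)) ^+ 2 * c = -1.
  by rewrite -c0; field.
by rewrite lerNr oppr0 ler10.
Qed.

Lemma exists_half_pow_le (R : archiRealFieldType) (e : R) : 0 < e ->
  exists n, 2^-1 ^+ n <= e.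
Proof.
move=> e0; exists (Num.bound e^-1).
rewrite exprVn invf_ple ?posrE ?exprn_gt0// (le_trans (ltW (archi_boundP _)))//.
  by rewrite invr_ge0 ltW.
by rewrite -natrX ler_nat ltnW// ltn_expl.
Qed.

Section L2_space.
Context {R : realType} {m : nat} (Om : set 'rV[R]_m).
Hypothesis mOm : measurable Om.
Local Notation mu := (@rV_lebesgue R m).
Local Notation fn := ('rV[R]_m -> R).
Implicit Types (u v w : fn) (a : R).
Local Notation "<< u , v >>" := (L2_inner Om u v).

Lemma measurable_sqr u : measurable_fun Om u ->
  measurable_fun Om (EFin \o (fun x => u x ^+ 2)).
Proof. by move=> mu_; apply/measurable_EFinP; exact: measurable_funX. Qed.

Lemma L2_integrableM u v : L2 Om u -> L2 Om v ->
  mu.-integrable Om (EFin \o (fun x => u x * v x)).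
Proof.
move=> [mu_ u2] [mv v2].
apply: (@le_integrable _ _ _ _ _ mOm _ (fun x => (u x ^+ 2)%:E + (v x ^+ 2)%:E)%E).
- by apply/measurable_EFinP; exact: measurable_funM.
- move=> x _ /=; rewrite lee_fin [leRHS]ger0_norm ?addr_ge0 ?sqr_ge0//.
  by rewrite ler_norml; apply/andP; split; nra.
- apply: integrableD => //; apply/integrableP; split; try exact: measurable_sqr.
  + by under eq_integral do rewrite gee0_abs ?lee_fin ?sqr_ge0//.
  + by under eq_integral do rewrite gee0_abs ?lee_fin ?sqr_ge0//.
Qed.

Lemma integrable_L2 u : measurable_fun Om u ->
  mu.-integrable Om (EFin \o (fun x => u x * u x)) -> L2 Om u.
Proof.
move=> mu_ /integrableP[_ i2]; split => //; apply: le_lt_trans i2.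
by under [leRHS]eq_integral do rewrite /= ger0_norm -?expr2 ?sqr_ge0//.
Qed.

Lemma L2_measurable u : L2 Om u -> measurable_fun Om u.
Proof. by case. Qed.

Lemma L2_le u v a : measurable_fun Om u -> L2 Om v ->
  (forall x, Om x -> `|u x| <= a * `|v x|) -> L2 Om u.
Proof.
move=> mu_ v2 uv; apply: integrable_L2 => //.
apply: (@le_integrable _ _ _ _ _ mOm _ (fun x => (a ^+ 2)%:E * (v x * v x)%:E)%E).
- by apply/measurable_EFinP; exact: measurable_funM.
- move=> x Ox /=; rewrite lee_fin normrM -expr2.
  rewrite (le_trans _ (ler_norm _))// -[v x * v x]expr2 -[v x ^+ 2]real_normK ?num_real//.
  by rewrite -exprMn ler_sqr ?nnegrE ?uv// (le_trans _ (uv x Ox)).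
- exact: integrableZl (L2_integrableM v2 v2).
Qed.

Lemma L2_0 : L2 Om 0.
Proof.
split; first exact: measurable_cst.
by rewrite integral0_eq ?ltry// => x _ /=; rewrite expr0n.
Qed.

Lemma L2D u v : L2 Om u -> L2 Om v -> L2 Om (u + v).
Proof.
move=> u2 v2; have [mu_ _] := u2; have [mv _] := v2.
apply: integrable_L2; first exact: measurable_funD.
have -> : EFin \o (fun x => (u + v) x * (u + v) x) =
   (fun x => (u x * u x)%:E + (2%:E * (u x * v x)%:E + (v x * v x)%:E))%E.
  by apply/funext => x /=; rewrite addrfctE; congr EFin; ring.
apply: integrableD => //; first exact: L2_integrableM.
apply: integrableD => //; last exact: L2_integrableM.
exact: integrableZl (L2_integrableM u2 v2).
Qed.

Lemma L2Z a u : L2 Om u -> L2 Om (a *: u).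
Proof.
move=> u2; have [mu_ _] := u2; apply: (L2_le (a := `|a|) _ u2).
  exact: measurable_funM.
by move=> x _; rewrite normrM.
Qed.

Lemma L2N u : L2 Om u -> L2 Om (- u).
Proof. by rewrite -scaleN1r; exact: L2Z. Qed.

Lemma L2B u v : L2 Om u -> L2 Om v -> L2 Om (u - v).
Proof. by move=> u2 v2; apply: L2D => //; exact: L2N. Qed.

Lemma L2_sum (I : Type) (r : seq I) (P : pred I) (F : I -> fn) :
  (forall i, P i -> L2 Om (F i)) -> L2 Om (\sum_(i <- r | P i) F i).
Proof. by move=> F2; elim/big_ind : _ => //; [exact: L2_0|exact: L2D]. Qed.

Lemma eq_L2_inner u u' v v' : (forall x, Om x -> u x * v x = u' x * v' x) ->
  << u, v >> = << u', v' >>.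
Proof. by move=> e; apply: eq_Rintegral => x; rewrite inE; exact: e. Qed.

Lemma L2_innerC u v : << u, v >> = << v, u >>.
Proof. by apply: eq_L2_inner => x _; rewrite mulrC. Qed.

Lemma L2_innerDl u v w : L2 Om u -> L2 Om v -> L2 Om w ->
  << u + v, w >> = << u, w >> + << v, w >>.
Proof.
move=> u2 v2 w2; rewrite -RintegralD//; try exact: L2_integrableM.
by apply: eq_Rintegral => x _; rewrite -mulrDl.
Qed.

Lemma L2_innerZl a u w : L2 Om u -> L2 Om w -> << a *: u, w >> = a * << u, w >>.
Proof.
move=> u2 w2; rewrite -RintegralZl//; try exact: L2_integrableM.
by apply: eq_Rintegral => x _; rewrite mulrA.
Qed.

Lemma L2_inner0l w : << 0, w >> = 0.
Proof.
transitivity (\int[mu]_(x in Om) (0 : R)).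
  by apply: eq_Rintegral => x _; rewrite mul0r.
by rewrite Rintegral_cst// mul0r.
Qed.

Lemma L2_innerNl u w : L2 Om u -> L2 Om w -> << - u, w >> = - << u, w >>.
Proof. by move=> u2 w2; rewrite -scaleN1r L2_innerZl// mulN1r. Qed.

Lemma L2_innerBl u v w : L2 Om u -> L2 Om v -> L2 Om w ->
  << u - v, w >> = << u, w >> - << v, w >>.
Proof. by move=> u2 v2 w2; rewrite L2_innerDl ?L2_innerNl//; exact: L2N. Qed.

Lemma L2_innerDr u v w : L2 Om u -> L2 Om v -> L2 Om w ->
  << w, u + v >> = << w, u >> + << w, v >>.
Proof. by move=> *; rewrite L2_innerC L2_innerDl// !(L2_innerC w). Qed.

Lemma L2_innerZr a u w : L2 Om u -> L2 Om w -> << w, a *: u >> = a * << w, u >>.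
Proof. by move=> *; rewrite L2_innerC L2_innerZl// L2_innerC. Qed.

Lemma L2_innerBr u v w : L2 Om u -> L2 Om v -> L2 Om w ->
  << w, u - v >> = << w, u >> - << w, v >>.
Proof. by move=> *; rewrite L2_innerC L2_innerBl// !(L2_innerC w). Qed.

Lemma L2_inner_suml (I : Type) (r : seq I) (P : pred I) (F : I -> fn) w :
  (forall i, P i -> L2 Om (F i)) -> L2 Om w ->
  << \sum_(i <- r | P i) F i, w >> = \sum_(i <- r | P i) << F i, w >>.
Proof.
move=> F2 w2; suff [//] : L2 Om (\sum_(i <- r | P i) F i) /\
    << \sum_(i <- r | P i) F i, w >> = \sum_(i <- r | P i) << F i, w >>.
elim/big_ind2 : _ => [|u a v b [u2 <-] [v2 <-]|i Pi]; last by split => //; exact: F2.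
  by split; [exact: L2_0|exact: L2_inner0l].
by split; [exact: L2D|exact: L2_innerDl].
Qed.

Lemma L2_inner_sumr (I : Type) (r : seq I) (P : pred I) (F : I -> fn) w :
  (forall i, P i -> L2 Om (F i)) -> L2 Om w ->
  << w, \sum_(i <- r | P i) F i >> = \sum_(i <- r | P i) << w, F i >>.
Proof.
move=> F2 w2; rewrite L2_innerC L2_inner_suml//.
by apply: eq_bigr => i _; rewrite L2_innerC.
Qed.

Lemma L2_inner_ge0 u : 0 <= << u, u >>.
Proof. by apply: Rintegral_ge0 => x _; rewrite -expr2 sqr_ge0. Qed.

Lemma L2_innerE u : L2 Om u -> (\int[mu]_(x in Om) (u x ^+ 2)%:E = << u, u >>%:E)%E.
Proof.
move=> u2; rewrite /L2_inner /Rintegral fineK.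
  by apply: eq_integral => x _; rewrite expr2.
by apply: integrable_fin_num => //; exact: (L2_integrableM u2 u2).
Qed.

Definition L2_norm u : R := Num.sqrt << u, u >>.
Local Notation "`N u" := (L2_norm u) (at level 9).

Lemma L2_norm_ge0 u : 0 <= `N u. Proof. exact: sqrtr_ge0. Qed.
Hint Resolve L2_norm_ge0 : core.

Lemma sqr_L2_norm u : `N u ^+ 2 = << u, u >>.
Proof. by rewrite sqr_sqrtr// L2_inner_ge0. Qed.

Lemma cauchy_schwarz u v : L2 Om u -> L2 Om v -> `|<< u, v >>| <= `N u * `N v.
Proof.
move=> u2 v2; rewrite -ler_sqr ?nnegrE ?mulr_ge0//.
rewrite real_normK ?num_real// exprMn !sqr_L2_norm.
apply: quadratic_ge0_discr; [exact: L2_inner_ge0..|] => t.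
have tv := L2Z t v2; have := L2_inner_ge0 (u + t *: v).
rewrite L2_innerDl ?L2_innerDr ?L2_innerZl ?L2_innerZr//; try exact: L2D.
by rewrite (L2_innerC v u); congr (0 <= _); ring.
Qed.

Lemma le_cauchy_schwarz u v : L2 Om u -> L2 Om v -> << u, v >> <= `N u * `N v.
Proof. by move=> u2 v2; apply: le_trans (ler_norm _) (cauchy_schwarz u2 v2). Qed.

Lemma L2_normZ a u : L2 Om u -> `N (a *: u) = `|a| * `N u.
Proof.
move=> u2; rewrite /L2_norm L2_innerZl ?L2_innerZr//; try exact: L2Z.
by rewrite mulrA -expr2 sqrtrM ?sqr_ge0// sqrtr_sqr.
Qed.

Lemma L2_normN u : L2 Om u -> `N (- u) = `N u.
Proof. by move=> u2; rewrite -scaleN1r L2_normZ// normrN1 mul1r. Qed.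

Lemma L2_norm0 : `N 0 = 0.
Proof. by rewrite /L2_norm L2_inner0l sqrtr0. Qed.

Lemma ler_L2_normD u v : L2 Om u -> L2 Om v -> `N (u + v) <= `N u + `N v.
Proof.
move=> u2 v2; rewrite -ler_sqr ?nnegrE ?addr_ge0// sqr_L2_norm.
rewrite L2_innerDl ?L2_innerDr//; try exact: L2D.
rewrite sqrrD !sqr_L2_norm (L2_innerC v u).
by have := le_cauchy_schwarz u2 v2; lra.
Qed.

Lemma L2_norm_distC u v : L2 Om u -> L2 Om v -> `N (u - v) = `N (v - u).
Proof. by move=> u2 v2; rewrite -[RHS]L2_normN ?opprB//; exact: L2B. Qed.

Lemma ler_L2_norm_dist u v w : L2 Om u -> L2 Om v -> L2 Om w ->
  `N (u - w) <= `N (u - v) + `N (v - w).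
Proof.
move=> u2 v2 w2; have -> : u - w = (u - v) + (v - w) by rewrite addrA subrK.
by apply: ler_L2_normD; exact: L2B.
Qed.

Lemma ler_L2_norm_sum (I : Type) (r : seq I) (P : pred I) (F : I -> fn) :
  (forall i, P i -> L2 Om (F i)) ->
  `N (\sum_(i <- r | P i) F i) <= \sum_(i <- r | P i) `N (F i).
Proof.
move=> F2; suff [//] : L2 Om (\sum_(i <- r | P i) F i) /\
    `N (\sum_(i <- r | P i) F i) <= \sum_(i <- r | P i) `N (F i).
elim/big_ind2 : _ => [|u a v b [u2 ua] [v2 vb]|i Pi]; last by split => //; exact: F2.
  by rewrite L2_norm0; split => //; exact: L2_0.
by split; [exact: L2D|exact: le_trans (ler_L2_normD _ _) (lerD _ _)].
Qed.

Lemma ler_L2_norm u v : L2 Om u -> L2 Om v ->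
  (forall x, Om x -> `|u x| <= `|v x|) -> `N u <= `N v.
Proof.
move=> u2 v2 uv; rewrite ler_sqrt ?L2_inner_ge0//.
apply: le_Rintegral => //; try exact: L2_integrableM.
by move=> x Ox; rewrite -!expr2 -[leLHS]real_normK ?num_real//
  -[leRHS]real_normK ?num_real// ler_sqr ?nnegrE ?uv.
Qed.

Lemma ler_L2_normZ a u v : L2 Om u -> L2 Om v -> 0 <= a ->
  (forall x, Om x -> `|u x| <= a * `|v x|) -> `N u <= a * `N v.
Proof.
move=> u2 v2 a0 uv; rewrite -[X in X * _]ger0_norm// -L2_normZ//.
apply: ler_L2_norm => //; first exact: L2Z.
by move=> x Ox; rewrite normrM (ger0_norm a0) uv.
Qed.

Lemma L2_norm_eq0 u : L2 Om u -> `N u = 0 -> {ae mu, forall x, Om x -> u x = 0}.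
Proof.
move=> u2 u0; have mu2 := measurable_sqr u2.1.
have : (\int[mu]_(x in Om) `|(u x ^+ 2)%:E|)%E = 0%E.
  under eq_integral do rewrite gee0_abs ?lee_fin ?sqr_ge0//.
  by rewrite L2_innerE// -sqr_L2_norm u0 expr0n.
move=> /(ae_eq_integral_abs mu mOm mu2); apply: filterS => x ux0 Ox.
by have /eqP := ux0 Ox; rewrite eqe sqrf_eq0 => /eqP.
Qed.

Lemma ae_eq_L2_inner u u' v : L2 Om u -> L2 Om u' -> L2 Om v ->
  {ae mu, forall x, Om x -> u x = u' x} -> << u, v >> = << u', v >>.
Proof.
move=> [mu_ _] [mu' _] [mv _] uu'; congr fine; apply: ae_eq_integral => //.
- by apply/measurable_EFinP; exact: measurable_funM.
- by apply/measurable_EFinP; exact: measurable_funM.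
- by apply: filterS uu' => x uu' Ox; rewrite uu'.
Qed.

(** * Completeness of L^2 on a set of finite measure *)

Section finite_measure.
Hypothesis Om_fin : (mu Om < +oo)%E.

Lemma L2_bounded u a : measurable_fun Om u -> (forall x, Om x -> `|u x| <= a) ->
  L2 Om u.
Proof.
move=> mu_ ua; apply: integrable_L2 => //.
apply: (@le_integrable _ _ _ _ _ mOm _ (cst (a ^+ 2)%:E)).
- by apply/measurable_EFinP; exact: measurable_funM.
- move=> x Ox /=; rewrite lee_fin normrM -expr2 (le_trans _ (ler_norm _))//.
  by rewrite ler_sqr ?nnegrE ?ua// (le_trans _ (ua x Ox)).
- exact: measurable_bounded_integrable (bounded_cst _ _).
Qed.

Lemma L2_norm_bounded u a : measurable_fun Om u -> 0 <= a ->
  (forall x, Om x -> `|u x| <= a) -> `N u <= a * `N (cst 1).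
Proof.
move=> mu_ a0 ua; apply: ler_L2_normZ => //; first exact: L2_bounded ua.
  by apply: (@L2_bounded _ 1) => // x _ /=; rewrite normr1.
by move=> x Ox; rewrite normr1 mulr1 ua.
Qed.

Lemma L2_cst a : L2 Om (cst a).
Proof. by apply: (@L2_bounded _ `|a|) => // x _. Qed.

Lemma integral_norm_le u : L2 Om u ->
  (\int[mu]_(x in Om) `|u x|%:E <= (`N u * `N (cst 1))%:E)%E.
Proof.
move=> u2; have nu2 : L2 Om (fun x => `|u x|).
  apply: (L2_le (a := 1) _ u2); last by move=> x _; rewrite normr_id mul1r.
  by apply: measurableT_comp => //; exact: u2.1.
have -> : `N u = `N (fun x => `|u x|).
  by congr Num.sqrt; apply: eq_L2_inner => x _; rewrite -!expr2 real_normK ?num_real.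
apply: le_trans (_ : (<< (fun x => `|u x|), cst 1 >>%:E <= _)%E); last first.
  by rewrite lee_fin; apply: le_cauchy_schwarz => //; exact: L2_cst.
rewrite /L2_inner /Rintegral fineK.
  by under [leRHS]eq_integral do rewrite mulr1.
by apply: integrable_fin_num => //; exact: (L2_integrableM nu2 (L2_cst 1)).
Qed.

(** On a set of finite measure the L^1 norms of the increments are summable too, so the series of
    their absolute values is integrable and hence finite almost everywhere. *)
Lemma ae_cvg_fast_cauchy (u : nat -> fn) : (forall n, L2 Om (u n)) ->
  (forall n, `N (u n.+1 - u n) <= 2^-1 ^+ n) ->
  {ae mu, forall x, Om x -> cvgn (fun n => u n x)}.
Proof.
move=> u2 du; pose f n x := (`|u n.+1 x - u n x|)%:E.
have d2 n : L2 Om (u n.+1 - u n) by exact: L2B.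
have mf n : measurable_fun Om (f n).
  by apply/measurable_EFinP/measurableT_comp => //; exact: (d2 n).1.
have f0 n x : Om x -> (0 <= f n x)%E by rewrite lee_fin.
have sf : (\int[mu]_(x in Om) (\sum_(n <oo) f n x) < +oo)%E.
  rewrite integral_nneseries//.
  apply: (@le_lt_trans _ _ (\sum_(n <oo) (`N (cst 1) * 2^-1 ^+ n)%:E)%E).
    apply: lee_nneseries => n _; first by move=> _; apply: integral_ge0 => x; exact: f0.
    apply: le_trans (integral_norm_le (d2 n)) _.
    by rewrite lee_fin mulrC ler_wpM2l.
  apply: (@le_lt_trans _ _ (`N (cst 1) * 2)%:E); last exact: ltry.
  apply: lime_le; first by apply: is_cvg_nneseries => n _ _; rewrite lee_fin mulr_ge0// exprn_ge0.
  apply: nearW => n; rewrite sumEFin lee_fin -mulr_sumr ler_wpM2l//.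
  have -> : \sum_(0 <= i < n) 2^-1 ^+ i = 2 - 2 * 2^-1 ^+ n :> R.
    elim: n => [|n IH]; first by rewrite big_nil expr0 mulr1 subrr.
    by rewrite big_nat_recr//= IH exprS; field.
  by rewrite gerBl mulr_ge0// exprn_ge0.
have : mu.-integrable Om (fun x => \sum_(n <oo) f n x)%E.
  apply/integrableP; split.
    by apply: ge0_emeasurable_sum => // n x Ox _; exact: f0.
  under eq_integral => x /set_mem Ox.
    rewrite gee0_abs; last by apply: nneseries_ge0 => n _ _; exact: f0.
    over.
  exact: sf.
move=> /(integrable_ae mOm); apply: filterS => x fx Ox.
have {}fx := fx Ox.
have : cvgn (series (fun n => u n.+1 x - u n x)).
  apply: normed_cvg; apply: nondecreasing_is_cvgn.
    by apply/nondecreasing_seqP => n /=; rewrite /series /= big_nat_recr//= lerDl.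
  exists (fine (\sum_(n <oo) f n x)) => _ [n _ <-].
  rewrite -lee_fin fineK// /= -sumEFin.
  by apply: (@nneseries_lim_ge _ _ xpredT 0) => k _ _; exact: f0.
move=> /cvg_ex[l dl]; apply/cvg_ex; exists (u 0%N x + l).
have -> : (fun n => u n x) = (fun n => u 0%N x + series (fun n => u n.+1 x - u n x) n).
  apply/funext => n; rewrite /series /= telescope_sumr//.
  by rewrite addrCA subrr addr0.
by apply: cvgD => //; exact: cvg_cst.
Qed.

Lemma L2_dist_fast_cauchy (u : nat -> fn) : (forall n, L2 Om (u n)) ->
  (forall n, `N (u n.+1 - u n) <= 2^-1 ^+ n) ->
  forall n j, `N (u (n + j)%N - u n) <= 2 * 2^-1 ^+ n.
Proof.
move=> u2 du n j; have h0 k : 0 <= 2^-1 ^+ k :> R by rewrite exprn_ge0.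
suff : `N (u (n + j)%N - u n) <= 2 * 2^-1 ^+ n - 2 * 2^-1 ^+ (n + j).
  by move/le_trans; apply; rewrite gerBl mulr_ge0.
elim: j => [|j IH]; first by rewrite addn0 !subrr L2_norm0.
rewrite addnS (le_trans (ler_L2_norm_dist (u2 _) (u2 (n + j)%N) (u2 _)))//.
by have := du (n + j)%N; rewrite exprS; lra.
Qed.

Lemma riesz_fischer (u : nat -> fn) : (forall n, L2 Om (u n)) ->
  (forall n, `N (u n.+1 - u n) <= 2^-1 ^+ n) ->
  exists v, [/\ L2 Om v, {ae mu, forall x, Om x -> (fun n => u n x) @ \oo --> v x} &
    forall n, `N (u n - v) <= 2 * 2^-1 ^+ n].
Proof.
move=> u2 du; have cu := ae_cvg_fast_cauchy u2 du.
have uj := L2_dist_fast_cauchy u2 du.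
(* The upper limit is measurable on all of Om and is the limit wherever there is one; [fine] sends
   infinite values to 0. *)
pose v x := fine (limn_esup (fun n => (u n x)%:E)).
have mv : measurable_fun Om v.
  apply: (@measurableT_comp _ _ _ _ _ _ (@fine R)); [exact: fine_measurable|].
  by apply: measurable_fun_limn_esup => n; apply/measurable_EFinP; exact: (u2 n).1.
have uv : {ae mu, forall x, Om x -> (fun n => u n x) @ \oo --> v x}.
  apply: filterS cu => x cx Ox; have /cvg_ex[l ul] := cx Ox.
  suff -> : v x = l by [].
  have /cvg_limn_einf_sup[_] : (fun n => (u n x)%:E) @ \oo --> l%:E.
    by apply/cvg_EFin; [exact: nearW|].
  by rewrite /v => ->.
have uvn n : (\int[mu]_(x in Om) ((u n x - v x) ^+ 2)%:E <= ((2 * 2^-1 ^+ n) ^+ 2)%:E)%E.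
  pose f k x := ((u n x - u k x) ^+ 2)%:E.
  have mf k : measurable_fun Om (f k).
    by apply: measurable_sqr; exact: (L2B (u2 n) (u2 k)).1.
  have f0 k x : Om x -> (0 <= f k x)%E by rewrite lee_fin sqr_ge0.
  have mlim : measurable_fun Om (fun x => limn_einf (f^~ x)).
    rewrite (_ : (fun x => _) = (fun x => - limn_esup (fun k => - f k x))%E).
      by apply: measurableT_comp => //; apply: measurable_fun_limn_esup => k;
        exact: measurableT_comp.
    by [].
  apply: (@le_trans _ _ (\int[mu]_(x in Om) limn_einf (f^~ x))%E).
    rewrite le_eqVlt; apply/orP; left; apply/eqP/ae_eq_integral => //.
      by apply: measurable_sqr; apply: measurable_funB => //; exact: (u2 n).1.
    apply: filterS uv => x ux Ox; have {}ux := ux Ox.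
    have /cvg_limn_einf_sup[-> _] // : f ^~ x @ \oo --> ((u n x - v x) ^+ 2)%:E.
    apply/cvg_EFin; first exact: nearW.
    by apply: (@cvg_comp _ _ _ (fun k => u n x - u k x) (fun y => y ^+ 2) _ (nbhs (u n x - v x)));
      [apply: cvgB => //; exact: cvg_cst|exact: exprn_continuous].
  apply: le_trans (fatou mu mOm mf f0) _.
  rewrite limn_einf_lim; apply: lime_le; first exact: is_cvg_einfs.
  (* The index must be at least N to enter the infimum and at least n for [uj]. *)
  apply: nearW => N; apply: (@le_trans _ _ (\int[mu]_(x in Om) f (maxn n N) x)%E).
    by apply: ereal_inf_lbound; exists (maxn n N) => //=; exact: leq_maxr.
  rewrite L2_innerE; last exact: L2B.
  rewrite lee_fin -sqr_L2_norm ler_sqr ?nnegrE ?mulr_ge0 ?exprn_ge0//.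
  rewrite L2_norm_distC//; have := uj n (maxn n N - n)%N.
  by rewrite subnKC// leq_maxl.
have d2 n : L2 Om (u n - v).
  split; first by apply: measurable_funB => //; exact: (u2 n).1.
  by apply: le_lt_trans (uvn n) _; rewrite ltry.
have v2 : L2 Om v.
  have -> : v = u 0%N - (u 0%N - v) by rewrite opprB addrC subrK.
  exact: L2B.
exists v; split => // n; rewrite -ler_sqr ?nnegrE ?mulr_ge0 ?exprn_ge0//.
by rewrite sqr_L2_norm -lee_fin -L2_innerE; [exact: uvn|exact: d2].
Qed.

Lemma L2_complete (u : nat -> fn) : (forall n, L2 Om (u n)) ->
  (forall e, 0 < e -> exists N, forall p q, (N <= p)%N -> (N <= q)%N ->
     `N (u p - u q) <= e) ->
  exists2 v, L2 Om v & forall e, 0 < e -> exists N, forall n, (N <= n)%N ->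
     `N (u n - v) <= e.
Proof.
move=> u2 cu.
have h0 k : 0 < 2^-1 ^+ k :> R by rewrite exprn_gt0.
have /choice[M MP] (j : nat) : exists M, forall p q, (M <= p)%N -> (M <= q)%N ->
    `N (u p - u q) <= 2^-1 ^+ j by exact: cu.
(* Partial sums make the indices nondecreasing while keeping s j above M j. *)
pose s j := \sum_(i < j.+1) M i.
have sM j : (M j <= s j)%N by rewrite /s big_ord_recr leq_addl.
have sS j : (s j <= s j.+1)%N by rewrite {2}/s big_ord_recr leq_addr.
have [||v [v2 _ uv]] := @riesz_fischer (u \o s); first by move=> n; exact: u2.
  by move=> n; apply: MP => //; exact: leq_trans (sS n).
exists v => // e e0; have [j je] := exists_half_pow_le (divr_gt0 e0 (ltr0Sn _ 2)).
exists (M j) => n nM.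
apply: le_trans (ler_L2_norm_dist (u2 n) (u2 (s j)) v2) _.
have := uv j; have := MP j n (s j) nM (sM j); move=> /=; lra.
Qed.

End finite_measure.

End L2_space.

(** * Shears and Lebesgue measure *)

Lemma lebesgue_measure_translation (R : realType) (c : R)
    (B : set (measurableTypeR R)) : measurable B ->
  lebesgue_measure ((fun a : R => a + c) @^-1` B) = lebesgue_measure B.
Proof.
move=> mB.
have mc : measurable_fun setT (fun a : measurableTypeR R => a + c : measurableTypeR R).
  exact: measurable_funD.
apply/esym; rewrite -[RHS]/(pushforward (@lebesgue_measure R) (fun a => a + c) B).
apply: (@lebesgue_measure_unique R (pushforward lebesgue_measure
  (fun a : measurableTypeR R => a + c : measurableTypeR R))) => //=.
move=> _ [[a b]] _ <-; rewrite /pushforward.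
rewrite (_ : _ @^-1` _ = `]a - c, b - c]%classic); last first.
  apply/seteqP; split=> x /=; rewrite !in_itv /=.
    by rewrite ltrBlDr lerBrDr.
  by rewrite ltrBlDr lerBrDr.
rewrite !lebesgue_measure_itv /= !lte_fin ltrD2r.
by case: ifPn => // _; congr EFin; ring.
Qed.

Section shear.
Context {R : realType}.

Definition shear m (i : 'I_m) (A : 'rV[R]_m -> R) (x : 'rV[R]_m) : 'rV[R]_m :=
  x + A x *: delta_mx ord0 i.

Definition indep_of m (i : 'I_m) (A : 'rV[R]_m -> R) : Prop :=
  forall x t, A (x + t *: delta_mx ord0 i) = A x.

Lemma shearE m (i : 'I_m) (A : 'rV[R]_m -> R) x j :
  shear i A x ord0 j = x ord0 j + (if j == i then A x else 0).
Proof.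
by rewrite !mxE eqxx /= eq_sym; case: eqVneq => _; rewrite ?mulr1 ?mulr0.
Qed.

Lemma measurable_shear m (i : 'I_m) A : measurable_fun setT A ->
  measurable_fun setT (shear i A).
Proof.
move=> mA; apply: measurable_fun_rV => j; rewrite /comp /rV_coord.
under eq_fun do rewrite shearE.
apply: measurable_funD; first exact: measurable_rV_coord.
by case: eqVneq.
Qed.

Lemma rV_consD m (a b : R) (v w : 'rV[R]_m) :
  rV_cons (a, v) + rV_cons (b, w) = rV_cons (a + b, v + w).
Proof.
apply/rowP => j; rewrite mxE; case: (unliftP ord0 j) => [k ->|->].
  by rewrite !rV_consS mxE.
by rewrite !rV_cons0.
Qed.

Lemma scale_delta_lift m (t : R) (j : 'I_m) :
  t *: delta_mx ord0 (lift ord0 j) = rV_cons (0, t *: delta_mx ord0 j).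
Proof.
apply/rowP => k; case: (unliftP ord0 k) => [l ->|->].
  by rewrite rV_consS !mxE (inj_eq lift_inj).
by rewrite rV_cons0 !mxE /= mulr0.
Qed.

Lemma scale_delta0 m (t : R) :
  t *: delta_mx ord0 (ord0 : 'I_m.+1) = rV_cons (t, 0).
Proof.
apply/rowP => k; case: (unliftP ord0 k) => [l ->|->].
  by rewrite rV_consS !mxE /= mulr0.
by rewrite rV_cons0 !mxE !eqxx mulr1.
Qed.

(** Induction on the dimension along the product structure of the measure. If i is not the first
    coordinate, every section at a fixed first coordinate is sheared in one dimension less. If it
    is, the order of integration is exchanged, and every line parallel to the first axis is
    translated by a constant. *)
Lemma measure_shear m (i : 'I_m) A (E : set 'rV[R]_m) :
  measurable_fun setT A -> indep_of i A -> measurable E ->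
  rV_lebesgue m (shear i A @^-1` E) = rV_lebesgue m E.
Proof.
elim: m i A E => [[] //|m IH] i A E mA iA mE.
have mS : measurable (shear i A @^-1` E).
  by rewrite -[X in measurable X]setTI; exact: measurable_shear.
have mcons (B : set 'rV[R]_m.+1) : measurable B -> measurable (@rV_cons R m @^-1` B).
  by move=> mB; rewrite -[X in measurable X]setTI; exact: measurable_rV_cons.
rewrite /= /rV_cons_measure /pushforward.
case: (unliftP ord0 i) => [j|] ij.
  apply: eq_integral => a _ /=.
  have <- : rV_lebesgue m (shear j (fun v => A (rV_cons (a, v))) @^-1`
      xsection (@rV_cons R m @^-1` E) a) =
      rV_lebesgue m (xsection (@rV_cons R m @^-1` E) a).
    apply: IH.
    - apply: measurableT_comp => //; apply: measurableT_comp (@measurable_rV_cons R m) _.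
      exact: pair1_measurable.
    - move=> v t; rewrite -(iA (rV_cons (a, v)) t) ij scale_delta_lift rV_consD.
      by rewrite addr0.
    - by apply: measurable_xsection; exact: mcons.
  congr (rV_lebesgue m _); apply/seteqP; split=> v /=;
    rewrite /xsection /= !inE /= /shear ij scale_delta_lift rV_consD addr0//.
have pmE B : measurable B -> (lebesgue_measure \x rV_lebesgue m)%E B =
    (lebesgue_measure \x^ rV_lebesgue m)%E B.
  move=> mB; apply: product_measure_unique => // *; exact: product_measure2E.
rewrite !pmE; [|exact: mcons..].
apply: eq_integral => v _ /=.
pose c := A (rV_cons (0, v)).
have cE a : A (rV_cons (a, v)) = c.
  by rewrite /c -(iA (rV_cons (0, v)) a) ij scale_delta0 rV_consD add0r addr0.
rewrite -(@lebesgue_measure_translation R c (ysection (@rV_cons R m @^-1` E) v)); last first.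
  by apply: measurable_ysection; exact: mcons.
congr (lebesgue_measure _); apply/seteqP; split=> a /=;
  by rewrite /ysection /= !inE /= /shear cE ij scale_delta0 rV_consD addr0.
Qed.

Variables (m : nat) (i : 'I_m) (A : 'rV[R]_m -> R).
Hypotheses (mA : measurable_fun setT A) (iA : indep_of i A).
Local Notation mu := (@rV_lebesgue R m).

Lemma ge0_integral_shear (f : 'rV[R]_m -> \bar R) : measurable_fun setT f ->
  (forall x, 0 <= f x)%E -> (\int[mu]_x f (shear i A x) = \int[mu]_x f x)%E.
Proof.
move=> mf f0; transitivity (\int[pushforward mu (shear i A)]_x f x)%E.
  rewrite ge0_integral_pushforward ?preimage_setT//.
  exact: measurable_shear.
apply: eq_measure_integral; first exact: measurable_shear.
by move=> ? E mE _; exact: measure_shear.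
Qed.

Lemma Rintegral_shear (f : 'rV[R]_m -> R) : measurable_fun setT f ->
  \int[mu]_x f (shear i A x) = \int[mu]_x f x.
Proof.
move=> mf; rewrite /Rintegral integralE [in RHS]integralE; congr (fine (_ - _)%E).
  rewrite -[RHS](@ge0_integral_shear ((EFin \o f)^\+)%E)//.
    by apply: eq_integral => x _; rewrite !funeposE.
  by apply: measurable_funepos; exact/measurable_EFinP.
rewrite -[RHS](@ge0_integral_shear ((EFin \o f)^\-)%E)//.
  by apply: eq_integral => x _; rewrite !funenegE.
by apply: measurable_funeneg; exact/measurable_EFinP.
Qed.

End shear.

(** * Smooth functions and test functions *)

Section one_dim.
Context {R : realType}.

Lemma mean_value (f df : R -> R) a b :
  (forall x : R, is_derive x 1 f (df x)) ->
  exists2 c, `|c - a| <= `|b - a| & f b - f a = df c * (b - a).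
Proof.
move=> fdf; have fc : continuous f.
  by move=> x; apply/differentiable_continuous/derivable1_diffP; have [] := fdf x.
have fcw (x y : R) : {within `[x, y], continuous f} by exact: continuous_subspaceT.
have [ab|/ltW ba] := leP a b.
  have [c /[!in_itv]/= /andP[ac cb] ->] := MVT_segment ab (fun x _ => fdf x) (fcw _ _).
  by exists c => //; rewrite !ger0_norm ?subr_ge0// lerD2r.
have [c /[!in_itv]/= /andP[bc ca] e] := MVT_segment ba (fun x _ => fdf x) (fcw _ _).
exists c; last by rewrite -opprB e -mulrN opprB.
by rewrite !ler0_norm ?subr_le0// lerN2 lerD2r.
Qed.

(** The powers of t are included so that derivatives of members of the family are linear
    combinations of members. *)
Definition flat (n : nat) (t : R) : R := if 0 < t then t ^- n * expR (- t^-1) else 0.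

Lemma flat_ge0 n t : 0 <= flat n t.
Proof. by rewrite /flat; case: ifPn => // t0; rewrite mulr_ge0 ?expR_ge0// invr_ge0 exprn_ge0// ltW. Qed.

Lemma flat_gt0 n t : 0 < t -> 0 < flat n t.
Proof. by move=> t0; rewrite /flat t0 mulr_gt0 ?expR_gt0// invr_gt0 exprn_gt0. Qed.

Lemma flat_le0 n t : t <= 0 -> flat n t = 0.
Proof. by move=> t0; rewrite /flat ltNge t0. Qed.

(** For s = 1/t, the inequality e^s >= (s/(n+1))^(n+1) beats the power t^(-n) with one factor t to
    spare. This factor makes the difference quotients at the origin, which are values of
    [flat n.+1], tend to 0. *)
Lemma flat_le n t : `|flat n t| <= n.+1%:R ^+ n.+1 * `|t|.
Proof.
rewrite ger0_norm ?flat_ge0// /flat; case: ifPn => [t0|_]; last first.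
  by rewrite mulr_ge0// exprn_ge0.
rewrite gtr0_norm//.
have N0 : 0 < n.+1%:R :> R by rewrite ltr0n.
have : (t^-1 / n.+1%:R) ^+ n.+1 <= expR t^-1.
  have {2}-> : t^-1 = n.+1%:R * (t^-1 / n.+1%:R) by field; rewrite !gt_eqF.
  rewrite expRM_natl ler_pXn2r ?nnegrE ?expR_ge0 ?divr_ge0 ?invr_ge0 ?(ltW t0)//.
  by apply: le_trans (expR_ge1Dx _); rewrite lerDr.
rewrite -lef_pV2 ?posrE ?expR_gt0 ?exprn_gt0 ?divr_gt0 ?invr_gt0// -expRN => h.
have -> : n.+1%:R ^+ n.+1 * t = t ^- n * ((t^-1 / n.+1%:R) ^+ n.+1)^-1.
  by rewrite exprMn !exprVn invfM !invrK [t ^+ n.+1]exprS; field; rewrite expf_neq0 ?gt_eqF.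
by rewrite ler_wpM2l// invr_ge0 exprn_ge0// ltW.
Qed.

Lemma is_derive_flat n (t : R) :
  is_derive t 1 (flat n) (flat n.+2 t - n%:R * flat n.+1 t).
Proof.
have [t0|t0|->] := ltrgtP t 0.
- rewrite !flat_le0 ?(ltW t0)// mulr0 subr0.
  apply: (near_eq_is_derive (f := cst 0)).
  near=> s; rewrite flat_le0//; near: s.
  by apply: filterS (lt_nbhsl t0) => s /ltW.
  apply: (@near_eq_is_derive R R R (fun s : R => s^-1 ^+ n * expR (- s^-1)) (flat n) t 1 _ _ _).
    near=> s; rewrite /flat exprVn; case: ifPn => // /negP[]; near: s.
    exact: lt_nbhsr.
  have dV : is_derive t 1 (fun s : R => s^-1) (- t ^- 2).
    have t00 : t != 0 by rewrite gt_eqF.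
    split; first exact: derivableV.
    by rewrite (deriveV (f := id))// derive_id /GRing.scale /= mulr1.
  have dE : is_derive t 1 (fun s : R => expR (- s^-1)) (expR (- t^-1) * (t ^- 2)).
    have := @is_derive1_comp R expR (fun s : R => - s^-1) t _ _ (is_derive_expR _) (is_deriveN dV).
    by rewrite opprK.
  have dX := is_deriveX n dV; rewrite exprfctE in dX.
  have Hm := is_deriveM dX dE.
  suff <- : t^-1 ^+ n *: (expR (- t^-1) / t ^+ 2) +
     expR (- t^-1) *: ((n%:R * t^-1 ^+ n.-1) *: - t ^- 2) =
     flat n.+2 t - n%:R * flat n.+1 t by exact: Hm.
  rewrite /flat t0 /GRing.scale /=.
  case: n {dX Hm} => [|n]; rewrite /=.
    by rewrite expr0 !mul0r mulr0 mul1r addr0 subr0 mulrC.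
  by rewrite !exprVn [t ^+ n.+3]exprS [t ^+ n.+2]exprS !exprS; field; rewrite ?expf_neq0 ?gt_eqF.
- rewrite !flat_le0// mulr0 subr0.
  suff : (fun h : R => h^-1 *: ((flat n \o shift 0) (h *: 1) - flat n 0)) @ 0^' --> (0 : R).
    by move=> c0; split; [apply/cvg_ex; exists 0|apply/cvg_lim].
  have nC : (fun h : R => n.+2%:R ^+ n.+2 * `|h|) @ 0^' --> (0 : R).
    have C0 : 0 < n.+2%:R ^+ n.+2 :> R by rewrite exprn_gt0.
    apply/cvgrPdist_le => e e0; near=> h.
    rewrite sub0r normrN normrM normr_id gtr0_norm// mulrC -ler_pdivlMr//.
    by near: h; apply: dnbhs0_le; exact: divr_gt0.
  apply: (@squeeze_cvgr _ _ _ _ (fun h => - (n.+2%:R ^+ n.+2 * `|h|)) (fun h => n.+2%:R ^+ n.+2 * `|h|)).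
  - near=> h; have h0 : h != 0 by near: h; exact: nbhs_dnbhs_neq.
    rewrite -ler_norml; suff -> : h^-1 *: ((flat n \o shift 0) (h *: 1) - flat n 0) = flat n.+1 h.
      exact: flat_le.
    rewrite /= addr0 (flat_le0 n (lexx 0)) subr0 /GRing.scale /= mulr1 /flat.
    by case: ifPn => _; [rewrite exprS invfM mulrA|rewrite mulr0].
  - by have := cvgN nC; rewrite oppr0; apply.
  - exact: nC.
Unshelve. all: by end_near. Qed.

End one_dim.

(** * Directional derivatives *)

Section directional.
Context {R : realType} {V : normedModType R}.
Implicit Types (f q : V -> R) (x v : V).

Lemma is_deriveP f x v d :
  is_derive x v f d <-> (fun h : R => h^-1 * (f (h *: v + x) - f x)) @ 0^' --> d.
Proof.
split=> [[+ <-]|]; first by [].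
by move=> fd; split; [apply/cvg_ex; exists d|exact/cvg_lim].
Qed.

End directional.

Section directional_line.
Context {R : realType} {V : normedModType R}.
Implicit Types (f q : V -> R) (x v : V).

(** This reduces directional derivatives to functions of one real variable, to which the chain rule
    and the mean value theorem apply. *)
Lemma is_derive_line f x v d (s : R) :
  is_derive (s *: v + x) v f d <-> is_derive s 1 (fun s => f (s *: v + x)) d.
Proof.
rewrite !is_deriveP; set F := (X in X @ _ --> _); set G := (X in _ <-> X @ _ --> _).
suff -> : F = G by [].
apply/funext => h; rewrite /F /G scalerDl addrA.
by rewrite [in RHS]/GRing.scale /= mulr1.
Qed.

Lemma is_derive_line0 f x v d :
  is_derive x v f d <-> is_derive (0 : R) 1 (fun s => f (s *: v + x)) d.
Proof. by rewrite -is_derive_line scale0r add0r. Qed.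

Lemma is_derive_comp_line (G : R -> R) q x v (G' dq' : R) :
  is_derive (q x) 1 G G' -> is_derive x v q dq' -> is_derive x v (G \o q) (G' * dq').
Proof.
move=> dG /is_derive_line0 dq; apply/is_derive_line0.
by apply: (@is_derive1_comp R G (fun s => q (s *: v + x))); rewrite ?scale0r ?add0r.
Qed.

Lemma mean_value_line f df x v s :
  (forall y, is_derive y v f (df y)) ->
  exists2 c, `|c| <= `|s| & f (x + s *: v) - f x = df (x + c *: v) * s.
Proof.
move=> fdf.
have /(mean_value 0 s)[c] : forall t : R,
    is_derive t 1 (fun t => f (t *: v + x)) (df (t *: v + x)).
  by move=> t; apply/is_derive_line.
rewrite !subr0 scale0r add0r => cs e; exists c => //.
by rewrite ![x + _]addrC e.
Qed.

End directional_line.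

Section smooth_basics.
Context {R : realType} {m : nat}.
Local Notation fn := ('rV[R]_m -> R).
Implicit Types (f g q A : fn) (x : 'rV[R]_m) (i l : 'I_m).
Local Notation e_ i := (delta_mx ord0 i).

Lemma Cinfty_continuous f : Cinfty f -> continuous f.
Proof. by move=> /(_ 0%N)[]. Qed.

Lemma Cinfty_is_derive f i x : Cinfty f -> is_derive x (e_ i) f (partial i f x).
Proof. by move=> /(_ 1%N)[_ [df _]]; apply/derivableP; exact: df. Qed.

Lemma Cinfty_partial f i : Cinfty f -> Cinfty (partial i f).
Proof. by move=> sf k; have [_ [_]] := sf k.+1; exact. Qed.

Lemma partialE f i x d : is_derive x (e_ i) f d -> partial i f x = d.
Proof. by case. Qed.

Lemma ball_rV x e y : ball x e y <-> 0 < e /\ forall j, `|x ord0 j - y ord0 j| < e.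
Proof.
split=> [[e0 xy]|[e0 xy]]; split => //.
  by move=> j; exact: xy.
by move=> j0 j; rewrite ord1; exact: xy.
Qed.

End smooth_basics.

(** * A class of functions closed under partial derivatives *)

Section smooth.
Context {R : realType} {m : nat}.
Local Notation fn := ('rV[R]_m -> R).
Implicit Types (f g q A : fn) (x : 'rV[R]_m) (i l : 'I_m).
Local Notation e_ i := (delta_mx ord0 i).

Lemma shear_continuous i A : continuous A -> continuous (shear i A).
Proof.
move=> cA x; apply: (@cvgD _ _ _ (nbhs x) _ idfun (fun y => A y *: e_ i)) => //.
by apply: cvgZl; exact: cA.
Qed.

(** The increment is split into a step along e_l with the shear frozen at [A x], which ends at
    [y t], and a step along e_i of length [a t]. The mean value theorem applies to the latter, and
    the continuity of d_i f gives the limit. *)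
Lemma is_derive_shear f A i l x dl : continuous f ->
  (forall j y, is_derive y (e_ j) f (partial j f y)) -> continuous (partial i f) ->
  continuous A -> is_derive x (e_ l) A dl ->
  is_derive x (e_ l) (f \o shear i A)
    (partial l f (shear i A x) + dl * partial i f (shear i A x)).
Proof.
move=> cf df cpf cA /is_deriveP dA; apply/is_deriveP.
pose y (t : R) := t *: e_ l + x + A x *: e_ i.
pose a (t : R) := A (t *: e_ l + x) - A x.
have /choice[xi xiP] (t : R) : exists c, `|c| <= `|a t| /\
    f (y t + a t *: e_ i) - f (y t) = partial i f (y t + c *: e_ i) * a t.
  by have [c c1 c2] := mean_value_line (y t) (a t) (df i); exists c.
have -> : (fun h : R => h^-1 * ((f \o shear i A) (h *: e_ l + x) - (f \o shear i A) x)) =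
   (fun h : R => h^-1 * (f (h *: e_ l + shear i A x) - f (shear i A x)) +
       h^-1 * (A (h *: e_ l + x) - A x) * partial i f (y h + xi h *: e_ i)).
  apply/funext => h.
  have -> : h *: e_ l + shear i A x = y h by rewrite /y /shear addrA.
  rewrite -mulrA [_ * partial i f _]mulrC; have [_ <-] := xiP h.
  rewrite -mulrDr; congr (_ * _); rewrite [RHS]addrC [RHS]addrA subrK; congr (f _ - _).
  by rewrite /shear /y /a -[RHS]addrA -scalerDl [A x + _]addrC subrK.
apply: cvgD; first by apply/is_deriveP; exact: df.
apply: cvgM => //.
have cx : (fun h : R => h *: e_ l + x) @ 0^' --> x.
  suff : (fun h : R => h *: e_ l + x) @ 0^' --> 0 *: e_ l + x by rewrite scale0r add0r.
  by apply: cvg_within_filter; apply: cvgD; [apply: cvgZl; exact: cvg_id|exact: cvg_cst].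
have cy : y h @[h --> 0^'] --> shear i A x by apply: cvgD cx (cvg_cst _).
have ca : a h @[h --> 0^'] --> 0.
  suff : a h @[h --> 0^'] --> A x - A x by rewrite subrr.
  apply: cvgB; last exact: cvg_cst.
  by apply: cvg_comp; [exact: cx|exact: cA].
have cxi : xi h @[h --> 0^'] --> 0.
  apply/cvgr0Pnorm_le => e e0; have /cvgr0Pnorm_le/(_ e e0) := ca.
  by apply: filterS => h; apply: le_trans; have [] := xiP h.
have : (fun h => y h + xi h *: e_ i) @ 0^' --> shear i A x + 0 *: e_ i.
  by apply: cvgD => //; apply: cvgZl.
rewrite scale0r addr0 => cyx.
by apply: cvg_comp; [exact: cyx|exact: cpf].
Qed.

(** [Cinfty] iterates partial derivatives, and the derivative of a product, inverse or composition
    is a combination of several such terms. A class closed under all these operations and under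
    partial derivatives at once makes the induction on the order go through. *)
Inductive smooth_gen : fn -> Prop :=
| smooth_gen_base f of Cinfty f : smooth_gen f
| smooth_gen_cst (c : R) : smooth_gen (cst c)
| smooth_gen_coord i : smooth_gen (fun x => x ord0 i)
| smooth_gen_add f g of smooth_gen f & smooth_gen g : smooth_gen (f + g)
| smooth_gen_mul f g of smooth_gen f & smooth_gen g : smooth_gen (f * g)
| smooth_gen_inv f of smooth_gen f & (forall x, f x != 0) :
    smooth_gen (fun x => (f x)^-1)
| smooth_gen_flat n q of smooth_gen q : smooth_gen (flat n \o q)
| smooth_gen_shear f i A of smooth_gen f & smooth_gen A : smooth_gen (f \o shear i A)
| smooth_gen_col (gam : 'rV[R]_m.-1 -> R) i of Cinfty gam :
    smooth_gen (gam \o col' i).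

Lemma flat_continuous n : continuous (@flat R n).
Proof.
move=> t; apply/differentiable_continuous/derivable1_diffP.
by have [] := is_derive_flat n t.
Qed.

Lemma col'_continuous i : continuous (col' i : 'rV[R]_m -> 'rV[R]_m.-1).
Proof.
move=> x; apply/(@cvg_ballP _ _ _ (nbhs x)) => e e0; near=> y.
have xy : ball x e y by near: y; exact: (nbhsx_ballx x).
by split => // j0 j; rewrite !mxE ord1; have [_] := xy; exact.
Unshelve. all: by end_near. Qed.

Lemma smooth_gen_continuous f : smooth_gen f -> continuous f.
Proof.
elim=> {f} [f sf|c|i|f g _ cf _ cg|f g _ cf _ cg|f _ cf f0|n q _ cq|f i A _ cf _ cA|gam i cg] x.
- exact: Cinfty_continuous.
- exact: cst_continuous.
- exact: coord_continuous.
- exact: (cvgD (cf x) (cg x)).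
- exact: (cvgM (cf x) (cg x)).
- exact: (cvgV (f0 x) (cf x)).
- by apply: cvg_comp; [exact: cq|exact: flat_continuous].
- by apply: cvg_comp; [exact: shear_continuous|exact: cf].
- by apply: cvg_comp; [exact: col'_continuous|exact: (Cinfty_continuous cg)].
Qed.

Lemma col'_delta i l (t : R) x : col' i (t *: e_ l + x) =
  (if unlift i l is Some j then t *: delta_mx ord0 j else 0) + col' i x.
Proof.
apply/rowP => j; rewrite !mxE; congr (_ + _).
case: unliftP => [k ->|->].
  by rewrite !mxE (inj_eq lift_inj).
by rewrite mxE [lift i j == i]eq_sym (negbTE (neq_lift i j)) andbF mulr0.
Qed.

Lemma smooth_gen_is_derive f : smooth_gen f -> forall l,
  exists2 df, smooth_gen df & forall x, is_derive x (e_ l) f (df x).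
Proof.
elim=> {f} [f sf|c|i|f g sf IHf sg IHg|f g sf IHf sg IHg|f sf IHf f0|n q sq IHq|
  f i A sf IHf sA IHA|gam i sg] l; try (have [df sdf dfE] := IHf l);
  try (have [dg sdg dgE] := IHg l).
- exists (partial l f) => [|x]; last exact: Cinfty_is_derive.
  exact/smooth_gen_base/Cinfty_partial.
- by exists (cst 0) => [|x]; [exact: smooth_gen_cst|exact: is_derive_cst].
- exists (cst (l == i)%:R) => [|x]; first exact: smooth_gen_cst.
  apply/is_deriveP; apply: cvg_near_cst; near=> h.
  have h0 : h != 0 by near: h; exact: nbhs_dnbhs_neq.
  by rewrite !mxE eqxx /= addrK mulKf// eq_sym.
- by exists (df + dg) => [|x]; [exact: smooth_gen_add|exact: (is_deriveD (dfE x) (dgE x))].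
- exists (f * dg + g * df) => [|x]; last exact: (is_deriveM (dfE x) (dgE x)).
  by apply: smooth_gen_add; exact: smooth_gen_mul.
- pose F x := (f x)^-1.
  exists (cst (-1) * (F * F) * df) => [|x].
    by do 2 (apply: smooth_gen_mul => //); [exact: smooth_gen_cst|
      apply: smooth_gen_mul; exact: smooth_gen_inv].
  have [dx dv] := dfE x; split; first exact: derivableV.
  rewrite deriveV// dv.
  have -> : - f x ^- 2 = -1 * ((f x)^-1 * (f x)^-1) by rewrite expr2 invfM mulN1r.
  by [].
- have [dq sdq dqE] := IHq l.
  exists (((flat n.+2 \o q) + cst (- n%:R) * (flat n.+1 \o q)) * dq) => [|x].
    apply: smooth_gen_mul => //; apply: smooth_gen_add; first exact: smooth_gen_flat.
    by apply: smooth_gen_mul; [exact: smooth_gen_cst|exact: smooth_gen_flat].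
  rewrite (_ : (((flat n.+2 \o q) + cst (- n%:R) * (flat n.+1 \o q)) * dq) x = (flat n.+2 (q x) - n%:R * flat n.+1 (q x)) * dq x).
    exact: is_derive_comp_line (is_derive_flat n (q x)) (dqE x).
  by rewrite -mulNr.
- have [dA sdA dAE] := IHA l.
  have pE j (df' : fn) : (forall x, is_derive x (e_ j) f (df' x)) -> partial j f = df'.
    by move=> h; apply/funext => x; exact: partialE.
  have [dfi sdfi dfiE] := IHf i.
  exists ((df \o shear i A) + dA * (dfi \o shear i A)) => [|x].
    apply: smooth_gen_add; first exact: smooth_gen_shear.
    by apply: smooth_gen_mul => //; exact: smooth_gen_shear.
  rewrite -(pE _ _ dfE) -(pE _ _ dfiE); apply: is_derive_shear (dAE x).
  - exact: smooth_gen_continuous.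
  - by move=> j y; have [d _ dE] := IHf j; rewrite (pE _ _ dE).
  - by rewrite (pE _ _ dfiE); exact: smooth_gen_continuous.
  - exact: smooth_gen_continuous.
- have cd x : is_derive x (e_ l) (gam \o col' i)
      (if unlift i l is Some j then partial j gam (col' i x) else 0).
    apply/is_deriveP; set d := (X in _ --> X).
    rewrite (_ : (fun h : R => _) = (fun h : R => h^-1 * (gam ((if unlift i l is Some j
      then h *: delta_mx ord0 j else 0) + col' i x) - gam (col' i x)))); last first.
      by apply/funext => h /=; rewrite col'_delta.
    rewrite /d; case: unliftP => [j _|_]; first exact/is_deriveP/Cinfty_is_derive.
    rewrite add0r subrr; under eq_fun do rewrite mulr0.
    exact: cvg_cst.
  case: unliftP cd => [j _|_] cd.
    by exists (partial j gam \o col' i) => //; apply/smooth_gen_col/Cinfty_partial.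
  by exists (cst 0) => //; exact: smooth_gen_cst.
Unshelve. all: by end_near. Qed.

Lemma smooth_gen_Cinfty f : smooth_gen f -> Cinfty f.
Proof.
move=> sf k; elim: k f sf => [|k IH] f sf /=; split => //; try exact: smooth_gen_continuous.
split=> [i x|i]; have [df sdf dfE] := smooth_gen_is_derive sf i; first by have [] := dfE x.
by rewrite (_ : partial i f = df); [exact: IH|apply/funext => x; exact: partialE].
Qed.

Lemma CinftyD f g : Cinfty f -> Cinfty g -> Cinfty (f + g).
Proof. by move=> sf sg; apply/smooth_gen_Cinfty/smooth_gen_add; exact: smooth_gen_base. Qed.

Lemma CinftyM f g : Cinfty f -> Cinfty g -> Cinfty (f * g).
Proof. by move=> sf sg; apply/smooth_gen_Cinfty/smooth_gen_mul; exact: smooth_gen_base. Qed.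

Lemma Cinfty_cst c : Cinfty (cst c : fn).
Proof. exact/smooth_gen_Cinfty/smooth_gen_cst. Qed.

Lemma CinftyZ c f : Cinfty f -> Cinfty (c *: f).
Proof. by move=> sf; apply: (@CinftyM (cst c) f) => //; exact: Cinfty_cst. Qed.

Lemma CinftyN f : Cinfty f -> Cinfty (- f).
Proof. by rewrite -scaleN1r; exact: CinftyZ. Qed.

Lemma CinftyB f g : Cinfty f -> Cinfty g -> Cinfty (f - g).
Proof. by move=> sf sg; apply: CinftyD => //; exact: CinftyN. Qed.

Lemma CinftyV f : Cinfty f -> (forall x, f x != 0) -> Cinfty (fun x => (f x)^-1).
Proof. by move=> sf f0; apply/smooth_gen_Cinfty/smooth_gen_inv => //; exact: smooth_gen_base. Qed.

Lemma Cinfty_flat n q : Cinfty q -> Cinfty (flat n \o q).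
Proof. by move=> sq; apply/smooth_gen_Cinfty/smooth_gen_flat; exact: smooth_gen_base. Qed.

Lemma Cinfty_shear f i A : Cinfty f -> Cinfty A -> Cinfty (f \o shear i A).
Proof. by move=> sf sA; apply/smooth_gen_Cinfty/smooth_gen_shear; exact: smooth_gen_base. Qed.

Lemma Cinfty_col (gam : 'rV[R]_m.-1 -> R) i : Cinfty gam -> Cinfty (gam \o col' i : fn).
Proof. by move=> sg; apply/smooth_gen_Cinfty/smooth_gen_col. Qed.

Lemma Cinfty_coord i : Cinfty (fun x : 'rV[R]_m => x ord0 i).
Proof. exact/smooth_gen_Cinfty/smooth_gen_coord. Qed.

Lemma Cinfty_sum (I : Type) (r : seq I) (P : pred I) (F : I -> fn) :
  (forall j, P j -> Cinfty (F j)) -> Cinfty (\sum_(j <- r | P j) F j).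
Proof. by move=> sF; elim/big_ind : _ => //; [exact: Cinfty_cst|exact: CinftyD]. Qed.

Lemma Cinfty_prod (I : Type) (r : seq I) (P : pred I) (F : I -> fn) :
  (forall j, P j -> Cinfty (F j)) -> Cinfty (\prod_(j <- r | P j) F j).
Proof. by move=> sF; elim/big_ind : _ => //; [exact: Cinfty_cst|exact: CinftyM]. Qed.

Lemma partialD f g i : Cinfty f -> Cinfty g -> partial i (f + g) = partial i f + partial i g.
Proof.
move=> sf sg; apply/funext => x; apply: partialE.
exact: (is_deriveD (Cinfty_is_derive _ _ sf) (Cinfty_is_derive _ _ sg)).
Qed.

Lemma partialM f g i : Cinfty f -> Cinfty g ->
  partial i (f * g) = f * partial i g + g * partial i f.
Proof.
move=> sf sg; apply/funext => x; apply: partialE.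
exact: (is_deriveM (Cinfty_is_derive _ _ sf) (Cinfty_is_derive _ _ sg)).
Qed.

Lemma partial_cst c i : partial i (cst c : fn) = 0.
Proof. by apply/funext => x; apply: partialE; exact: is_derive_cst. Qed.

Lemma partialZ c f i : Cinfty f -> partial i (c *: f) = c *: partial i f.
Proof.
move=> sf; rewrite (_ : c *: f = cst c * f)// partialM//; last exact: Cinfty_cst.
by rewrite partial_cst mulr0 addr0.
Qed.

Lemma partialN f i : Cinfty f -> partial i (- f) = - partial i f.
Proof. by move=> sf; rewrite -scaleN1r partialZ// scaleN1r. Qed.

Lemma partialB f g i : Cinfty f -> Cinfty g -> partial i (f - g) = partial i f - partial i g.
Proof. by move=> sf sg; rewrite partialD ?partialN//; exact: CinftyN. Qed.

Lemma partial_shear f i A l : Cinfty f -> Cinfty A ->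
  partial l (f \o shear i A) =
  (partial l f \o shear i A) + partial l A * (partial i f \o shear i A).
Proof.
move=> sf sA; apply/funext => x; apply: partialE; apply: is_derive_shear.
- exact: Cinfty_continuous.
- by move=> *; exact: Cinfty_is_derive.
- exact/Cinfty_continuous/Cinfty_partial.
- exact: Cinfty_continuous.
- exact: Cinfty_is_derive.
Qed.

End smooth.

(** * Measurability and boxes in R^m *)

Section continuous_rV.
Context {R : realType} {m : nat}.
Local Notation fn := ('rV[R]_m -> R).
Implicit Types (f : fn) (K : set 'rV[R]_m) (rho : R).
Local Notation mu := (@rV_lebesgue R m).

Lemma continuous_measurable_rV f : continuous f -> measurable_fun setT f.
Proof.
move=> /continuousP cf; apply: (measurability _ (RGenOpens.measurableE R)).
move=> _ [_ [a [b ->]] <-]; rewrite setTI; apply: open_measurable_rV.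
by apply: cf; exact: interval_open.
Qed.

Definition cbox rho : set 'rV[R]_m := [set x | forall i, `|x ord0 i| <= rho].

Lemma measurable_cbox rho : measurable (cbox rho).
Proof.
rewrite (_ : cbox rho = \bigcap_(i in [set: 'I_m]) (rV_coord i @^-1` `[- rho, rho]%classic)).
  apply: fin_bigcap_measurable => // i _.
  by rewrite -[X in measurable X]setTI; exact: measurable_rV_coord.
apply/seteqP; split=> [x xr i _|x xr i]; first by rewrite /= in_itv /= -ler_norml xr.
by have := xr i I; rewrite /= in_itv /= -ler_norml.
Qed.

Lemma cbox_fin rho : (mu (cbox rho) < +oo)%E.
Proof.
rewrite (_ : cbox rho = [set x | forall i, `[- rho, rho]%classic (x ord0 i)]).
  rewrite (rV_lebesgue_box (A := fun=> `[- rho, rho]%classic))//.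
  set I := `[- rho, rho]%classic.
  suff : (\prod_(i < m) lebesgue_measure I)%E \is a fin_num.
    by rewrite fin_numElt => /andP[].
  elim/big_ind : _ => [//|x y xf yf|i _]; first by rewrite fin_numM.
  by rewrite /I lebesgue_measure_itv /=; case: ifP.
by apply/seteqP; split=> x xr i; have := xr i; rewrite /= in_itv /= -ler_norml.
Qed.

Lemma bounded_set_cbox K : bounded_set K -> exists2 rho, 0 < rho & K `<=` cbox rho.
Proof.
case=> M [Mr KM]; exists (`|M| + 1); first by rewrite ltr_wpDl.
move=> x Kx i; have /= := KM (`|M| + 1) _ x Kx.
rewrite (le_lt_trans (ler_norm _)) ?ltrDl// => /(_ isT).
apply: le_trans; rewrite [leRHS]/Num.norm /= mx_normrE.
by apply: le_trans (le_bigmax _ _ (ord0, i)).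
Qed.

Lemma compact_cbox rho : compact (cbox rho).
Proof.
have := @rV_compact R m (fun i => `[- rho, rho]%classic) (fun i => @segment_compact _ _ _).
by congr compact; apply/seteqP; split=> x xr i; have := xr i; rewrite /= in_itv /= -ler_norml.
Qed.

Lemma bounded_on_cbox f rho : continuous f ->
  exists2 a, 0 <= a & forall x, cbox rho x -> `|f x| <= a.
Proof.
move=> cf.
have /compact_bounded [M [Mr fM]] : compact (f @` cbox rho).
  apply: continuous_compact; first exact: continuous_subspaceT.
  exact: compact_cbox.
exists (`|M| + 1) => [|x xr]; first by rewrite addr_ge0.
by apply: fM; [rewrite (le_lt_trans (ler_norm _)) ?ltrDl|exists x].
Qed.

End continuous_rV.

(** * Test functions *)

Section tests.
Context {R : realType} {m : nat}.
Local Notation fn := ('rV[R]_m -> R).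
Implicit Types (Om K : set 'rV[R]_m) (f g phi psi : fn) (i l : 'I_m) (a rho : R).
Local Notation mu := (@rV_lebesgue R m).
Local Notation "`N u" := (L2_norm setT u) (at level 9).

(** Any compact K in Om containing the nonzero set does the work of the closed support, which eases
    the closure properties below. *)
Lemma test_functionP Om phi : test_function Om phi <->
  Cinfty phi /\ exists K, [/\ compact K, K `<=` Om & forall x, phi x != 0 -> K x].
Proof.
split=> [[sphi [cphi phiO]]|[sphi [K [cK KO phiK]]]]; split => //.
  by exists (closure [set x | phi x != 0]); split => // x px; apply: subset_closure.
have clK : closed K by apply: compact_closed => //; exact: norm_hausdorff.
have sK : closure [set x | phi x != 0] `<=` K.
  by move=> x; rewrite (closure_id K).1//; exact: closureS.
split; last exact: subset_trans KO.
by apply: subclosed_compact cK sK; exact: closed_closure.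
Qed.

Lemma test_function_mono Om Om' phi : Om `<=` Om' -> test_function Om phi ->
  test_function Om' phi.
Proof. by move=> OO [sphi [cphi pO]]; split => //; split => //; exact: subset_trans OO. Qed.

Lemma test_Cinfty Om phi : test_function Om phi -> Cinfty phi.
Proof. by case. Qed.

Lemma test_off Om phi x : test_function Om phi -> ~ Om x -> phi x = 0.
Proof.
move=> /test_functionP[_ [K [_ KO phiK]]] Ox.
by apply: contra_notP Ox => /eqP/phiK/KO.
Qed.

Lemma partial_off K f l : closed K -> (forall x, f x != 0 -> K x) ->
  forall x, partial l f x != 0 -> K x.
Proof.
move=> cK fK x; apply: contraNP => Kx; apply/eqP/partialE.
apply: (near_eq_is_derive (f := cst 0)).
have : nbhs x (~` K) by apply: open_nbhs_nbhs; split => //; exact: closed_openC.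
by apply: filterS => y Ky; apply/esym; apply: contra_notP Ky => /eqP/fK.
Qed.

Lemma test0 Om : test_function Om (0 : fn).
Proof.
apply/test_functionP; split; first exact: Cinfty_cst.
by exists set0; split => //; [exact: compact0|move=> x /eqP].
Qed.

Lemma testD Om phi psi : test_function Om phi -> test_function Om psi ->
  test_function Om (phi + psi).
Proof.
move=> /test_functionP[s1 [K1 [c1 O1 k1]]] /test_functionP[s2 [K2 [c2 O2 k2]]].
apply/test_functionP; split; first exact: CinftyD.
exists (K1 `|` K2); split; first exact: compactU.
  by move=> x [/O1|/O2].
move=> x px; have [p1|p1] := eqVneq (phi x) 0; last by left; exact: k1.
by right; apply: k2; move: px; rewrite addrfctE p1 add0r.
Qed.

Lemma testM Om f phi : Cinfty f -> test_function Om phi -> test_function Om (f * phi).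
Proof.
move=> sf /test_functionP[s1 [K1 [c1 O1 k1]]].
apply/test_functionP; split; first exact: CinftyM.
exists K1; split => // x px; apply: k1; apply: contraNneq px => p0.
by rewrite mulrfctE p0 mulr0.
Qed.

Lemma testZ Om a phi : test_function Om phi -> test_function Om (a *: phi).
Proof. by apply: (@testM Om (cst a)); exact: Cinfty_cst. Qed.

Lemma testN Om phi : test_function Om phi -> test_function Om (- phi).
Proof. by move=> p; rewrite -scaleN1r; exact: testZ. Qed.

Lemma testB Om phi psi : test_function Om phi -> test_function Om psi ->
  test_function Om (phi - psi).
Proof. by move=> p1 p2; apply: testD => //; exact: testN. Qed.

Lemma test_sum Om (I : Type) (r : seq I) (P : pred I) (F : I -> fn) :
  (forall j, P j -> test_function Om (F j)) -> test_function Om (\sum_(j <- r | P j) F j).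
Proof. by move=> sF; elim/big_ind : _ => //; [exact: test0|exact: testD]. Qed.

Lemma test_partial Om l phi : test_function Om phi -> test_function Om (partial l phi).
Proof.
move=> /test_functionP[s1 [K1 [c1 O1 k1]]].
apply/test_functionP; split; first exact: Cinfty_partial.
exists K1; split => //; apply: partial_off => //.
by apply: compact_closed => //; exact: norm_hausdorff.
Qed.

Lemma Cinfty_measurable f : Cinfty f -> measurable_fun setT f.
Proof. by move=> /Cinfty_continuous; exact: continuous_measurable_rV. Qed.

Lemma cbox_supported_L2 f a rho : measurable_fun setT f -> 0 <= a ->
  (forall x, `|f x| <= a) -> (forall x, f x != 0 -> cbox rho x) ->
  L2 setT f /\ `N f <= a * Num.sqrt (fine (mu (cbox rho))).
Proof.
move=> mf a0 fa fr; pose v (x : 'rV[R]_m) : R := \1_(cbox rho) x.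
have mr : measurable (cbox rho : set 'rV[R]_m) by exact: measurable_cbox.
have iv : (\int[mu]_x (v x ^+ 2)%:E = mu (cbox rho))%E.
  transitivity (mu (cbox rho `&` setT)); last by rewrite setIT.
  rewrite -integral_indic//; apply: eq_integral => x _.
  by rewrite /v indicE; case: (_ \in _); rewrite ?expr1n ?expr0n.
have v2 : L2 setT v.
  by split; [exact: measurable_indic|rewrite iv; exact: cbox_fin].
have fv x : setT x -> `|f x| <= a * `|v x|.
  move=> _; rewrite /v indicE; have [xr|xr] := boolP (x \in _).
    by rewrite normr1 mulr1 fa.
  rewrite normr0 mulr0; have [->|/fr] := eqVneq (f x) 0; first by rewrite normr0.
  by move/mem_set => xr'; rewrite xr' in xr.
have f2 : L2 setT f by apply: L2_le v2 fv.
split => //; have -> : fine (mu (cbox rho)) = L2_inner setT v v.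
  by rewrite -[RHS]/(fine _%:E) -L2_innerE// iv.
exact: ler_L2_normZ.
Qed.

Lemma compact_sub_cbox K : compact K -> exists2 rho, 0 < rho & K `<=` cbox rho.
Proof. by move=> /compact_bounded/bounded_set_cbox. Qed.

Lemma test_support_cbox Om phi : test_function Om phi ->
  exists2 rho, 0 < rho & forall x, phi x != 0 -> cbox rho x.
Proof.
move=> /test_functionP[_ [K [cK _ phiK]]].
have [rho r0 Kr] := compact_sub_cbox cK.
by exists rho => // x /phiK/Kr.
Qed.

Lemma test_bounded Om phi : test_function Om phi ->
  exists2 a, 0 <= a & forall x, `|phi x| <= a.
Proof.
move=> tphi; have [rho r0 phir] := test_support_cbox tphi.
have [a a0 phia] := bounded_on_cbox rho (Cinfty_continuous (test_Cinfty tphi)).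
exists a => // x; have [->|/phir/phia//] := eqVneq (phi x) 0.
by rewrite normr0.
Qed.

Lemma test_L2 Om phi : test_function Om phi -> L2 setT phi.
Proof.
move=> tphi; have [rho r0 phir] := test_support_cbox tphi.
have [a a0 phia] := test_bounded tphi.
have [] // := @cbox_supported_L2 phi a rho _ a0 phia phir.
exact: Cinfty_measurable (test_Cinfty tphi).
Qed.

Lemma L2_boundedM f psi a : L2 setT psi -> measurable_fun setT f ->
  (forall x, psi x != 0 -> `|f x| <= a) -> L2 setT (f * psi).
Proof.
move=> p2 mf fa; apply: (L2_le (a := a) _ _ p2) => //.
  by apply: measurable_funM => //; exact: p2.1.
move=> x _; rewrite normrM; have [->|/fa fx] := eqVneq (psi x) 0.
  by rewrite normr0 !mulr0.
by rewrite ler_wpM2r.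
Qed.

End tests.

(** This stands for a passage to the limit e -> 0; the restriction e <= 1 serves estimates that hold
    for small steps only. *)
Lemma le_of_eps (R : realFieldType) (x y c : R) : 0 <= c ->
  (forall e, 0 < e -> e <= 1 -> x <= y + e * c) -> x <= y.
Proof.
move=> c0 xy; rewrite leNgt; apply/negP => yx.
have c1 : 0 < c + 1 by rewrite ltr_wpDl.
have [d1|d1] := leP ((x - y) / (c + 1)) 1.
  have := xy _ (divr_gt0 _ c1) d1; rewrite subr_gt0 => /(_ yx).
  rewrite mulrAC -lerBlDl ler_pdivlMr// ler_pM2l ?subr_gt0//.
  by rewrite gerDl leNgt ltr01.
have := xy 1 ltr01 (lexx _); rewrite mul1r.
by move: d1; rewrite ltr_pdivlMr// mul1r; lra.
Qed.

(** * Difference quotients along tangential fields *)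

Lemma indep_partial (R : realType) m (i l : 'I_m) (G : 'rV[R]_m -> R) : Cinfty G ->
  indep_of i G -> indep_of i (partial l G).
Proof.
move=> sG iG x t; apply: partialE; apply/is_deriveP.
have /is_deriveP H := Cinfty_is_derive l x sG.
rewrite (_ : (fun h : R => _) = fun h : R => h^-1 * (G (h *: delta_mx ord0 l + x) - G x))//.
by apply/funext => h; rewrite addrA !iG.
Qed.

Section tangential_shift.
Context {R : realType} {m : nat} (i j : 'I_m) (G : 'rV[R]_m -> R).
Hypotheses (sG : Cinfty G) (iG : indep_of i G).
Local Notation fn := ('rV[R]_m -> R).
Implicit Types (p q chi psi : fn) (x y : 'rV[R]_m) (h : R) (l : 'I_m).
Local Notation e_ l := (delta_mx ord0 l).
Local Notation mu := (@rV_lebesgue R m).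
Local Notation "`N u" := (L2_norm setT u) (at level 9).
Local Notation "<< u , v >>" := (L2_inner setT u v).

(* The flow of the vector field e_j + (d_j G) e_i, which is tangent to the
   graphs x_i = G x + c. *)
Definition tshift h : 'rV[R]_m -> 'rV[R]_m :=
  shear j (cst h) \o shear i ((G \o shear j (cst h)) - G).

Definition tangent p : fn := partial j p + partial j G * partial i p.

Definition shifted h p : fn := p \o tshift h.

Definition diffq h p : fn := h^-1 *: (shifted h p - p).

Lemma tshiftE h x : tshift h x = x + h *: e_ j + (G (x + h *: e_ j) - G x) *: e_ i.
Proof. by rewrite /tshift /shear /= addrAC. Qed.

Lemma G_tshift h x : G (tshift h x) = G (x + h *: e_ j).
Proof. by rewrite tshiftE iG. Qed.

(** G does not see the i-component, so [G (tshift k x)] is the value of G at x + k e_j and the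
    increments of G telescope. *)
Lemma tshiftD h k x : tshift h (tshift k x) = tshift (h + k) x.
Proof.
have e : tshift k x + h *: e_ j = x + (h + k) *: e_ j + (G (x + k *: e_ j) - G x) *: e_ i.
  by rewrite tshiftE [(h + k) *: _]scalerDl [h *: _ + _]addrC !addrA [LHS]addrAC.
rewrite [LHS]tshiftE G_tshift e iG tshiftE -[LHS]addrA -scalerDl; congr (_ + _ *: _).
by rewrite addrC addrA subrK.
Qed.

Lemma tshift0 x : tshift 0 x = x.
Proof. by rewrite tshiftE !(scale0r, addr0) subrr scale0r addr0. Qed.

Lemma tshiftK h : cancel (tshift h) (tshift (- h)).
Proof. by move=> x; rewrite tshiftD addNr tshift0. Qed.

Lemma shiftedD h k p : shifted h (shifted k p) = shifted (k + h) p.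
Proof. by apply/funext => x; rewrite /shifted /= tshiftD. Qed.

Let A h := (G \o shear j (cst h)) - G.

Let sA h : Cinfty (A h).
Proof. by apply: CinftyB => //; apply: Cinfty_shear => //; exact: Cinfty_cst. Qed.

Let iA h : indep_of i (A h).
Proof.
move=> x t; rewrite /A !fctE /shear /= iG; congr (_ - _).
by rewrite addrAC iG.
Qed.

Lemma Cinfty_shifted h p : Cinfty p -> Cinfty (shifted h p).
Proof.
move=> sp; apply: (@Cinfty_shear _ _ (p \o shear j (cst h))); last exact: sA.
by apply: Cinfty_shear => //; exact: Cinfty_cst.
Qed.

Lemma Cinfty_diffq h p : Cinfty p -> Cinfty (diffq h p).
Proof. by move=> sp; apply/CinftyZ/CinftyB => //; exact: Cinfty_shifted. Qed.

(** This is the coefficient in the commutator of d_l with [diffq h], see [partial_diffq]; on bounded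
    sets it stays bounded as h -> 0. *)
Definition diffq_slope h l : fn :=
  h^-1 *: ((partial l G \o shear j (cst h)) - partial l G).

Lemma partial_shifted h l p : Cinfty p -> partial l (shifted h p) =
  shifted h (partial l p) + (h *: diffq_slope h l) * shifted h (partial i p).
Proof.
have h1 l' q : Cinfty q ->
    partial l' (q \o shear j (cst h)) = partial l' q \o shear j (cst h).
  move=> sq; rewrite partial_shear//; last exact: Cinfty_cst.
  by rewrite partial_cst mul0r addr0.
have [-> _|h0 sp] := eqVneq h 0.
  have s0 q : shifted 0 q = q by apply/funext => x; rewrite /shifted /= tshift0.
  by rewrite !s0 scale0r mul0r addr0.
rewrite [LHS](@partial_shear _ _ (p \o shear j (cst h)) i (A h) l); last first.
- exact: sA.
- by apply: Cinfty_shear => //; exact: Cinfty_cst.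
rewrite !h1// /A partialB//; last by apply: Cinfty_shear => //; exact: Cinfty_cst.
by rewrite h1// /diffq_slope scalerA divff// scale1r.
Qed.

Lemma partial_diffq h l p : h != 0 -> Cinfty p -> partial l (diffq h p) =
  diffq h (partial l p) + diffq_slope h l * shifted h (partial i p).
Proof.
move=> h0 sp; have ssp := Cinfty_shifted h sp.
rewrite partialZ ?partialB ?partial_shifted//; last exact: CinftyB.
rewrite addrAC scalerDr; congr (_ + _).
by apply/funext => x; rewrite !fctE /GRing.scale /=; rewrite !mulrA mulVf// mul1r.
Qed.

Lemma measurable_shifted h p : measurable_fun setT p -> measurable_fun setT (shifted h p).
Proof.
move=> mp; have mA q : Cinfty q -> measurable_fun setT q by exact: Cinfty_measurable.
apply: (measurableT_comp mp); apply: measurableT_comp.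
  by apply: measurable_shear; exact: measurable_cst.
by apply: measurable_shear; apply: mA; exact: sA.
Qed.

Lemma ge0_integral_shifted h (f : 'rV[R]_m -> \bar R) : measurable_fun setT f ->
  (forall x, 0 <= f x)%E -> (\int[mu]_x f (tshift h x) = \int[mu]_x f x)%E.
Proof.
move=> mf f0; have ic : indep_of j (cst h : fn) by [].
have mc : measurable_fun setT (cst h : fn) by exact: measurable_cst.
rewrite -[RHS](ge0_integral_shear mc ic)//.
have mA : measurable_fun setT (A h) by exact: Cinfty_measurable.
rewrite -[RHS](ge0_integral_shear mA (iA h))//.
by apply: measurableT_comp => //; exact: measurable_shear.
Qed.

Lemma Rintegral_shifted h p : measurable_fun setT p ->
  \int[mu]_x shifted h p x = \int[mu]_x p x.
Proof.
move=> mf; have ic : indep_of j (cst h : fn) by [].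
have mc : measurable_fun setT (cst h : fn) by exact: measurable_cst.
rewrite -[RHS](Rintegral_shear mc ic)//.
have mA : measurable_fun setT (A h) by exact: Cinfty_measurable.
rewrite -[RHS](Rintegral_shear mA (iA h))//.
by apply: measurableT_comp => //; exact: measurable_shear.
Qed.

Lemma L2_shifted h p : L2 setT p -> L2 setT (shifted h p).
Proof.
move=> [mp p2]; split; first exact: measurable_shifted.
rewrite (@ge0_integral_shifted h (fun x => (p x ^+ 2)%:E))//.
  exact: measurable_sqr.
by move=> x; rewrite lee_fin sqr_ge0.
Qed.

Lemma inner_shifted h p q : L2 setT p -> L2 setT q ->
  << shifted h p, shifted h q >> = << p, q >>.
Proof.
move=> [mp _] [mq _]; apply: (@Rintegral_shifted h (fun x => p x * q x)).
exact: measurable_funM.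
Qed.

Lemma norm_shifted h p : L2 setT p -> `N (shifted h p) = `N p.
Proof. by move=> p2; rewrite /L2_norm inner_shifted. Qed.

Lemma inner_shiftedC h p q : L2 setT p -> L2 setT q ->
  << shifted h p, q >> = << p, shifted (- h) q >>.
Proof.
move=> p2 q2; rewrite -(inner_shifted h p2 (L2_shifted (- h) q2)); congr (<< _, _ >>).
by rewrite shiftedD addNr; apply/funext => x; rewrite /shifted /= tshift0.
Qed.

Lemma L2_diffq h p : L2 setT p -> L2 setT (diffq h p).
Proof. by move=> p2; apply: L2Z => //; apply: L2B => //; exact: L2_shifted. Qed.

(** Discrete integration by parts: the flow preserves the measure, so the adjoint of a shift is the
    inverse shift. *)
Lemma inner_diffqC h p q : L2 setT p -> L2 setT q ->
  << diffq h p, q >> = - << p, diffq (- h) q >>.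
Proof.
move=> p2 q2; have Tp := L2_shifted h p2; have Tq := L2_shifted (- h) q2.
have pp := L2B measurableT Tp p2; have qq := L2B measurableT Tq q2.
rewrite /diffq L2_innerZl// L2_innerZr// L2_innerBl// L2_innerBr// inner_shiftedC//.
by rewrite invrN mulNr opprK.
Qed.

Lemma norm_diffq_le h p : L2 setT p -> `N (diffq h p) <= 2 / `|h| * `N p.
Proof.
move=> p2; have Tp := L2_shifted h p2; have pp := L2B measurableT Tp p2.
rewrite L2_normZ// normfV [2 / _]mulrC -mulrA ler_wpM2l ?invr_ge0//.
rewrite (le_trans (ler_L2_normD _ Tp (L2N measurableT p2)))// L2_normN// norm_shifted//.
by rewrite mulrDl mul1r.
Qed.

Lemma is_derive_tshift p x h : Cinfty p ->
  is_derive h 1 (fun s => p (tshift s x)) (tangent p (tshift h x)).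
Proof.
move=> sp; pose B : fn := G - cst (G x); pose f := p \o shear i B.
have sB : Cinfty B by apply: CinftyB => //; exact: Cinfty_cst.
have fE s : f (s *: e_ j + x) = p (tshift s x).
  by rewrite /f /= tshiftE /shear /B !fctE [s *: _ + _]addrC.
have -> : (fun s => p (tshift s x)) = (fun s => f (s *: e_ j + x)).
  by apply/funext => s; rewrite fE.
apply/(is_derive_line f x (e_ j)).
have -> : tangent p (tshift h x) = partial j f (h *: e_ j + x).
  have sh : shear i B (h *: e_ j + x) = tshift h x.
    by rewrite tshiftE /shear /B !fctE [h *: _ + _]addrC.
  rewrite partial_shear// /tangent !fctE /= sh; congr (_ + _ * _).
  rewrite /B partialB//; last exact: Cinfty_cst.
  rewrite partial_cst !fctE subr0 tshiftE (indep_partial _ sG iG).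
  by rewrite addrC.
exact/Cinfty_is_derive/Cinfty_shear.
Qed.

Lemma diffq_mean_value p x h : Cinfty p -> h != 0 ->
  exists2 c, `|c| <= `|h| & diffq h p x = tangent p (tshift c x).
Proof.
move=> sp h0.
have [c] := mean_value 0 h (fun s => is_derive_tshift x s sp).
rewrite !subr0 tshift0 => ch e; exists c => //.
by rewrite /diffq !fctE /shifted /= e /GRing.scale /= mulrC mulfK.
Qed.

Lemma Cinfty_tangent p : Cinfty p -> Cinfty (tangent p).
Proof.
move=> sp; apply: CinftyD; first exact: Cinfty_partial.
by apply: CinftyM; exact: Cinfty_partial.
Qed.

Lemma test_tangent Om p : test_function Om p -> test_function Om (tangent p).
Proof.
move=> tp; apply: testD; first exact: test_partial.
by apply: testM; [exact: Cinfty_partial|exact: test_partial].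
Qed.

Lemma tshift_cbox rho : exists rho', forall h x, `|h| <= 1 ->
  cbox rho (tshift h x) -> cbox rho' x.
Proof.
have [b b0 Gb] := bounded_on_cbox (rho + 1) (Cinfty_continuous sG).
exists (rho + 1 + (b + b)) => h x h1.
have xE : x = tshift (- h) (tshift h x) by rewrite tshiftK.
rewrite {2}xE; move: (tshift h x) => y {xE} yr l.
have d1 a b' (c : R) : `|c * (a == b' :> 'I_m)%:R| <= `|c|.
  by case: (a == b'); rewrite ?mulr1// mulr0 normr0.
rewrite tshiftE !mxE.
have yh : cbox (rho + 1) (y + (- h) *: e_ j).
  move=> a; rewrite !mxE (le_trans (ler_normD _ _))// lerD//.
  by rewrite (le_trans (d1 _ _ _))// normrN.
have yr1 : cbox (rho + 1) y by move=> a; rewrite (le_trans (yr a))// lerDl.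
rewrite (le_trans (ler_normD _ _))// lerD//; first by have := yh l; rewrite !mxE.
by rewrite (le_trans (d1 _ _ _))// (le_trans (ler_normB _ _))// lerD// Gb.
Qed.

(** The quotient is the value of [tangent chi] at an intermediate time of the flow; a second mean
    value step bounds the difference by |h| times the second derivative along the flow. For |h| <= 1
    everything is supported in one box. *)
Lemma diffq_L2_cvg Om chi : test_function Om chi ->
  exists2 K, 0 <= K & forall h, h != 0 -> `|h| <= 1 ->
    `N (diffq h chi - tangent chi) <= `|h| * K.
Proof.
move=> tchi; have schi := test_Cinfty tchi.
have [rho r0 chir] := test_support_cbox tchi.
have [rho' rr'] := tshift_cbox rho.
have [a a0 ta] := test_bounded (test_tangent (test_tangent tchi)).
pose mr := Num.max rho rho'.
exists (a * Num.sqrt (fine (mu (cbox mr)))); first by rewrite mulr_ge0 ?sqrtr_ge0.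
move=> h h0 h1; rewrite mulrA.
have := @cbox_supported_L2 _ _ (diffq h chi - tangent chi) (`|h| * a) mr.
case=> //.
- apply: Cinfty_measurable; apply: CinftyB; first exact: Cinfty_diffq.
  exact: Cinfty_tangent.
- by rewrite mulr_ge0.
- move=> x; have [c ch e] := diffq_mean_value x schi h0.
  rewrite !fctE e.
  have [c' cc' e'] := mean_value 0 c (fun s => is_derive_tshift x s (Cinfty_tangent schi)).
  move: e'; rewrite subr0 tshift0 => ->; rewrite normrM mulrC.
  by rewrite ler_pM.
- move=> x; apply: contraNP => xr.
  have cr : closed (cbox rho : set 'rV[R]_m).
    by apply: compact_closed; [exact: norm_hausdorff|exact: compact_cbox].
  have xr1 : ~ cbox rho x.
    by apply: contra_not xr => xr l; rewrite (le_trans (xr l))// le_max lexx.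
  have xr2 : ~ cbox rho (tshift h x).
    by apply: contra_not xr => /(rr' _ _ h1) xr l; rewrite (le_trans (xr l))// le_max lexx orbT.
  have z q y : (forall x, q x != 0 -> cbox rho x) -> ~ cbox rho y -> q y = 0.
    by move=> qr; apply: contra_notP => /eqP/qr.
  rewrite !fctE /diffq /tangent !fctE /shifted /= !(z chi)//.
  rewrite !(z (partial _ chi))//; try exact: partial_off.
  by rewrite subrr scaler0 mulr0 addr0 subrr.
Qed.

Lemma diffq_double h p : h != 0 ->
  diffq (2 * h) p = 2^-1 *: (shifted h (diffq h p) + diffq h p).
Proof.
move=> h0; apply/funext => x; rewrite /diffq !fctE /shifted /= ?fctE /= tshiftD.
rewrite [h + h](_ : _ = 2 * h); last by ring.
by rewrite /GRing.scale /=; field.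
Qed.

(** The quotient for 2h is the average of two functions with the norm of the quotient for h.
    Repeated halving of h therefore does not decrease the norm, and it leads to [tangent chi]. *)
Lemma norm_diffq Om chi h : test_function Om chi -> h != 0 ->
  `N (diffq h chi) <= `N (tangent chi).
Proof.
move=> tchi h0; have chi2 := test_L2 tchi.
have half k : k != 0 -> `N (diffq (2 * k) chi) <= `N (diffq k chi).
  move=> k0; have d2 := L2_diffq k chi2; have s2 := L2_shifted k d2.
  rewrite diffq_double// L2_normZ//; last exact: L2D.
  rewrite ger0_norm ?invr_ge0// mulrC ler_pdivrMr// mulrDr mulr1.
  by rewrite (le_trans (ler_L2_normD _ s2 d2))// norm_shifted.
have halfn n : `N (diffq h chi) <= `N (diffq (2^-1 ^+ n * h) chi).
  elim: n => [|n IH]; first by rewrite expr0 mul1r.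
  apply: le_trans IH _; have := half (2^-1 ^+ n.+1 * h).
  rewrite mulf_neq0 ?expf_neq0 ?invr_neq0// => /(_ isT).
  by rewrite exprS !mulrA divff// mul1r.
have [K K0 cK] := diffq_L2_cvg tchi.
apply: (@le_of_eps _ _ _ K) => // e e0 e1.
have hp : 0 < `|h| by rewrite normr_gt0.
have [n ne] := exists_half_pow_le (divr_gt0 e0 hp).
apply: le_trans (halfn n) _; set k := 2^-1 ^+ n * h.
have ke : `|k| <= e.
  by rewrite normrM ger0_norm ?exprn_ge0// -ler_pdivlMr.
have k0 : k != 0 by rewrite mulf_neq0 ?expf_neq0 ?invr_neq0.
have t2 := test_L2 (test_tangent tchi); have d2 := L2_diffq k chi2.
have -> : diffq k chi = tangent chi + (diffq k chi - tangent chi) by rewrite addrC subrK.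
rewrite (le_trans (ler_L2_normD _ t2 (L2B _ d2 t2)))// lerD2l.
by rewrite (le_trans (cK k k0 (le_trans ke e1)))// ler_wpM2r.
Qed.

End tangential_shift.

Section shifted_values.
Context {R : realType} {m : nat} (i j : 'I_m) (G : 'rV[R]_m -> R).

Lemma shiftedE h (p : 'rV[R]_m -> R) x : shifted i j G h p x = p (tshift i j G h x).
Proof. by []. Qed.

Lemma diffq_slopeE h l x : diffq_slope j G h l x =
  h^-1 * (partial l G (x + h *: delta_mx ord0 j) - partial l G x).
Proof. by []. Qed.

End shifted_values.

(* Unfolding these makes unification explode. *)
Opaque partial L2_norm L2_inner diffq shifted tangent diffq_slope.

(** * The energy estimate along the tangential flow *)

Section tangential_estimate.
Context {R : realType} {m : nat} (i j : 'I_m) (G : 'rV[R]_m -> R).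
Hypotheses (sG : Cinfty G) (iG : indep_of i G).
Local Notation fn := ('rV[R]_m -> R).
Implicit Types (p q chi psi : fn) (x y : 'rV[R]_m) (h : R) (l : 'I_m).
Local Notation e_ l := (delta_mx ord0 l).
Local Notation mu := (@rV_lebesgue R m).
Local Notation "`N u" := (L2_norm setT u) (at level 9).
Local Notation "<< u , v >>" := (L2_inner setT u v).
Local Notation diffq := (diffq i j G).
Local Notation shifted := (shifted i j G).
Local Notation tangent := (tangent i j G).
Local Notation tshift := (tshift i j G).
Local Notation slope := (diffq_slope j G).
Variables (Om : set 'rV[R]_m) (rho C : R).
Hypothesis Om_rho : Om `<=` cbox rho.
Hypothesis C_ge0 : 0 <= C.
Hypothesis CG : forall x, cbox (rho + 1) x -> `|partial j G x| <= C.
Hypothesis CGG : forall l x, cbox (rho + 1) x -> `|partial j (partial l G) x| <= C.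

Lemma test_cbox psi x : test_function Om psi -> psi x != 0 -> cbox rho x.
Proof.
move=> tpsi; apply: contra_neqP => xr; apply: (test_off tpsi).
by apply: contra_not xr; exact: Om_rho.
Qed.

(** Since G ignores the i-component, x and x + h e_j may be replaced by y - h e_j and y, where y =
    [tshift h x] lies in the box of Om. The intermediate point is then within distance 1 of that
    box, where C bounds the second derivatives. *)
Lemma slope_bound h l psi x : h != 0 -> `|h| <= 1 -> test_function Om psi ->
  shifted h psi x != 0 -> `|slope h l x| <= C.
Proof.
move=> h0 h1 tpsi; rewrite shiftedE => /(test_cbox tpsi) xr.
have iGl := indep_partial l sG iG.
set y := tshift h x in xr.
have e1 : partial l G (x + h *: e_ j) = partial l G (0 *: e_ j + y).
  by rewrite scale0r add0r /y tshiftE iGl.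
have e0 : partial l G x = partial l G ((- h) *: e_ j + y).
  by rewrite /y tshiftE addrA iGl scaleNr [- _ + _]addrC addrK.
have sl : forall t : R, is_derive t 1 (fun t => partial l G (t *: e_ j + y))
    (partial j (partial l G) (t *: e_ j + y)).
  move=> t; apply/(is_derive_line (partial l G) y (e_ j)).
  exact/Cinfty_is_derive/Cinfty_partial.
have [c] := mean_value 0 (- h) sl; rewrite !subr0 normrN => ch e.
rewrite diffq_slopeE e1 e0 -opprB e !mulrN opprK mulrCA mulVf// mulr1.
clearbody y; apply: CGG => a; rewrite !mxE (le_trans (ler_normD _ _))// [leLHS]addrC lerD ?xr//.
have d1 (b : bool) : `|c * b%:R| <= `|c| by case: b; rewrite ?mulr1// mulr0 normr0.
by rewrite (le_trans (d1 _))// (le_trans ch).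
Qed.

Lemma norm_slopeM h l psi : h != 0 -> `|h| <= 1 -> test_function Om psi ->
  L2 setT (slope h l * shifted h psi) /\ `N (slope h l * shifted h psi) <= C * `N psi.
Proof.
move=> h0 h1 tpsi; have s2 := L2_shifted j sG iG h (test_L2 tpsi).
have sb := slope_bound l h0 h1 tpsi.
have p2 : L2 setT (slope h l * shifted h psi).
  apply: (L2_boundedM s2) sb; apply: Cinfty_measurable; apply: CinftyZ; apply: CinftyB.
    by apply: Cinfty_shear; [exact: Cinfty_partial|exact: Cinfty_cst].
  exact: Cinfty_partial.
split => //; rewrite -(norm_shifted j sG iG h (test_L2 tpsi)).
apply: ler_L2_normZ => // x _; rewrite normrM.
have [->|/sb sx] := eqVneq (shifted h psi x) 0; first by rewrite normr0 !mulr0.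
by rewrite ler_wpM2r.
Qed.

Lemma norm_tangent psi : test_function Om psi ->
  `N (tangent psi) <= `N (partial j psi) + C * `N (partial i psi).
Proof.
move=> tpsi; have p2 l := test_L2 (test_partial l tpsi).
have b x : partial i psi x != 0 -> `|partial j G x| <= C.
  move=> /(test_cbox (test_partial i tpsi)) xr; apply: CG => l.
  by rewrite (le_trans (xr l))// lerDl.
have g2 : L2 setT (partial j G * partial i psi).
  by apply: (L2_boundedM (p2 i) _ b); exact: Cinfty_measurable (Cinfty_partial _ sG).
rewrite (le_trans (ler_L2_normD _ (p2 j) g2))// lerD2l.
apply: ler_L2_normZ => // x _; rewrite normrM.
have [->|/b bx] := eqVneq (partial i psi x) 0; first by rewrite normr0 !mulr0.
by rewrite ler_wpM2r.
Qed.

Variables (F : fn) (w : 'I_m -> fn).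
Hypothesis F2 : L2 setT F.
Hypothesis w2 : forall l, L2 setT (w l).
Hypothesis weak : forall chi, test_function Om chi ->
  \sum_l << w l, partial l chi >> = << F, chi >>.

(** * The estimate at a fixed step h *)

Section fixed_shift.
Variables (h : R) (psi q r : fn).
Hypotheses (h0 : h != 0) (h1 : `|h| <= 1) (tpsi : test_function Om psi).
Hypotheses (qE : q = diffq h psi) (rE : r = diffq (- h) q).
Hypothesis tq : test_function Om q.
Hypothesis tr : test_function Om r.
Local Notation P := (\sum_l `N (partial l psi)).
Local Notation E := (\sum_l `N (partial l psi - w l)).
Local Notation X l := (`N (partial l q)).
Let hN0 : - h != 0. Proof. by rewrite oppr_eq0. Qed.
Let hN1 : `|- h| <= 1. Proof. by rewrite normrN. Qed.
Let p2 l : L2 setT (partial l psi). Proof. exact: test_L2 (test_partial l tpsi). Qed.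
Let q2 l : L2 setT (partial l q). Proof. exact: test_L2 (test_partial l tq). Qed.
Let r2 l : L2 setT (partial l r). Proof. exact: test_L2 (test_partial l tr). Qed.
Let P_ge l : `N (partial l psi) <= P.
Proof. by rewrite (bigD1 l)//= lerDl sumr_ge0// => *; exact: L2_norm_ge0. Qed.

Let alg (a b c : R) : a + b = b + c - (- a + c).
Proof. by rewrite opprD opprK addrACA subrr addr0 addrC. Qed.

(** The commutator rule is applied to q and to r, and one quotient is moved across the inner
    product. Up to two commutator terms, |d_l q|^2 becomes - <d_l psi, d_l r>, which the weak
    equation tested with r controls. *)
Let step l : X l ^+ 2 =
  << slope h l * shifted h (partial i psi), partial l q >> +
  << partial l psi, slope (- h) l * shifted (- h) (partial i q) >> -
  << partial l psi, partial l r >>.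
Proof.
have [s2 _] := norm_slopeM l h0 h1 (test_partial i tpsi).
have [s2' _] := norm_slopeM l hN0 hN1 (test_partial i tq).
have dq2 := L2_diffq j sG iG (- h) (q2 l).
have dp2 := L2_diffq j sG iG h (p2 l).
have -> : partial l r = diffq (- h) (partial l q) + slope (- h) l * shifted (- h) (partial i q).
  rewrite rE; exact: (partial_diffq i j sG l hN0 (test_Cinfty tq)).
rewrite L2_innerDr//.
have e : << partial l psi, diffq (- h) (partial l q) >> = - << diffq h (partial l psi), partial l q >>.
  by rewrite (inner_diffqC j sG iG h (p2 l) (q2 l)) opprK.
rewrite e sqr_L2_norm.
have {1}-> : partial l q = diffq h (partial l psi) + slope h l * shifted h (partial i psi).
  rewrite qE; exact: (partial_diffq i j sG l h0 (test_Cinfty tpsi)).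
rewrite L2_innerDl//; exact: alg.
Qed.

(** With M the largest [X l], the sum of the identities [step] bounds M^2 by a constant times M, and
    one factor M cancels. The weak equation holds for w and not for the gradient of psi; the
    resulting error is paired with d_l r, of norm at most (2/|h| + C) M, which is the origin of the
    last term. *)
Lemma diffq_estimate l : X l <=
  (m + 2)%:R * C * P + (1 + C) * `N F + E * (2 / `|h| + C).
Proof.
have X0 l' : 0 <= X l' by exact: L2_norm_ge0.
have E0 l' : 0 <= `N (partial l' psi - w l') by exact: L2_norm_ge0.
have P0 : 0 <= P by rewrite sumr_ge0// => *; exact: L2_norm_ge0.
have [l0 _ lmax] := arg_maxP (fun l => X l) (erefl : xpredT l).
have [M ME] : exists M, M = X l0 by exists (X l0).
have {}lmax l' : X l' <= M by rewrite ME; exact: lmax.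
have h20 : 0 <= 2 / `|h| + C by rewrite addr_ge0// divr_ge0.
have r_le l' : `N (partial l' r) <= (2 / `|h| + C) * M.
  have dq2 := L2_diffq j sG iG (- h) (q2 l').
  have [s2 sn] := norm_slopeM l' hN0 hN1 (test_partial i tq).
  have -> : partial l' r = diffq (- h) (partial l' q) + slope (- h) l' * shifted (- h) (partial i q).
    rewrite rE; exact: (partial_diffq i j sG l' hN0 (test_Cinfty tq)).
  apply: le_trans (ler_L2_normD measurableT dq2 s2) _; rewrite [leRHS]mulrDl.
  apply: lerD.
    apply: le_trans (norm_diffq_le j sG iG (- h) (q2 l')) _; rewrite normrN.
    by apply: ler_wpM2l; [rewrite divr_ge0|exact: lmax].
  apply: le_trans sn _.
  apply: ler_wpM2l.
    exact: C_ge0.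
  exact: lmax.
(* No factor 1/|h| is lost here: [norm_diffq] bounds r by first derivatives of q. *)
have rn : `N r <= (1 + C) * M.
  rewrite rE (le_trans (norm_diffq j sG iG tq hN0))//.
  apply: le_trans (norm_tangent tq) _; rewrite mulrDl mul1r; apply: lerD; first exact: lmax.
  by apply: ler_wpM2l; [exact: C_ge0|exact: lmax].
have S_le : \sum_l X l ^+ 2 <= ((m + 1)%:R * C * P + (1 + C) * `N F + E * (2 / `|h| + C)) * M.
  under eq_bigr do rewrite step.
  rewrite sumrB big_split /=.
  have wE : \sum_l' << partial l' psi, partial l' r >> =
      << F, r >> + \sum_l' << partial l' psi - w l', partial l' r >>.
    rewrite -(weak tr) -big_split /=; apply: eq_bigr => l' _.
    by rewrite L2_innerBl// addrC subrK.
  rewrite wE.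
  have b1 : \sum_l' << slope h l' * shifted h (partial i psi), partial l' q >> <= m%:R * (C * P * M).
    apply: (@le_trans _ _ (\sum_(l' < m) C * P * M)); last first.
      by rewrite sumr_const card_ord mulr_natl.
    apply: ler_sum => l' _.
    have [s2 sn] := norm_slopeM l' h0 h1 (test_partial i tpsi).
    rewrite (le_trans (le_cauchy_schwarz _ s2 (q2 l')))// ler_pM ?L2_norm_ge0//.
    by rewrite (le_trans sn)// ler_wpM2l.
  have b2 : \sum_l' << partial l' psi, slope (- h) l' * shifted (- h) (partial i q) >> <= C * P * M.
    apply: (@le_trans _ _ (\sum_l' `N (partial l' psi) * (C * M))).
      apply: ler_sum => l' _.
      have [s2 sn] := norm_slopeM l' hN0 hN1 (test_partial i tq).
      rewrite (le_trans (le_cauchy_schwarz _ (p2 l') s2))// ler_wpM2l ?L2_norm_ge0//.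
      by rewrite (le_trans sn)// ler_wpM2l//; exact: lmax.
    by rewrite -mulr_suml [C * P]mulrC mulrA.
  have b3 : - << F, r >> <= (1 + C) * `N F * M.
    rewrite (le_trans (ler_norm _))// normrN (le_trans (cauchy_schwarz _ F2 (test_L2 tr)))//.
    by rewrite -mulrA mulrCA ler_wpM2l ?L2_norm_ge0.
  have b4 : - (\sum_l' << partial l' psi - w l', partial l' r >>) <= E * (2 / `|h| + C) * M.
    rewrite -sumrN -mulrA mulr_suml; apply: ler_sum => l' _.
    have d2 := L2B measurableT (p2 l') (w2 l').
    rewrite (le_trans (ler_norm _))// normrN (le_trans (cauchy_schwarz _ d2 (r2 l')))//.
    by rewrite ler_wpM2l.
  move: b1 b2 b3 b4; rewrite natrD.
  move: (\sum_l' _) (\sum_l' _) (\sum_l' _) (<< F, r >>) (E * _) => a b c d e.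
  move=> b1 b2 b3 b4; rewrite !mulrDl; lra.
have M2 : M ^+ 2 <= \sum_l X l ^+ 2.
  by rewrite ME (bigD1 l0)//= lerDl sumr_ge0// => *; exact: sqr_ge0.
apply: le_trans (lmax l) _.
have [M0|M0] := leP M 0.
  apply: le_trans M0 _; rewrite !addr_ge0 ?mulr_ge0 ?addr_ge0 ?L2_norm_ge0//.
  by rewrite sumr_ge0.
have := le_trans M2 S_le; rewrite expr2 ler_pM2r// => /le_trans; apply.
rewrite !lerD2r -!mulrA ler_wpM2r ?mulr_ge0// ler_nat; lia.
Qed.

Lemma diffq_partial_estimate l : `N (diffq h (partial l psi)) <=
  (m + 3)%:R * C * P + (1 + C) * `N F + E * (2 / `|h| + C).
Proof.
have [s2 sn] := norm_slopeM l h0 h1 (test_partial i tpsi).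
have -> : diffq h (partial l psi) = partial l q - slope h l * shifted h (partial i psi).
  rewrite qE (partial_diffq i j sG l h0 (test_Cinfty tpsi)).
  by rewrite addrK.
rewrite (le_trans (ler_L2_normD _ (q2 l) (L2N measurableT s2)))// L2_normN//.
have := diffq_estimate l; have : `N (slope h l * shifted h (partial i psi)) <= C * P.
  by rewrite (le_trans sn)// ler_wpM2l.
have -> : (m + 3)%:R = (m + 2)%:R + 1 :> R by rewrite -[1]/(1%:R) -natrD -addnA.
move: (`N _) (`N _) (m + 2)%:R (E * _) (_ * `N F) => a b c d e.
by rewrite !mulrDl mul1r; lra.
Qed.

End fixed_shift.

Variables (adm : fn -> Prop) (h_adm : R).
Hypothesis h_adm_gt0 : 0 < h_adm.
Hypothesis admP : forall psi h, adm psi -> `|h| <= h_adm ->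
  [/\ test_function Om psi, test_function Om (diffq h psi) &
      test_function Om (diffq (- h) (diffq h psi))].
Hypothesis adm_dense : forall e, 0 < e -> exists2 psi, adm psi &
  forall l, `N (partial l psi - w l) <= e.

(** The quotient is moved from chi to d_a psi, where the estimate at fixed step applies. As h_adm
    does not depend on psi, psi can approach the solution at fixed h, which removes the terms with
    1/|h|; then h tends to 0. *)
Lemma tangential_bound a : exists2 K, 0 <= K & forall chi,
  test_function setT chi -> `|<< w a, tangent chi >>| <= K * `N chi.
Proof.
pose W := \sum_l `N (w l).
have W0 : 0 <= W by rewrite sumr_ge0// => *; exact: L2_norm_ge0.
pose K := (m + 3)%:R * C * W + (1 + C) * `N F.
have K0 : 0 <= K by rewrite addr_ge0 ?mulr_ge0 ?addr_ge0 ?L2_norm_ge0.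
exists K => // chi tchi; have chi2 := test_L2 tchi.
have bh h : h != 0 -> `|h| <= h_adm -> `|h| <= 1 -> `|<< w a, diffq h chi >>| <= K * `N chi.
  move=> h0 hadm h1; have d2 := L2_diffq j sG iG h chi2.
  have hN0 : - h != 0 by rewrite oppr_eq0.
  (* The coefficient of e in the total error when the partial derivatives of psi are within e of w;
     it may depend on h. *)
  pose c := ((m + 3)%:R * C * m%:R + m%:R * (2 / `|h| + C)) * `N chi + `N (diffq h chi).
  have c0 : 0 <= c by rewrite !(addr_ge0, mulr_ge0)// ?L2_norm_ge0// divr_ge0.
  apply: (le_of_eps c0) => e e0 _; have [psi apsi psie] := adm_dense e0.
  have [|tpsi tq tr] := admP (h := - h) apsi; first by rewrite normrN.
  have p2 l := test_L2 (test_partial l tpsi).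
  have wp2 l := L2B measurableT (p2 l) (w2 l).
  have -> : << w a, diffq h chi >> = << partial a psi, diffq h chi >> - << partial a psi - w a, diffq h chi >>.
    by rewrite L2_innerBl// opprB addrC subrK.
  have b1 : `|<< partial a psi, diffq h chi >>| <=
      ((m + 3)%:R * C * (W + m%:R * e) + (1 + C) * `N F + (m%:R * e) * (2 / `|h| + C)) * `N chi.
    have -> : << partial a psi, diffq h chi >> = - << diffq (- h) (partial a psi), chi >>.
      by rewrite (inner_diffqC j sG iG (- h) (p2 a) chi2) !opprK.
    have dp2 := L2_diffq j sG iG (- h) (p2 a).
    rewrite normrN (le_trans (cauchy_schwarz _ dp2 chi2))// ler_wpM2r ?L2_norm_ge0//.
    have hN1 : `|- h| <= 1 by rewrite normrN.
    apply: le_trans (diffq_partial_estimate hN0 hN1 tpsi erefl erefl tq tr a) _.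
    have E_le : \sum_l `N (partial l psi - w l) <= m%:R * e.
      apply: (@le_trans _ _ (\sum_(l' < m) e)); last first.
        by rewrite sumr_const card_ord mulr_natl.
      by apply: ler_sum => l' _.
    rewrite normrN lerD//; last by rewrite ler_wpM2r// addr_ge0// divr_ge0.
    rewrite lerD2r ler_wpM2l ?mulr_ge0//.
    apply: le_trans (_ : W + \sum_l `N (partial l psi - w l) <= _); last by rewrite lerD2l.
    rewrite -big_split /=; apply: ler_sum => l _.
    have {1}-> : partial l psi = w l + (partial l psi - w l) by rewrite addrC subrK.
    exact: ler_L2_normD.
  have b2 : `|<< partial a psi - w a, diffq h chi >>| <= e * `N (diffq h chi).
    by rewrite (le_trans (cauchy_schwarz _ (wp2 a) d2))// ler_wpM2r ?L2_norm_ge0.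
  rewrite (le_trans (ler_normB _ _))// (le_trans (lerD b1 b2))// /c /K.
  move: (`N chi) (`N F) (`N (diffq h chi)) (2 / `|h| + C) ((m + 3)%:R) => n1 n2 n3 n4 n5.
  by rewrite le_eqVlt; apply/orP; left; apply/eqP; ring.
have [D D0 cD] := diffq_L2_cvg j sG iG tchi.
have c0 : 0 <= `N (w a) * D by rewrite mulr_ge0 ?L2_norm_ge0.
apply: (le_of_eps c0) => e e0 e1.
pose h := Num.min e h_adm.
have h0 : 0 < h by rewrite lt_min e0.
have he : `|h| <= e by rewrite gtr0_norm// ge_min lexx.
have ha : `|h| <= h_adm by rewrite gtr0_norm// ge_min lexx orbT.
have hn0 : h != 0 by rewrite gt_eqF.
have h1 := le_trans he e1.
have d2 := L2_diffq j sG iG h chi2.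
have t2 := test_L2 (test_tangent i j sG tchi).
have -> : << w a, tangent chi >> = << w a, diffq h chi >> - << w a, diffq h chi - tangent chi >>.
  by rewrite L2_innerBr// opprB addrC subrK.
rewrite (le_trans (ler_normB _ _))// lerD//; first exact: bh.
rewrite (le_trans (cauchy_schwarz _ (w2 a) (L2B _ d2 t2)))// mulrCA ler_wpM2l ?L2_norm_ge0//.
by rewrite (le_trans (cD h hn0 h1))// ler_wpM2r.
Qed.

End tangential_estimate.

Transparent partial L2_norm L2_inner diffq shifted tangent diffq_slope.

Lemma Cinfty0 (R : realType) m : Cinfty (0 : 'rV[R]_m -> R).
Proof. exact: Cinfty_cst. Qed.

Lemma indep0 (R : realType) m (i : 'I_m) : indep_of i (0 : 'rV[R]_m -> R).
Proof. by []. Qed.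

Lemma partial_indep (R : realType) m (i : 'I_m) (A : 'rV[R]_m -> R) :
  indep_of i A -> partial i A = 0.
Proof.
move=> iA; apply/funext => x; apply: partialE; apply/is_deriveP.
rewrite (_ : (fun h : R => _) = cst 0); first exact: cvg_cst.
by apply/funext => h; rewrite [h *: _ + x]addrC iA subrr mulr0.
Qed.

(** * Translations and integration by parts *)

Section translations.
Context {R : realType} {m : nat}.
Local Notation fn := ('rV[R]_m -> R).
Implicit Types (p q chi psi zeta f u v : fn) (h : R) (l a b : 'I_m) (w : 'I_m -> fn).
Local Notation "`N u" := (L2_norm setT u) (at level 9).
Local Notation "<< u , v >>" := (L2_inner setT u v).
Local Notation transq l := (diffq l l (0 : fn)).

Lemma tangent0 l p : tangent l l 0 p = partial l p.
Proof. by rewrite /tangent (partial_cst 0) mul0r addr0. Qed.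

Lemma partial_transq l a h p : h != 0 -> Cinfty p ->
  partial a (transq l h p) = transq l h (partial a p).
Proof.
move=> h0 sp; rewrite (partial_diffq l l (@Cinfty0 R m) a h0 sp).
rewrite (_ : diffq_slope l 0 h a = 0) ?mul0r ?addr0//.
by apply/funext => x; rewrite diffq_slopeE (partial_cst 0) subrr mulr0.
Qed.

Lemma diffqE i j G h p x : diffq i j G h p x = h^-1 * (shifted i j G h p x - p x).
Proof. by []. Qed.

Lemma transq_cvg l chi : test_function setT chi -> exists2 K, 0 <= K &
  forall h, h != 0 -> `|h| <= 1 -> `N (transq l h chi - partial l chi) <= `|h| * K.
Proof.
by move=> tchi; have := diffq_L2_cvg l (@Cinfty0 R m) (@indep0 R m l) tchi; rewrite tangent0.
Qed.

Opaque L2 partial L2_norm L2_inner diffq shifted tangent.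

Lemma eq_of_eps (x y c : R) : 0 <= c ->
  (forall e, 0 < e -> e <= 1 -> `|x - y| <= e * c) -> x = y.
Proof.
move=> c0 xy; apply/eqP; rewrite -subr_eq0 -normr_le0.
by apply: (le_of_eps c0) => e e0 e1; rewrite add0r xy.
Qed.

Let algA (z P Q : R) : P - - Q = - (- z - P) - (z - Q).
Proof. by lra. Qed.

Let algB (z P Q : R) : P - Q = (z - Q) - (z - P).
Proof. by lra. Qed.

(** This is the limit of [inner_diffqC] for i = j = l and G = 0, where the flow is the translation
    along e_l. *)
Lemma partial_parts l psi chi : test_function setT psi -> test_function setT chi ->
  << partial l psi, chi >> = - << psi, partial l chi >>.
Proof.
move=> tp tc; have p2 := test_L2 tp; have c2 := test_L2 tc.
have dp2 := test_L2 (test_partial l tp); have dc2 := test_L2 (test_partial l tc).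
have [K K0 cK] := transq_cvg l tp; have [K' K'0 cK'] := transq_cvg l tc.
apply: (@eq_of_eps _ _ (K * `N chi + `N psi * K')).
  by rewrite addr_ge0// mulr_ge0// L2_norm_ge0.
move=> e e0 e1; have en0 : e != 0 by rewrite gt_eqF.
have enN : - e != 0 by rewrite oppr_eq0.
have ne : `|e| = e by rewrite gtr0_norm.
have q2 := L2_diffq l (@Cinfty0 R m) (@indep0 R m l) e p2.
have q2' := L2_diffq l (@Cinfty0 R m) (@indep0 R m l) (- e) c2.
have b1 := cK e en0; rewrite ne in b1; have {}b1 := b1 e1.
have b2 := cK' (- e) enN; rewrite normrN ne in b2; have {}b2 := b2 e1.
have i1 := inner_diffqC l (@Cinfty0 R m) (@indep0 R m l) e p2 c2.
have d1 := L2B measurableT q2 dp2; have d2 := L2B measurableT q2' dc2.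
have e1' : << transq l e psi - partial l psi, chi >> =
    << transq l e psi, chi >> - << partial l psi, chi >>.
  exact: (L2_innerBl measurableT q2 dp2 c2).
have e2' : << psi, transq l (- e) chi - partial l chi >> =
    << psi, transq l (- e) chi >> - << psi, partial l chi >>.
  exact: (L2_innerBr measurableT q2' dc2 p2).
have -> : << partial l psi, chi >> - - << psi, partial l chi >> =
    - << transq l e psi - partial l psi, chi >> - << psi, transq l (- e) chi - partial l chi >>.
  by rewrite e1' e2' i1; exact: algA.
apply: le_trans (ler_normB _ _) _; rewrite normrN mulrDr; apply: lerD.
  apply: le_trans (cauchy_schwarz measurableT d1 c2) _.
  by rewrite mulrA ler_wpM2r// L2_norm_ge0.
apply: le_trans (cauchy_schwarz measurableT p2 d2) _.
by rewrite mulrCA ler_wpM2l// L2_norm_ge0.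
Qed.

(** d_b commutes with translation quotients along e_a. The identity therefore follows from
    [partial_parts] for a quotient of chi, in the limit of small steps. *)
Lemma partial_parts2 a b psi chi : test_function setT psi -> test_function setT chi ->
  << partial a psi, partial b chi >> = << partial b psi, partial a chi >>.
Proof.
move=> tp tc; have p2 := test_L2 tp; have c2 := test_L2 tc.
have dp2 l := test_L2 (test_partial l tp); have dc2 l := test_L2 (test_partial l tc).
have [K K0 cK] := transq_cvg a tp; have [K' K'0 cK'] := transq_cvg a tc.
apply: (@eq_of_eps _ _ (K * `N (partial b chi) + `N (partial b psi) * K')).
  by rewrite addr_ge0// mulr_ge0// L2_norm_ge0.
move=> e e0 e1; have en0 : e != 0 by rewrite gt_eqF.
have enN : - e != 0 by rewrite oppr_eq0.
have ne : `|e| = e by rewrite gtr0_norm.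
have q2 := L2_diffq a (@Cinfty0 R m) (@indep0 R m a) e p2.
have q2' := L2_diffq a (@Cinfty0 R m) (@indep0 R m a) (- e) c2.
have b1 := cK e en0; rewrite ne in b1; have {}b1 := b1 e1.
have b2 := cK' (- e) enN; rewrite normrN ne in b2; have {}b2 := b2 e1.
have i1 := inner_diffqC a (@Cinfty0 R m) (@indep0 R m a) e p2 (dc2 b).
have tq : test_function setT (transq a (- e) chi).
  apply/test_functionP; split.
    exact: Cinfty_diffq (@Cinfty0 R m) _ _ (test_Cinfty tc).
  have [rho r0 cr] := test_support_cbox tc.
  have [rho' rr'] := tshift_cbox a (@Cinfty0 R m) (@indep0 R m a) rho.
  exists (cbox (Num.max rho rho')); split => //; first exact: compact_cbox.
  move=> x qx; have [cx|/cr xr l] := eqVneq (chi x) 0; last first.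
    by rewrite (le_trans (xr l))// le_max lexx.
  have : chi (tshift a a 0 (- e) x) != 0.
    apply: contra_neq qx => cx'.
    rewrite diffqE.
    by rewrite shiftedE cx cx' subrr mulr0.
  move=> /cr/rr' xr l; rewrite (le_trans (xr _ l)) ?normrN ?ne//.
  by rewrite le_max lexx orbT.
have i2 := partial_parts b tp tq.
rewrite (partial_transq a b enN (test_Cinfty tc)) in i2.
have d1 := L2B measurableT q2 (dp2 a); have d2 := L2B measurableT q2' (dc2 a).
have e1' : << transq a e psi - partial a psi, partial b chi >> =
    << transq a e psi, partial b chi >> - << partial a psi, partial b chi >>.
  exact: (L2_innerBl measurableT q2 (dp2 a) (dc2 b)).
have e2' : << partial b psi, transq a (- e) chi - partial a chi >> =
    << partial b psi, transq a (- e) chi >> - << partial b psi, partial a chi >>.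
  exact: (L2_innerBr measurableT q2' (dc2 a) (dp2 b)).
have -> : << partial a psi, partial b chi >> - << partial b psi, partial a chi >> =
    << partial b psi, transq a (- e) chi - partial a chi >>
    - << transq a e psi - partial a psi, partial b chi >>.
  by rewrite e1' e2' i1 i2; exact: algB.
apply: le_trans (ler_normB _ _) _; rewrite mulrDr addrC; apply: lerD.
  apply: le_trans (cauchy_schwarz measurableT d1 (dc2 b)) _.
  by rewrite mulrA ler_wpM2r// L2_norm_ge0.
apply: le_trans (cauchy_schwarz measurableT (dp2 b) d2) _.
by rewrite mulrCA ler_wpM2l// L2_norm_ge0.
Qed.

End translations.

Transparent L2 partial L2_norm L2_inner diffq shifted tangent.

Opaque L2 partial L2_norm L2_inner.

(** * The space H^1_0 and the weak Poisson equation *)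

Section h10.
Context {R : realType} {m : nat} (Om : set 'rV[R]_m).
Local Notation fn := ('rV[R]_m -> R).
Implicit Types (p q chi psi zeta f u v F : fn) (h : R) (l a b : 'I_m) (w : 'I_m -> fn).
Local Notation "`N u" := (L2_norm setT u) (at level 9).
Local Notation "<< u , v >>" := (L2_inner setT u v).

(* v is in H^1_0(Om) with gradient w, both extended by 0 outside Om. *)
Definition h10 v w : Prop :=
  [/\ L2 setT v, forall l, L2 setT (w l) & forall e, 0 < e ->
    exists psi, [/\ test_function Om psi, `N (psi - v) <= e &
      forall l, `N (partial l psi - w l) <= e]].

(** With w the gradient of v, this is the weak form of -Delta v = F. *)
Definition weak_poisson w F : Prop :=
  forall chi, test_function Om chi -> \sum_l << w l, partial l chi >> = << F, chi >>.

Let algA (z P Q : R) : P - - Q = - (- z - P) - (z - Q).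
Proof. by lra. Qed.

Let algB (z P Q : R) : P - Q = (z - Q) - (z - P).
Proof. by lra. Qed.

Let testT chi : test_function Om chi -> test_function setT chi.
Proof. exact: test_function_mono. Qed.

(** The support of chi may meet the boundary of Om, because v is a limit of functions supported
    inside. *)
Lemma h10_parts v w l chi : h10 v w -> test_function setT chi ->
  << w l, chi >> = - << v, partial l chi >>.
Proof.
move=> [v2 w2 vw] tc; have c2 := test_L2 tc; have dc2 := test_L2 (test_partial l tc).
apply: (@eq_of_eps _ _ _ (`N chi + `N (partial l chi))); first by rewrite addr_ge0 ?L2_norm_ge0.
move=> e e0 _; have [psi [tp pv pw]] := vw e e0; have p2 := test_L2 tp.
have dp2 := test_L2 (test_partial l tp).
have d1 := L2B measurableT dp2 (w2 l); have d2 := L2B measurableT p2 v2.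
have i1 := partial_parts l (testT tp) tc.
have e1 : << partial l psi - w l, chi >> = << partial l psi, chi >> - << w l, chi >>.
  by rewrite L2_innerBl.
have e2 : << psi - v, partial l chi >> = << psi, partial l chi >> - << v, partial l chi >>.
  by rewrite L2_innerBl.
have -> : << w l, chi >> - - << v, partial l chi >> =
    - << partial l psi - w l, chi >> - << psi - v, partial l chi >>.
  by rewrite e1 e2 i1; exact: algA.
apply: le_trans (ler_normB _ _) _; rewrite normrN mulrDr; apply: lerD.
  apply: le_trans (cauchy_schwarz measurableT d1 c2) _.
  by rewrite ler_wpM2r ?L2_norm_ge0.
apply: le_trans (cauchy_schwarz measurableT d2 dc2) _.
by rewrite ler_wpM2r ?L2_norm_ge0.
Qed.

Lemma h10_sym v w a b chi : h10 v w -> test_function setT chi ->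
  << w a, partial b chi >> = << w b, partial a chi >>.
Proof.
move=> [v2 w2 vw] tc; have dc2 l := test_L2 (test_partial l tc).
apply: (@eq_of_eps _ _ _ (`N (partial b chi) + `N (partial a chi))).
  by rewrite addr_ge0 ?L2_norm_ge0.
move=> e e0 _; have [psi [tp pv pw]] := vw e e0.
have dp2 l := test_L2 (test_partial l tp).
have d l := L2B measurableT (dp2 l) (w2 l).
have i1 := partial_parts2 a b (testT tp) tc.
have e1 : << partial a psi - w a, partial b chi >> =
  << partial a psi, partial b chi >> - << w a, partial b chi >>.
  exact: (L2_innerBl measurableT (dp2 a) (w2 a) (dc2 b)).
have e2 : << partial b psi - w b, partial a chi >> =
  << partial b psi, partial a chi >> - << w b, partial a chi >>.
  exact: (L2_innerBl measurableT (dp2 b) (w2 b) (dc2 a)).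
have -> : << w a, partial b chi >> - << w b, partial a chi >> =
    << partial b psi - w b, partial a chi >> - << partial a psi - w a, partial b chi >>.
  by rewrite e1 e2 i1; exact: algB.
apply: le_trans (ler_normB _ _) _; rewrite mulrDr addrC; apply: lerD.
  apply: le_trans (cauchy_schwarz measurableT (d a) (dc2 b)) _.
  by rewrite ler_wpM2r ?L2_norm_ge0.
apply: le_trans (cauchy_schwarz measurableT (d b) (dc2 a)) _.
by rewrite ler_wpM2r ?L2_norm_ge0.
Qed.

Lemma test_mulL2 zeta f : test_function setT zeta -> L2 setT f ->
  exists2 K, 0 <= K & L2 setT (zeta * f) /\ `N (zeta * f) <= K * `N f.
Proof.
move=> tz f2; have [K K0 zK] := test_bounded tz; exists K => //.
have mz := Cinfty_measurable (test_Cinfty tz).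
have p2 : L2 setT (zeta * f) by apply: (L2_boundedM f2 mz) => x _; exact: zK.
split => //; apply: ler_L2_normZ => // x _.
by rewrite normrM ler_wpM2r.
Qed.

(** The approximants keep the form zeta * psi, so that their supports lie in that of zeta; the
    tangential estimate relies on this. *)
Lemma h10M_approx zeta v w e : test_function setT zeta -> h10 v w -> 0 < e ->
  exists psi, [/\ test_function Om psi, `N (zeta * psi - zeta * v) <= e &
    forall l, `N (partial l (zeta * psi) - (zeta * w l + partial l zeta * v)) <= e].
Proof.
move=> tz [v2 w2 vw] e0.
have tzl l := test_partial l tz.
have M2 z f : test_function setT z -> L2 setT f -> L2 setT (z * f).
  by move=> tz' f2'; have [? _ []] := test_mulL2 tz' f2'.
have [K K0 zK] := test_bounded tz.
have [K' K'0 zK'] : exists2 K', 0 <= K' & forall l x, `|partial l zeta x| <= K'.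
  have /choice[k kP] l : exists k, 0 <= k /\ forall x, `|partial l zeta x| <= k.
    by have [k ? ?] := test_bounded (tzl l); exists k.
  exists (\sum_l k l); first by rewrite sumr_ge0// => l _; have [] := kP l.
  move=> l x; rewrite (le_trans ((kP l).2 x))// (bigD1 l)//= lerDl sumr_ge0// => l' _.
  by have [] := kP l'.
have mulN z k f : test_function setT z -> L2 setT f -> 0 <= k -> (forall x, `|z x| <= k) ->
    `N (z * f) <= k * `N f.
  move=> tz' f2 k0 zk; apply: ler_L2_normZ => //; first exact: M2.
  by move=> x _; rewrite normrM ler_wpM2r.
have c0 : 0 < K + K' + 1 by rewrite ltr_wpDl ?addr_ge0.
have [psi [tp pv pw]] := vw _ (divr_gt0 e0 c0).
set d := e / (K + K' + 1) in pv pw.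
have d0 : 0 <= d by rewrite divr_ge0 ?ltW.
have de : (K + K' + 1) * d = e by rewrite /d mulrC divfK ?gt_eqF.
have p2 := test_L2 tp; have dp2 l := test_L2 (test_partial l tp).
have pv2 := L2B measurableT p2 v2; have pw2 l := L2B measurableT (dp2 l) (w2 l).
exists psi; split; first exact: tp.
- rewrite -mulrBr; apply: le_trans (mulN _ _ _ tz pv2 K0 zK) _.
  apply: le_trans (ler_wpM2l K0 pv) _; rewrite -de ler_wpM2r//.
  by rewrite -addrA lerDl addr_ge0.
- move=> l; rewrite partialM; [|exact: test_Cinfty tz|exact: test_Cinfty tp].
  rewrite [psi * _]mulrC opprD addrACA -!mulrBr.
  apply: le_trans (ler_L2_normD measurableT (M2 _ _ tz (pw2 l)) (M2 _ _ (tzl l) pv2)) _.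
  apply: (@le_trans _ _ (K * d + K' * d)); last first.
    by rewrite -mulrDl -de ler_wpM2r// lerDl.
  apply: lerD.
    by apply: le_trans (mulN _ _ _ tz (pw2 l) K0 zK) _; exact: ler_wpM2l.
  by apply: le_trans (mulN _ _ _ (tzl l) pv2 K'0 (zK' l)) _; exact: ler_wpM2l.
Qed.

Lemma h10M zeta v w : test_function setT zeta -> h10 v w ->
  h10 (zeta * v) (fun l => zeta * w l + partial l zeta * v).
Proof.
move=> tz vw; have [v2 w2 _] := vw.
have M2 z f : test_function setT z -> L2 setT f -> L2 setT (z * f).
  by move=> tz' f2'; have [? _ []] := test_mulL2 tz' f2'.
split=> [|l|e e0]; first exact: M2.
  apply: (L2D measurableT (M2 _ _ tz (w2 l))).
  exact: M2 (test_partial l tz) v2.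
have [psi [tp pv pw]] := h10M_approx tz vw e0.
by exists (zeta * psi); split => //; exact: testM (test_Cinfty tz) tp.
Qed.

Lemma inner_mulC f u v : << f * u, v >> = << u, f * v >>.
Proof. by apply: eq_L2_inner => x _; rewrite !fctE mulrCA mulrA. Qed.

(** The reason is -Delta(zeta v) = zeta F - 2 grad zeta . grad v - v Delta zeta; [H l] collects the
    l-th summands of 2 grad zeta . grad v + v Delta zeta. *)
Lemma weak_poissonM zeta v w F : test_function setT zeta -> h10 v w -> L2 setT F ->
  weak_poisson w F -> exists2 F', L2 setT F' &
  weak_poisson (fun l => zeta * w l + partial l zeta * v) F'.
Proof.
move=> tz vw F2 wF; have [v2 w2 _] := vw.
have sz := test_Cinfty tz; have tzl l := test_partial l tz.
have szl l := test_Cinfty (tzl l).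
have M2 z f : test_function setT z -> L2 setT f -> L2 setT (z * f).
  by move=> tz' f2'; have [? _ []] := test_mulL2 tz' f2'.
pose H l := partial l zeta * w l + partial l zeta * w l + partial l (partial l zeta) * v.
have H2 l : L2 setT (H l).
  by apply: L2D => //; [apply: L2D => //|]; apply: M2 => //; exact: test_partial.
have Hs2 : L2 setT (\sum_l H l) by apply: L2_sum => // l _; exact: H2.
exists (zeta * F - \sum_l H l); first by apply: L2B => //; exact: M2.
move=> chi tc; have sc := test_Cinfty tc; have c2 := test_L2 tc.
have cT := testT tc; have dc2 l := test_L2 (test_partial l tc).
rewrite L2_innerBl//; last exact: M2.
rewrite L2_inner_suml// inner_mulC -(wF (zeta * chi)); last exact: testM.
rewrite -sumrB; apply: eq_bigr => l _.
have zw := M2 _ _ tz (w2 l); have zv := M2 _ _ (tzl l) v2.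
have zlw := M2 _ _ (tzl l) (w2 l); have zllv := M2 _ _ (test_partial l (tzl l)) v2.
have tzc : test_function setT (partial l zeta * chi) by exact: testM.
have := h10_parts l vw tzc.
rewrite !partialM// L2_innerDl// /H !L2_innerDl//; last exact: L2D.
rewrite !inner_mulC.
have a1 := test_L2 (testM sz (test_partial l tc)).
have a2 := test_L2 (testM sc (tzl l)).
have a3 := test_L2 (testM (szl l) (test_partial l tc)).
have a4 := test_L2 (testM sc (test_partial l (tzl l))).
rewrite !L2_innerDr// [chi * partial l zeta]mulrC [chi * _]mulrC.
move: (<< _, _ >>) (<< v, _ >>) (<< v, _ >>) (<< w l, zeta * _ >>) => x y z t.
by move=> ->; lra.
Qed.

End h10.

Transparent L2 partial L2_norm L2_inner.

(** * Functionals bounded in the L^2 norm of the test function *)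

Section bounded_functionals.
Context {R : realType} {m : nat} (Om : set 'rV[R]_m).
Local Notation fn := ('rV[R]_m -> R).
Implicit Types (p q chi psi zeta f u v F : fn) (h : R) (l a b : 'I_m) (w : 'I_m -> fn).
Implicit Types L : fn -> R.
Local Notation "`N u" := (L2_norm setT u) (at level 9).
Local Notation "<< u , v >>" := (L2_inner setT u v).

(** For L chi = <w a, d_b chi> this expresses, through the Riesz representation, that the weak
    derivative d_b (w a) is in L^2. *)
Definition bounded_on_tests L : Prop :=
  exists2 K, 0 <= K & forall chi, test_function Om chi -> `|L chi| <= K * `N chi.

Lemma eq_bounded_on_tests L L' : (forall chi, test_function Om chi -> L chi = L' chi) ->
  bounded_on_tests L -> bounded_on_tests L'.
Proof. by move=> LL [K K0 KL]; exists K => // chi tc; rewrite -LL// KL. Qed.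

Lemma bounded_on_testsD L L' : bounded_on_tests L -> bounded_on_tests L' ->
  bounded_on_tests (fun chi => L chi + L' chi).
Proof.
move=> [K K0 KL] [K' K'0 KL']; exists (K + K'); first by rewrite addr_ge0.
move=> chi tc; rewrite (le_trans (ler_normD _ _))// mulrDl lerD//; first exact: KL.
exact: KL'.
Qed.

Lemma bounded_on_testsN L : bounded_on_tests L -> bounded_on_tests (fun chi => - L chi).
Proof. by move=> [K K0 KL]; exists K => // chi tc; rewrite normrN KL. Qed.

Lemma bounded_on_testsB L L' : bounded_on_tests L -> bounded_on_tests L' ->
  bounded_on_tests (fun chi => L chi - L' chi).
Proof. by move=> h1 h2; apply: bounded_on_testsD => //; exact: bounded_on_testsN. Qed.

Lemma bounded_on_tests_sum (I : Type) (r : seq I) (P : pred I) (L : I -> fn -> R) :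
  (forall k, P k -> bounded_on_tests (L k)) ->
  bounded_on_tests (fun chi => \sum_(k <- r | P k) L k chi).
Proof.
move=> bL; elim: r => [|k r IH].
  by exists 0 => // chi _; rewrite big_nil normr0 mul0r.
case Pk : (P k); last by apply: eq_bounded_on_tests IH => chi _; rewrite big_cons Pk.
apply: eq_bounded_on_tests (bounded_on_testsD (bL k Pk) IH) => chi _.
by rewrite big_cons Pk.
Qed.

Lemma bounded_on_tests_inner f : L2 setT f -> bounded_on_tests (fun chi => << f, chi >>).
Proof.
move=> f2; exists (`N f); first exact: L2_norm_ge0.
by move=> chi tc; exact: (cauchy_schwarz measurableT f2 (test_L2 tc)).
Qed.

Lemma bounded_on_testsM rho f L : Om `<=` cbox rho -> Cinfty f ->
  bounded_on_tests L -> bounded_on_tests (fun chi => L (f * chi)).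
Proof.
move=> Or sf [K K0 KL]; have [k k0 fk] := bounded_on_cbox rho (Cinfty_continuous sf).
exists (K * k); first exact: mulr_ge0.
move=> chi tc; have fc := testM sf tc; apply: le_trans (KL _ fc) _.
rewrite -mulrA; apply: ler_wpM2l => //.
apply: (ler_L2_normZ measurableT (test_L2 fc) (test_L2 tc) k0).
move=> x _; rewrite normrM; have [Ox|Ox] := pselect (Om x).
  by rewrite ler_wpM2r// fk//; exact: Or.
by rewrite (test_off tc Ox) normr0 !mulr0.
Qed.

End bounded_functionals.

(** * All second derivatives from the tangential ones and the Laplacian *)

Section boundary_chart.
Context {R : realType} {m : nat} (Om : set 'rV[R]_m) (rho : R).
Local Notation fn := ('rV[R]_m -> R).
Implicit Types (chi f : fn) (a b j : 'I_m).
Hypothesis Om_rho : Om `<=` cbox rho.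
Variables (i : 'I_m) (D : 'I_m -> fn) (L : 'I_m -> 'I_m -> fn -> R).
Hypothesis sD : forall j, Cinfty (D j).
Hypothesis L_sym : forall a b chi, test_function Om chi -> L a b chi = L b a chi.
Hypothesis L_add : forall a b chi chi', test_function Om chi -> test_function Om chi' ->
  L a b (chi + chi') = L a b chi + L a b chi'.
Hypothesis L_tan : forall j a, j != i ->
  bounded_on_tests Om (fun chi => L a j chi + L a i (D j * chi)).
Hypothesis L_laplace : bounded_on_tests Om (fun chi => \sum_a L a a chi).

Let L_sum a b (I : Type) (r : seq I) (P : pred I) (c : I -> fn) :
  (forall k, P k -> test_function Om (c k)) ->
  L a b (\sum_(k <- r | P k) c k) = \sum_(k <- r | P k) L a b (c k).
Proof.
move=> tc; elim: r => [|k r IH].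
  rewrite !big_nil; have := L_add a b (test0 Om) (test0 Om); rewrite addr0 => /eqP.
  by rewrite -subr_eq0 opprD addNKr oppr_eq0 => /eqP.
rewrite !big_cons; case: ifP => // Pk.
by rewrite L_add ?IH//; [exact: tc|exact: test_sum].
Qed.

(** [L a b chi] stands for <d_a v, d_b chi>. Two tangential bounds and the symmetry turn L j j chi
    into L i i (D j ^2 chi), up to bounded functionals. The Laplacian then bounds chi |-> L i i (S
    chi) with S = 1 + sum of the D j ^2, and S >= 1 can be divided out; this is ellipticity in the
    direction transversal to the boundary. *)
Let L_ii_bdd : bounded_on_tests Om (L i i).
Proof.
pose S : fn := cst 1 + \sum_(j | j != i) D j * D j.
have sS : Cinfty S.
  apply: CinftyD; first exact: Cinfty_cst.
  by apply: Cinfty_sum => j _; exact: CinftyM.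
have S1 x : 1 <= S x.
  rewrite /S addrfctE lerDl; elim/big_ind : _ => //= [f g f0 g0|j _]; first exact: addr_ge0.
  by rewrite mulrfctE -expr2 sqr_ge0.
have S0 x : S x != 0 by rewrite gt_eqF// (lt_le_trans ltr01).
have bS : bounded_on_tests Om (fun chi => L i i (S * chi)).
  have jj j : j != i -> bounded_on_tests Om (fun chi => L j j chi - L i i (D j * D j * chi)).
    move=> ji; have := bounded_on_testsM Om_rho (sD j) (L_tan i ji).
    move/(bounded_on_testsB (L_tan j ji)); apply: eq_bounded_on_tests => chi tc.
    have td := testM (sD j) tc.
    rewrite (L_sym j i td) mulrA.
    by move: (L j j chi) (L i j _) (L i i _) => x y z; rewrite opprD addrA addrK.
  have := bounded_on_tests_sum (index_enum 'I_m) jj.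
  move/(bounded_on_testsB L_laplace); apply: eq_bounded_on_tests => chi tc.
  rewrite (bigD1 i)//= sumrB opprB addrA addrAC addrK.
  rewrite -L_sum => [|j _]; last by apply: testM => //; exact: CinftyM.
  rewrite -L_add//; last first.
    by apply: test_sum => j _; apply: testM => //; exact: CinftyM.
  by congr (L i i _); rewrite /S mulrDl mulr_suml mul1r.
have sV : Cinfty (fun x => (S x)^-1) by exact: CinftyV.
have := bounded_on_testsM Om_rho sV bS; apply: eq_bounded_on_tests => chi tc.
congr (L i i _); apply/funext => x; rewrite !mulrfctE mulrA divff//.
by rewrite mul1r.
Qed.

(** The tangential bound trades a second index other than i for i, and the symmetry exchanges the
    two indices, so everything reduces to L i i. *)
Lemma boundary_chart_bdd a b : bounded_on_tests Om (L a b).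
Proof.
have ai c : bounded_on_tests Om (L c i).
  have [->|ci] := eqVneq c i; first exact: L_ii_bdd.
  have := bounded_on_testsM Om_rho (sD c) L_ii_bdd.
  move/(bounded_on_testsB (L_tan i ci)); apply: eq_bounded_on_tests => chi tc.
  by rewrite (L_sym c i tc); rewrite addrK.
have [->|bi] := eqVneq b i; first exact: ai.
have := bounded_on_testsM Om_rho (sD b) (ai a).
move/(bounded_on_testsB (L_tan a bi)); apply: eq_bounded_on_tests => chi tc.
by rewrite addrK.
Qed.

End boundary_chart.

(** * Second derivatives up to the boundary *)

Section bump.
Context {R : realType} {m : nat}.
Implicit Types (x : 'rV[R]_m) (r : R).

Definition box x0 r : set 'rV[R]_m := [set x | forall l, `|x ord0 l - x0 ord0 l| <= r].

Let q x0 r (l : 'I_m) : 'rV[R]_m -> R :=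
  cst (r ^+ 2) - (fun x => x ord0 l - x0 ord0 l) * (fun x => x ord0 l - x0 ord0 l).

Definition bump x0 r : 'rV[R]_m -> R := \prod_(l < m) (flat 0 \o q x0 r l).

Lemma Cinfty_bump x0 r : Cinfty (bump x0 r).
Proof.
have sl l : Cinfty (fun x : 'rV[R]_m => x ord0 l - x0 ord0 l).
  by apply: (@CinftyB _ _ _ (cst (x0 ord0 l))); [exact: Cinfty_coord|exact: Cinfty_cst].
apply: Cinfty_prod => l _; apply: Cinfty_flat; apply: CinftyB; first exact: Cinfty_cst.
exact: CinftyM.
Qed.

Lemma bump_ge0 x0 r x : 0 <= bump x0 r x.
Proof.
rewrite /bump; elim/big_ind : _ => //= [f g f0 g0|l _].
  exact: mulr_ge0.
exact: flat_ge0.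
Qed.

Lemma bump_gt0 x0 r : 0 < r -> 0 < bump x0 r x0.
Proof.
move=> r0; rewrite /bump; elim/big_ind : _ => //= [f g f0 g0|l _].
  exact: mulr_gt0.
by rewrite flat_gt0// /q !fctE subrr mulr0 subr0 exprn_gt0.
Qed.

Lemma bump_support x0 r x : 0 <= r -> bump x0 r x != 0 -> box x0 r x.
Proof.
move=> r0; apply: contraNP => /existsNP[l /negP]; rewrite -ltNge => xl.
rewrite /bump (bigD1 l)//= mulrfctE /= flat_le0 ?mul0r// /q !fctE.
by rewrite -expr2 subr_le0 -[leRHS]real_normK ?num_real// ler_sqr ?nnegrE// ltW.
Qed.

End bump.

Opaque L2 partial L2_norm L2_inner.

(** * Estimates near a point of the closure *)

Section local_estimate.
Context {R : realType} {m : nat} (Om : set 'rV[R]_m).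
Local Notation fn := ('rV[R]_m -> R).
Implicit Types (chi psi zeta f G : fn) (a b i j l : 'I_m) (x y : 'rV[R]_m).
Local Notation "`N u" := (L2_norm setT u) (at level 9).
Local Notation "<< u , v >>" := (L2_inner setT u v).
Local Notation e_ l := (delta_mx ord0 l).

Lemma sub_box x0 r r' : r <= r' -> box x0 r `<=` box x0 r'.
Proof. by move=> rr x xr l; exact: le_trans (xr l) rr. Qed.

Lemma sub_box_ball x0 r r' : r < r' -> 0 < r' -> box x0 r `<=` ball x0 r'.
Proof.
move=> rr r0 x xr; apply/ball_rV; split => // l.
by rewrite distrC; exact: le_lt_trans (xr l) rr.
Qed.

Lemma closed_box x0 r : closed (box x0 r).
Proof.
rewrite (_ : box x0 r = \bigcap_(l in [set: 'I_m]) [set x | `|x ord0 l - x0 ord0 l| <= r]).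
  apply: closed_bigI => l _.
  pose f (x : 'rV[R]_m) := x ord0 l - x0 ord0 l.
  have cf : continuous f.
    apply/Cinfty_continuous/(@CinftyB _ _ _ (cst (x0 ord0 l))); last exact: Cinfty_cst.
    exact: Cinfty_coord.
  apply: (@closed_comp _ _ (fun x => `|f x|) [set y | y <= r]).
    by move=> x _; apply: (@continuous_comp _ _ _ f Num.norm x (cf x)); exact: norm_continuous.
  exact: closed_le.
by apply/seteqP; split=> [x xr l _|x xr l]; [exact: xr|exact: (xr l I)].
Qed.

Lemma test_of_box zeta x0 r : Cinfty zeta -> (forall x, zeta x != 0 -> box x0 r x) ->
  test_function setT zeta.
Proof.
move=> sz zb; apply/test_functionP; split => //; exists (box x0 r); split => //.
apply: (@subclosed_compact _ _ (cbox (`|r| + \sum_l `|x0 ord0 l|))).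
- exact: closed_box.
- exact: compact_cbox.
move=> x xr l; have -> : x ord0 l = (x ord0 l - x0 ord0 l) + x0 ord0 l by rewrite subrK.
rewrite (le_trans (ler_normD _ _))// lerD//; first exact: le_trans (xr l) (ler_norm _).
by rewrite (bigD1 l)//= lerDl sumr_ge0.
Qed.

Lemma tshift_continuous i j G h : Cinfty G -> continuous (tshift i j G h).
Proof.
move=> sG x; apply: continuous_comp; last first.
  by apply: shear_continuous; exact: cst_continuous.
apply: shear_continuous; apply/Cinfty_continuous/CinftyB => //.
by apply: Cinfty_shear => //; exact: Cinfty_cst.
Qed.

Lemma tshift_dist i j G rho C h y : Cinfty G -> indep_of i G ->
  (forall x, cbox (rho + 1) x -> `|partial j G x| <= C) -> cbox rho y -> `|h| <= 1 ->
  forall l, `|tshift i j G h y ord0 l - y ord0 l| <= `|h| * (1 + C).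
Proof.
move=> sG iG CG yr h1 l.
have [c ch e] := mean_value_line y h (fun x => Cinfty_is_derive j x sG).
have b : `|G (y + h *: e_ j) - G y| <= `|h| * C.
  rewrite e normrM mulrC ler_wpM2l// CG// => a; rewrite !mxE (le_trans (ler_normD _ _))// lerD//.
  rewrite normrM -[leRHS]mulr1 ler_pM// ?(le_trans ch)//.
  by case: (_ && _); rewrite ?normr1 ?normr0.
have d1 (z : R) (k : bool) : `|z * k%:R| <= `|z|.
  by case: k; rewrite ?mulr1// mulr0 normr0.
rewrite tshiftE; set A := G _ - G _ in b *; rewrite !mxE.
rewrite -addrA [y ord0 l + _]addrC addrK mulrDr mulr1.
by rewrite (le_trans (ler_normD _ _))// lerD// (le_trans (d1 _ _)).
Qed.

(** The quotient can be nonzero only on the support of psi and on its image under the inverse shift,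
    which the last hypothesis keeps inside Om. *)
Lemma test_diffq i j G h psi (B : set 'rV[R]_m) : Cinfty G -> indep_of i G ->
  test_function Om psi -> closed B -> (forall x, psi x != 0 -> B x) ->
  (forall y, Om y -> B y -> Om (tshift i j G (- h) y)) ->
  test_function Om (diffq i j G h psi).
Proof.
move=> sG iG tp cB pB stab.
have /test_functionP[sp [K [cK KO pK]]] := tp.
have cKB : compact (K `&` B).
  apply: (subclosed_compact _ cK); last exact: subIsetl.
  by apply: closedI => //; apply: compact_closed => //; exact: norm_hausdorff.
apply/test_functionP; split; first exact: Cinfty_diffq.
exists (K `|` tshift i j G (- h) @` (K `&` B)); split.
- apply: compactU => //; apply: continuous_compact => //.
  by apply: continuous_subspaceT; exact: tshift_continuous.
- by move=> x [/KO//|[y [/KO Oy By] <-]]; exact: stab.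
- move=> x; rewrite diffqE shiftedE => qx.
  have [px|/pK] := eqVneq (psi x) 0; last by left.
  right; exists (tshift i j G h x); last exact: tshiftK.
  have pT : psi (tshift i j G h x) != 0.
    by apply: contra_neq qx => ->; rewrite px subrr mulr0.
  by split; [exact: pK|exact: pB].
Qed.

Lemma diffq_support i j G h psi x : diffq i j G h psi x != 0 ->
  psi x != 0 \/ psi (tshift i j G h x) != 0.
Proof.
rewrite diffqE shiftedE => qx; have [px|] := eqVneq (psi x) 0; last by left.
by right; apply: contra_neq qx => ->; rewrite px subrr mulr0.
Qed.

Variables (rho : R) (v F : fn) (w : 'I_m -> fn).
Hypothesis Om_rho : Om `<=` cbox rho.
Hypotheses (vw : h10 Om v w) (F2 : L2 setT F) (wF : weak_poisson Om w F).

Let wz zeta a : fn := zeta * w a + partial a zeta * v.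

(** The tangential estimate is applied to zeta v, and the admissible psi are the test functions
    supported in the box that contains the support of zeta. *)
Lemma local_tangential (x0 : 'rV[R]_m) r i j G : 0 < r -> Cinfty G -> indep_of i G ->
  (forall x h, ball x0 r x -> ball x0 r (tshift i j G h x) -> Om x ->
     Om (tshift i j G h x)) ->
  forall zeta, Cinfty zeta -> (forall x, zeta x != 0 -> box x0 (r / 8) x) ->
  forall a, exists2 K, 0 <= K & forall chi, test_function setT chi ->
     `|<< wz zeta a, tangent i j G chi >>| <= K * `N chi.
Proof.
move=> r0 sG iG stab zeta sz zb a.
have tz := test_of_box sz zb.
have [rho1 [rho1_ge rho1_box]] : exists rho1, rho <= rho1 /\ box x0 r `<=` cbox rho1.
  exists (`|rho| + (r + \sum_l `|x0 ord0 l|)); split.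
    by rewrite (le_trans (ler_norm _))// lerDl addr_ge0 ?(ltW r0)// sumr_ge0.
  move=> x xr l; have -> : x ord0 l = (x ord0 l - x0 ord0 l) + x0 ord0 l by rewrite subrK.
  rewrite (le_trans (ler_normD _ _))// -[leLHS]add0r lerD//.
  by apply: lerD; [exact: xr|rewrite (bigD1 l)//= lerDl sumr_ge0].
have Om_rho1 : Om `<=` cbox rho1.
  by move=> x /Om_rho xr l; exact: le_trans (xr l) rho1_ge.
have [C1 C10 CG] := bounded_on_cbox (rho1 + 1) (Cinfty_continuous (Cinfty_partial j sG)).
have /choice[c cP] l : exists c, 0 <= c /\ forall x, cbox (rho1 + 1) x ->
    `|partial j (partial l G) x| <= c.
  have [c c0 ?] := bounded_on_cbox (rho1 + 1)
    (Cinfty_continuous (Cinfty_partial j (Cinfty_partial l sG))).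
  by exists c.
pose C := C1 + \sum_l c l.
have sc0 : 0 <= \sum_l c l by apply: sumr_ge0 => l _; have [] := cP l.
have C0 : 0 <= C by rewrite addr_ge0.
have CG' x : cbox (rho1 + 1) x -> `|partial j G x| <= C.
  by move=> xr; rewrite (le_trans (CG x xr))// lerDl.
have CGG l x : cbox (rho1 + 1) x -> `|partial j (partial l G) x| <= C.
  move=> xr; rewrite (le_trans ((cP l).2 x xr))// (le_trans _ (_ : \sum_l c l <= _))//.
    by rewrite (bigD1 l)//= lerDl sumr_ge0// => l' _; have [] := cP l'.
  by rewrite lerDr.
have h20 := h10M tz vw; have [F' F'2 wF'] := weak_poissonM tz vw F2 wF.
have wz2 l : L2 setT (wz zeta l) by have [_ + _] := h20; exact.
pose adm psi := test_function Om psi /\ forall x, psi x != 0 -> box x0 (r / 8) x.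
(* A shift by |h| <= hm moves the points concerned by at most r/8. Two quotients thus involve boxes
   of radius up to 3r/8, which lie in the ball where [stab] applies. *)
pose hm := Num.min 1 (r / 8 / (1 + C)).
have C1' : 0 < 1 + C by rewrite ltr_wpDr.
have hm0 : 0 < hm by rewrite lt_min ltr01 !divr_gt0.
have hm1 (h : R) : `|h| <= hm -> `|h| <= 1 by rewrite le_min => /andP[].
have hmC (h : R) : `|h| <= hm -> `|h| * (1 + C) <= r / 8.
  by rewrite le_min => /andP[_]; rewrite ler_pdivlMr.
have move_box k h y : k <= r -> `|h| <= hm -> box x0 k y ->
    box x0 (k + r / 8) (tshift i j G h y).
  move=> kr hh yk l; have yr : cbox rho1 y by apply: rho1_box; exact: sub_box yk.
  have d := tshift_dist sG iG CG' yr (hm1 h hh) l.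
  have -> : tshift i j G h y ord0 l - x0 ord0 l =
     (y ord0 l - x0 ord0 l) + (tshift i j G h y ord0 l - y ord0 l) by ring.
  by rewrite (le_trans (ler_normD _ _))// lerD// (le_trans d)// hmC.
have boxball k : k < r -> box x0 k `<=` ball x0 r by move=> kr; exact: sub_box_ball.
have q1 : r / 8 <= r by lra.
have q2 : r / 8 + r / 8 <= r by lra.
have q3 : r / 8 + r / 8 < r by lra.
have q4 : r / 8 + r / 8 + r / 8 < r by lra.
have q5 : r / 8 < r by lra.
have admP psi h : adm psi -> `|h| <= hm -> [/\ test_function Om psi,
    test_function Om (diffq i j G h psi) &
    test_function Om (diffq i j G (- h) (diffq i j G h psi))].
  move=> [tp pb] hh; have hhN : `|- h| <= hm by rewrite normrN.
  have tq : test_function Om (diffq i j G h psi).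
    refine (@test_diffq i j G h psi (box x0 (r / 8)) sG iG tp (@closed_box _ _) pb _) => y Oy By.
    apply: stab => //; first exact: boxball By.
    by apply: boxball q3 _ _; exact: move_box.
  split => //; refine (@test_diffq i j G (- h) _ (box x0 (r / 8 + r / 8)) sG iG tq (@closed_box _ _) _ _).
    move=> x /diffq_support[/pb xb|/pb xb].
      by apply: sub_box xb; rewrite lerDl divr_ge0 ?ltW.
    by rewrite -(tshiftK j iG h x); exact: move_box.
  move=> y Oy By; rewrite opprK; apply: stab => //; first exact: boxball q3 _ By.
  by apply: boxball q4 _ _; exact: move_box.
have adm_dense e : 0 < e -> exists2 psi, adm psi &
    forall l, `N (partial l psi - wz zeta l) <= e.
  move=> e0; have [psi [tp _ pw]] := h10M_approx tz vw e0.
  exists (zeta * psi) => //; split; first exact: testM.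
  move=> x zp; apply: zb; apply: contra_neq zp => z0.
  by rewrite mulrfctE z0 mul0r.
exact: (tangential_bound sG iG Om_rho1 C0 CG' CGG F'2 wz2 wF' hm0 admP adm_dense a).
Qed.

Lemma local_bounded x0 : open Om -> smooth_boundary Om -> closure Om x0 ->
  exists2 r, 0 < r & forall zeta, Cinfty zeta -> (forall x, zeta x != 0 -> box x0 r x) ->
    forall a b, bounded_on_tests Om (fun chi => << wz zeta a, partial b chi >>).
Proof.
move=> oO sO x0O; have testT chi : test_function Om chi -> test_function setT chi.
  exact: test_function_mono.
(* Around an interior point every direction counts as tangential: the flows are translations, with G
   = 0. *)
have [Ox|Ox] := pselect (Om x0).
  have /nbhs_ballP[r /= r0 rO] : nbhs x0 Om by exact: open_nbhs_nbhs.
  exists (r / 8) => [|zeta sz zb a b]; first by rewrite divr_gt0.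
  have [|K K0 bK] := @local_tangential x0 r b b 0 r0 (@Cinfty0 R m) (@indep0 R m b) _ zeta sz zb a.
    by move=> x h _ /rO.
  by exists K => // chi /testT tc; have := bK chi tc; rewrite tangent0.
have [i [rev [gamma [r [r0 sgam rO]]]]] := sO x0 (conj x0O Ox).
(* The orientation is moved into G: near x0, Om is given by s (x_i - G x) > 0, and the flow
   preserves x_i - G x. *)
pose s : R := (-1) ^+ rev; pose G : fn := s *: (gamma \o col' i).
have ss : s * s = 1 by rewrite -expr2 sqrr_sign.
have sG : Cinfty G by apply/CinftyZ/Cinfty_col.
have iG : indep_of i G.
  move=> x t; rewrite /G !fctE /= addrC col'_delta unlift_none add0r.
  by [].
have OG x : ball x0 r x -> (Om x <-> 0 < s * (x ord0 i - G x)).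
  move=> /rO ->; rewrite /G !fctE /= mulrBr /GRing.scale /= mulrA ss mul1r subr_gt0.
  by [].
exists (r / 8) => [|zeta sz zb a b]; first by rewrite divr_gt0.
have tz := test_of_box sz zb; have h10z := h10M tz vw.
have [_ wz2 _] := h10z.
have [F' F'2 wF'] := weak_poissonM tz vw F2 wF.
apply: (@boundary_chart_bdd _ _ Om rho Om_rho i (fun j => partial j G)
  (fun a b chi => << wz zeta a, partial b chi >>)) => [j|c d chi /testT tc|c d f1 f2 t1 t2|j c ji|].
- exact: Cinfty_partial.
- exact: (h10_sym c d h10z tc).
- rewrite partialD; [|exact: test_Cinfty t1|exact: test_Cinfty t2].
  exact: (L2_innerDr measurableT (test_L2 (test_partial d t1)) (test_L2 (test_partial d t2)) (wz2 c)).
- have [|K K0 bK] := @local_tangential x0 r i j G r0 sG iG _ zeta sz zb c.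
    move=> x h xr hr /(OG x xr) Ox'; apply/(OG _ hr).
    have -> : tshift i j G h x ord0 i - G (tshift i j G h x) = x ord0 i - G x => //.
    rewrite (G_tshift j iG) tshiftE !mxE !eqxx /= [i == j]eq_sym (negbTE ji) mulr0 mulr1 addr0.
    by rewrite [G _ - G x]addrC addrA addrK.
  exists K => // chi tc; have sc := test_Cinfty tc; have := bK chi (testT _ tc).
  (* d_j G does not depend on x_i and may be put under d_i, which gives the form required by
     [boundary_chart_bdd]. *)
  have -> : tangent i j G chi = partial j chi + partial i (partial j G * chi).
    rewrite partialM//; last exact: Cinfty_partial.
    by rewrite (partial_indep (indep_partial j sG iG)) mulr0 addr0.
  have t1 := test_L2 (test_partial j tc).
  have t2 := test_L2 (test_partial i (testM (Cinfty_partial j sG) tc)).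
  by rewrite (L2_innerDr measurableT t1 t2 (wz2 c)).
- apply: eq_bounded_on_tests (bounded_on_tests_inner Om F'2) => chi tc.
  by rewrite -(wF' _ tc).
Qed.

End local_estimate.

(** * Partition of unity and the global estimate *)

Section global_estimate.
Context {R : realType} {m : nat} (Om : set 'rV[R]_m).
Local Notation fn := ('rV[R]_m -> R).
Implicit Types (chi psi zeta f G : fn) (a b i j l : 'I_m) (x y : 'rV[R]_m).
Local Notation "`N u" := (L2_norm setT u) (at level 9).
Local Notation "<< u , v >>" := (L2_inner setT u v).

Lemma partial_near f l c : open Om -> (forall x, Om x -> f x = c) ->
  forall x, Om x -> partial l f x = 0.
Proof.
move=> oO fc x Ox; apply: partialE; apply: (near_eq_is_derive (f := cst c)).
have : nbhs x Om by exact: open_nbhs_nbhs.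
by apply: filterS => y /fc.
Qed.

Lemma compact_closure_bounded : bounded_set Om -> compact (closure Om).
Proof.
move=> /bounded_set_cbox[rho _ Or].
apply: (@subclosed_compact _ _ (cbox rho)); [exact: closed_closure|exact: compact_cbox|].
have /closure_id -> : closed (cbox rho : set 'rV[R]_m).
  by apply: compact_closed; [exact: norm_hausdorff|exact: compact_cbox].
exact: closureS.
Qed.

Lemma smooth_partition (r : 'rV[R]_m -> R) : compact (closure Om) -> Om !=set0 ->
  (forall x, closure Om x -> 0 < r x) ->
  exists (s : seq 'rV[R]_m) (zeta : 'rV[R]_m -> fn),
    [/\ forall x, x \in s -> closure Om x, forall x, Cinfty (zeta x),
       forall x y, closure Om x -> zeta x y != 0 -> box x (r x) y &
       forall y, Om y -> (\sum_(x <- s) zeta x) y = 1].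
Proof.
move=> cO [y0 Oy0] r0.
pose U (x : 'rV[R]_m) : set 'rV[R]_m := [set y | 0 < bump x (r x) y].
have oU x : closure Om x -> open (U x).
  move=> _; apply: (@open_comp _ _ (bump x (r x)) [set y | 0 < y]); last exact: open_gt.
  by move=> y _; exact/Cinfty_continuous/Cinfty_bump.
have cU : closure Om `<=` cover (closure Om) U.
  by move=> x Ox; exists x => //=; apply: bump_gt0; exact: r0.
have [D DO Dcov] : finite_subset_cover (closure Om) U (closure Om).
  by move: cO; rewrite compact_cover => /(_ _ (closure Om) U oU cU).
pose s := finmap.enum_fset D.
pose N : fn := \sum_(x <- s) bump x (r x).
have sN : Cinfty N by apply: Cinfty_sum => x _; exact: Cinfty_bump.
have N0 y : closure Om y -> 0 < N y.
  move=> /Dcov[x /= xD xy]; rewrite /N (big_rem x)//= addrfctE ltr_pwDl//.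
  elim/big_ind : _ => //= [f g f0 g0|z _]; first exact: addr_ge0.
  exact: bump_ge0.
have [c cO' cmin] : exists2 c, 0 < c & forall y, closure Om y -> c <= N y.
  have [||y yO ymin] := compact_EVT_min _ cO (f := N).
  - by exists y0; exact: subset_closure.
  - by apply: continuous_subspaceT; exact: Cinfty_continuous.
  exists (N y); first by apply: N0; exact: set_mem.
  by move=> z zO; apply: ymin; exact: mem_set.
(* N may vanish away from Om. The added term is 0 where N >= c, in particular on the closure of Om,
   and positive elsewhere, so that M is positive and 1/M is smooth everywhere. *)
pose M : fn := N + (flat 0 \o (cst c - N)).
have sM : Cinfty M by apply: CinftyD => //; apply/Cinfty_flat/CinftyB => //; exact: Cinfty_cst.
have M0 y : M y != 0.
  rewrite gt_eqF// /M addrfctE /=; have [Nc|cN] := ltP (N y) c; last first.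
    by rewrite ltr_wpDr ?flat_ge0// (lt_le_trans cO').
  rewrite ltr_wpDl ?flat_gt0 ?fctE ?subr_gt0//.
  rewrite /N; elim/big_ind : _ => //= [f g f0 g0|z _]; first exact: addr_ge0.
  exact: bump_ge0.
have MO y : Om y -> M y = N y.
  move=> Oy; rewrite /M addrfctE /= flat_le0 ?addr0// !fctE subr_le0.
  by apply: cmin; exact: subset_closure.
exists s, (fun x => (fun y => (M y)^-1) * bump x (r x)); split.
- by move=> x xs; apply: set_mem; exact: DO.
- by move=> x; apply: CinftyM; [exact: CinftyV|exact: Cinfty_bump].
- move=> x y Ox; rewrite mulrfctE mulf_eq0 negb_or => /andP[_].
  by apply: bump_support; exact/ltW/r0.
- move=> y Oy; rewrite -mulr_sumr mulrfctE -/N MO// mulVf// gt_eqF// N0//.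
  exact: subset_closure.
Qed.

(** The cutoffs add up to 1 on Om, so the sum of their gradients vanishes there and the localized
    gradients add up to w a where chi lives. *)
Lemma second_derivatives (v F : fn) (w : 'I_m -> fn) a b : smooth_bounded_domain Om ->
  h10 Om v w -> L2 setT F -> weak_poisson Om w F ->
  bounded_on_tests Om (fun chi => << w a, partial b chi >>).
Proof.
move=> [oO O0 _ bO sO] vw F2 wF.
have [rho _ Or] := bounded_set_cbox bO.
have [v2 w2 _] := vw.
have /choice[r rP] x0 : exists r, closure Om x0 -> 0 < r /\ forall zeta, Cinfty zeta ->
    (forall x, zeta x != 0 -> box x0 r x) -> forall a b,
    bounded_on_tests Om (fun chi => << zeta * w a + partial a zeta * v, partial b chi >>).
  have [x0O|] := pselect (closure Om x0); last by exists 0.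
  by have [r r0 rP] := local_bounded Or vw F2 wF oO sO x0O; exists r.
have [s [zeta [sO' sz zb z1]]] := smooth_partition (compact_closure_bounded bO) O0
  (fun x xO => (rP x xO).1).
pose wz x : fn := zeta x * w a + partial a (zeta x) * v.
have tz x : x \in s -> test_function setT (zeta x).
  move=> xs; exact (@test_of_box _ _ (zeta x) x (r x) (sz x) (fun y => zb x y (sO' x xs))).
have wz2 x : x \in s -> L2 setT (wz x).
  by move=> xs; have [_ + _] := h10M (tz x xs) vw; exact.
have bz x : x \in s -> bounded_on_tests Om (fun chi => << wz x, partial b chi >>).
  by move=> xs; apply: (rP x (sO' x xs)).2 => // y; exact: zb (sO' x xs).
have : bounded_on_tests Om (fun chi => \sum_(x <- s | x \in s) << wz x, partial b chi >>).
  exact: bounded_on_tests_sum.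
apply: eq_bounded_on_tests => chi tc.
have t2 := test_L2 (test_partial b tc).
rewrite -(L2_inner_suml measurableT s wz2 t2).
apply: eq_L2_inner => y _; have [Oy|Oy] := pselect (Om y); last first.
  by rewrite (test_off (test_partial b tc) Oy) !mulr0.
congr (_ * _).
have -> : \sum_(x <- s | x \in s) wz x = (\sum_(x <- s) zeta x) * w a + partial a (\sum_(x <- s) zeta x) * v.
  rewrite -big_seq {tz wz2 bz sO' z1}; elim: s => [|x s IH].
    by rewrite !big_nil (partial_cst 0) !mul0r addr0.
  rewrite !big_cons partialD//; last by apply: Cinfty_sum => z _; exact: sz.
  by rewrite IH !mulrDl addrACA.
rewrite addrfctE !mulrfctE z1// (partial_near a oO z1 Oy).
by rewrite mul1r mul0r addr0.
Qed.

End global_estimate.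

Transparent L2 partial L2_norm L2_inner.

(** * Eigenfunction expansions in H^1_0 *)

Section zero_extension.
Context {R : realType} {m : nat} (Om : set 'rV[R]_m).
Hypothesis mOm : measurable Om.
Local Notation fn := ('rV[R]_m -> R).
Implicit Types (u v f chi : fn).
Local Notation mu := (@rV_lebesgue R m).

Definition zext u : fn := fun x => if x \in Om then u x else 0.

Definition vanishes_off u : Prop := forall x, ~ Om x -> u x = 0.

Lemma zextT u x : Om x -> zext u x = u x.
Proof. by rewrite /zext => /mem_set ->. Qed.

Lemma zext_off u : vanishes_off (zext u).
Proof. by move=> x Ox; rewrite /zext memNset. Qed.

Lemma zext_id u : vanishes_off u -> zext u = u.
Proof.
move=> u0; apply/funext => x; have [Ox|Ox] := pselect (Om x); first exact: zextT.
by rewrite zext_off// u0.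
Qed.

Lemma zext_patch u : zext u = u \_ Om.
Proof. by apply/funext => x; rewrite /zext patchE. Qed.

Lemma Rintegral_zext u : \int[mu]_(x in Om) u x = \int[mu]_x zext u x.
Proof. by rewrite Rintegral_mkcond zext_patch. Qed.

Lemma L2_zext u : L2 Om u -> L2 setT (zext u).
Proof.
move=> [mu_ u2]; split.
  by rewrite zext_patch; exact: (iffLR (measurable_restrictT u mOm) mu_).
apply: le_lt_trans u2; rewrite [leRHS]integral_mkcond le_eqVlt; apply/orP; left.
apply/eqP/eq_integral => x _; rewrite patchE /zext; case: ifP => // _.
by rewrite expr0n.
Qed.

Lemma L2_inner_zext u v : L2_inner Om u v = L2_inner setT (zext u) v.
Proof.
rewrite /L2_inner Rintegral_zext; apply: eq_Rintegral => x _.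
by rewrite /zext; case: ifP => // _; rewrite mul0r.
Qed.

Lemma L2_norm_zext u : L2_norm Om u = L2_norm setT (zext u).
Proof.
rewrite /L2_norm L2_inner_zext; congr Num.sqrt; apply: eq_L2_inner => x _.
by rewrite /zext; case: ifP => // _; rewrite !mul0r.
Qed.

Lemma zextB u v : zext (u - v) = zext u - zext v.
Proof. by apply/funext => x; rewrite /zext !fctE; case: ifP => // _; rewrite subrr. Qed.

Lemma test_zext chi : test_function Om chi -> zext chi = chi.
Proof. by move=> tc; apply: zext_id => x; exact: test_off. Qed.

Lemma L2_restrict u : L2 setT u -> L2 Om u.
Proof.
move=> [mu_ u2]; have mu' : measurable_fun Om u by exact: measurable_funS mu_.
split => //; apply: le_lt_trans u2; apply: ge0_subset_integral => //.
  exact: measurable_sqr.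
by move=> x _; rewrite lee_fin sqr_ge0.
Qed.

Lemma L2_inner_vanish u v : vanishes_off u -> L2_inner Om u v = L2_inner setT u v.
Proof. by move=> u0; rewrite L2_inner_zext zext_id. Qed.

Lemma L2_norm_vanish u : vanishes_off u -> L2_norm Om u = L2_norm setT u.
Proof. by move=> u0; rewrite L2_norm_zext zext_id. Qed.

Lemma vanishes_offD u v : vanishes_off u -> vanishes_off v -> vanishes_off (u + v).
Proof. by move=> u0 v0 x Ox; rewrite addrfctE u0// v0// addr0. Qed.

Lemma vanishes_offZ a u : vanishes_off u -> vanishes_off (a *: u).
Proof.
move=> u0 x Ox; have -> : (a *: u) x = a * u x by [].
by rewrite u0// mulr0.
Qed.

Lemma vanishes_offB u v : vanishes_off u -> vanishes_off v -> vanishes_off (u - v).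
Proof. by move=> u0 v0 x Ox; rewrite !fctE u0// v0// subr0. Qed.

Lemma vanishes_off_sum (I : Type) (r : seq I) (P : pred I) (F : I -> fn) :
  (forall i, P i -> vanishes_off (F i)) -> vanishes_off (\sum_(i <- r | P i) F i).
Proof. by move=> F0; elim/big_ind : _ => //; exact: vanishes_offD. Qed.

Hypothesis Om_fin : (mu Om < +oo)%E.

Lemma L2_complete_vanish (u : nat -> fn) : (forall n, L2 setT (u n)) ->
  (forall n, vanishes_off (u n)) ->
  (forall e, 0 < e -> exists N, forall p q, (N <= p)%N -> (N <= q)%N ->
     L2_norm setT (u p - u q) <= e) ->
  exists v, [/\ L2 setT v, vanishes_off v & forall e, 0 < e -> exists N,
    forall n, (N <= n)%N -> L2_norm setT (u n - v) <= e].
Proof.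
move=> u2 u0 cu; have [||v v2 uv] := @L2_complete R m Om mOm Om_fin u.
- by move=> n; exact: L2_restrict.
- move=> e e0; have [N HN] := cu e e0; exists N => p q pN qN.
  by rewrite L2_norm_vanish ?HN//; exact: vanishes_offB.
exists (zext v); split; [exact: L2_zext|exact: zext_off|move=> e e0].
have [N HN] := uv e e0; exists N => n nN; have := HN n nN.
by rewrite L2_norm_zext zextB (zext_id (u0 n)).
Qed.

End zero_extension.

Opaque L2 partial L2_norm L2_inner.

(** * Linear combinations and limits in H^1_0 *)

Section h10_linear.
Context {R : realType} {m : nat} (Om : set 'rV[R]_m).
Local Notation fn := ('rV[R]_m -> R).
Implicit Types (u v f chi F : fn) (l : 'I_m) (w : 'I_m -> fn) (a : R).
Local Notation "`N u" := (L2_norm setT u) (at level 9).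
Local Notation "<< u , v >>" := (L2_inner setT u v).

Lemma h10_0 : h10 Om (0 : fn) (fun _ => 0).
Proof.
split=> [|l|e e0]; [exact: L2_0|exact: L2_0|exists 0].
split=> [||l]; first exact: test0.
  by rewrite subr0 (L2_norm0 measurableT); exact: ltW.
by rewrite (partial_cst 0) subr0 (L2_norm0 measurableT); exact: ltW.
Qed.

Lemma h10D v w v' w' : h10 Om v w -> h10 Om v' w' ->
  h10 Om (v + v') (fun l => w l + w' l).
Proof.
move=> [v2 w2 vw] [v2' w2' vw']; split=> [|l|e e0].
- exact: (L2D measurableT v2 v2').
- exact: (L2D measurableT (w2 l) (w2' l)).
have e2 : 0 < e / 2 by rewrite divr_gt0.
have [psi [tp pv pw]] := vw _ e2; have [psi' [tp' pv' pw']] := vw' _ e2.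
have p2 := test_L2 tp; have p2' := test_L2 tp'.
have dp2 l := test_L2 (test_partial l tp); have dp2' l := test_L2 (test_partial l tp').
exists (psi + psi'); split; first exact: testD.
  rewrite opprD addrACA (splitr e).
  apply: le_trans (ler_L2_normD measurableT (L2B measurableT p2 v2) (L2B measurableT p2' v2')) _.
  exact: lerD.
move=> l; rewrite partialD; [|exact: test_Cinfty tp|exact: test_Cinfty tp'].
rewrite opprD addrACA (splitr e).
apply: le_trans (ler_L2_normD measurableT (L2B measurableT (dp2 l) (w2 l))
  (L2B measurableT (dp2' l) (w2' l))) _.
by apply: lerD; [exact: pw|exact: pw'].
Qed.

Lemma h10Z a v w : h10 Om v w -> h10 Om (a *: v) (fun l => a *: w l).
Proof.
move=> [v2 w2 vw]; split=> [|l|e e0].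
- exact: (L2Z measurableT a v2).
- exact: (L2Z measurableT a (w2 l)).
have a0 : 0 < `|a| + 1 by rewrite ltr_wpDl.
have [psi [tp pv pw]] := vw _ (divr_gt0 e0 a0).
have p2 := test_L2 tp; have dp2 l := test_L2 (test_partial l tp).
have le_a x : x <= e / (`|a| + 1) -> `|a| * x <= e.
  move=> /(ler_wpM2l (normr_ge0 a)) /le_trans; apply.
  by rewrite mulrA ler_pdivrMr// mulrC ler_wpM2l ?(ltW e0)// lerDl.
exists (a *: psi); split; first exact: testZ.
  by rewrite -scalerBr (L2_normZ measurableT _ (L2B measurableT p2 v2)) le_a.
move=> l; rewrite partialZ; last exact: test_Cinfty tp.
by rewrite -scalerBr (L2_normZ measurableT _ (L2B measurableT (dp2 l) (w2 l))) le_a.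
Qed.

Lemma h10_lin n (c : nat -> R) (e : nat -> fn) (w : nat -> 'I_m -> fn) :
  (forall i, h10 Om (e i) (w i)) ->
  h10 Om (\sum_(i < n) c i *: e i) (fun l => \sum_(i < n) c i *: w i l).
Proof.
move=> h; elim: n => [|n IH].
  have := h10_0; rewrite big_ord0; congr (h10 _ _ _).
  by apply/funext => l; rewrite big_ord0.
have := h10D IH (h10Z (c n) (h n)); rewrite big_ord_recr /=; congr (h10 _ _ _).
by apply/funext => l; rewrite big_ord_recr.
Qed.

Lemma h10_closed v w : L2 setT v -> (forall l, L2 setT (w l)) ->
  (forall e, 0 < e -> exists v' w', [/\ h10 Om v' w', `N (v' - v) <= e &
    forall l, `N (w' l - w l) <= e]) -> h10 Om v w.
Proof.
move=> v2 w2 vw; split=> // e e0; have e2 : 0 < e / 2 by rewrite divr_gt0.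
have [v' [w' [[v2' w2' h] dv dw]]] := vw _ e2; have [psi [tp pv pw]] := h _ e2.
have p2 := test_L2 tp; have dp2 l := test_L2 (test_partial l tp).
exists psi; split => // [|l]; rewrite (splitr e).
  apply: le_trans (ler_L2_norm_dist measurableT p2 v2' v2) _.
  exact: lerD.
apply: le_trans (ler_L2_norm_dist measurableT (dp2 l) (w2' l) (w2 l)) _.
by apply: lerD; [exact: pw|exact: dw].
Qed.

(** By density the equation may be tested with a function of H^1_0; for w' = w this is the energy
    identity. *)
Lemma weak_poisson_h10 v w w' F : h10 Om v w -> (forall l, L2 setT (w' l)) -> L2 setT F ->
  weak_poisson Om w' F -> \sum_l << w' l, w l >> = << F, v >>.
Proof.
move=> [v2 w2 vw] w2' F2 wF.
have c0 : 0 <= \sum_l `N (w' l) + `N F.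
  by rewrite addr_ge0 ?L2_norm_ge0// sumr_ge0// => l _; exact: L2_norm_ge0.
apply: (eq_of_eps c0) => e e0 _; have [psi [tp pv pw]] := vw e e0.
have p2 := test_L2 tp; have dp2 l := test_L2 (test_partial l tp).
have d l := L2B measurableT (dp2 l) (w2 l); have dv := L2B measurableT p2 v2.
have e1 : \sum_l << w' l, partial l psi - w l >> =
    \sum_l << w' l, partial l psi >> - \sum_l << w' l, w l >>.
  rewrite -sumrB; apply: eq_bigr => l _.
  exact: (L2_innerBr measurableT (dp2 l) (w2 l) (w2' l)).
have e2 : << F, psi - v >> = << F, psi >> - << F, v >>.
  exact: (L2_innerBr measurableT p2 v2 F2).
have alg (s a b : R) : a - b = (s - b) - (s - a) by lra.
have -> : \sum_l << w' l, w l >> - << F, v >> =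
    << F, psi - v >> - \sum_l << w' l, partial l psi - w l >>.
  by rewrite e1 e2 (wF _ tp); exact: alg.
rewrite mulrDr [leRHS]addrC; apply: le_trans (ler_normB _ _) _; apply: lerD.
  apply: le_trans (cauchy_schwarz measurableT F2 dv) _.
  by rewrite mulrC ler_wpM2r ?L2_norm_ge0.
apply: le_trans (ler_norm_sum _ _ _) _; rewrite mulr_sumr; apply: ler_sum => l _.
apply: le_trans (cauchy_schwarz measurableT (w2' l) (d l)) _.
by rewrite mulrC ler_wpM2r ?L2_norm_ge0.
Qed.

Lemma weak_poisson_lin n (c : nat -> R) (F : nat -> fn) (w : nat -> 'I_m -> fn) :
  (forall i l, L2 setT (w i l)) -> (forall i, L2 setT (F i)) ->
  (forall i, weak_poisson Om (w i) (F i)) ->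
  weak_poisson Om (fun l => \sum_(i < n) c i *: w i l) (\sum_(i < n) c i *: F i).
Proof.
move=> w2 F2 wF chi tc; have c2 := test_L2 tc; have dc2 l := test_L2 (test_partial l tc).
rewrite (L2_inner_suml measurableT (F := fun i : 'I_n => c i *: F i) _ _ c2); last first.
  by move=> i _; exact: (L2Z measurableT _ (F2 i)).
have -> : \sum_l << \sum_(i < n) c i *: w i l, partial l chi >> =
    \sum_l \sum_(i < n) << c i *: w i l, partial l chi >>.
  apply: eq_bigr => l _.
  rewrite (L2_inner_suml measurableT (F := fun i : 'I_n => c i *: w i l) _ _ (dc2 l))//.
  by move=> i _; exact: (L2Z measurableT _ (w2 i l)).
rewrite exchange_big /=; apply: eq_bigr => i _.
rewrite (L2_innerZl measurableT _ (F2 i) c2) -(wF i chi tc) mulr_sumr.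
by apply: eq_bigr => l _; rewrite (L2_innerZl measurableT _ (w2 i l) (dc2 l)).
Qed.

Lemma weak_poisson_closed w F : (forall l, L2 setT (w l)) -> L2 setT F ->
  (forall e, 0 < e -> exists w' F', [/\ weak_poisson Om w' F', L2 setT F',
     forall l, L2 setT (w' l), `N (F' - F) <= e & forall l, `N (w' l - w l) <= e]) ->
  weak_poisson Om w F.
Proof.
move=> w2 F2 h chi tc; have c2 := test_L2 tc; have dc2 l := test_L2 (test_partial l tc).
have c0 : 0 <= \sum_l `N (partial l chi) + `N chi.
  by rewrite addr_ge0 ?L2_norm_ge0// sumr_ge0// => l _; exact: L2_norm_ge0.
apply: (eq_of_eps c0) => e e0 _; have [w' [F' [wF' F2' w2' dF dw]]] := h e e0.
have d l := L2B measurableT (w2' l) (w2 l); have dv := L2B measurableT F2' F2.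
have e1 : \sum_l << w' l - w l, partial l chi >> =
    \sum_l << w' l, partial l chi >> - \sum_l << w l, partial l chi >>.
  rewrite -sumrB; apply: eq_bigr => l _.
  exact: (L2_innerBl measurableT (w2' l) (w2 l) (dc2 l)).
have e2 : << F' - F, chi >> = << F', chi >> - << F, chi >>.
  exact: (L2_innerBl measurableT F2' F2 c2).
have alg (s a b : R) : a - b = (s - b) - (s - a) by lra.
have -> : \sum_l << w l, partial l chi >> - << F, chi >> =
    << F' - F, chi >> - \sum_l << w' l - w l, partial l chi >>.
  by rewrite e1 e2 (wF' _ tc); exact: alg.
rewrite mulrDr [leRHS]addrC; apply: le_trans (ler_normB _ _) _; apply: lerD.
  apply: le_trans (cauchy_schwarz measurableT dv c2) _.
  by rewrite ler_wpM2r ?L2_norm_ge0.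
apply: le_trans (ler_norm_sum _ _ _) _; rewrite mulr_sumr; apply: ler_sum => l _.
apply: le_trans (cauchy_schwarz measurableT (d l) (dc2 l)) _.
by rewrite ler_wpM2r ?L2_norm_ge0.
Qed.

End h10_linear.

(** * Expansion in eigenfunctions *)

Section spectral.
Context {R : realType} {m : nat} (Om : set 'rV[R]_m).
Local Notation fn := ('rV[R]_m -> R).
Local Notation mu := (@rV_lebesgue R m).
Implicit Types (u v f chi F : fn) (l : 'I_m) (c d : nat -> R) (n p q : nat).
Local Notation "`N u" := (L2_norm setT u) (at level 9).
Local Notation "<< u , v >>" := (L2_inner setT u v).
Hypothesis mOm : measurable Om.
Hypothesis Om_fin : (mu Om < +oo)%E.
Variables (lam : nat -> R) (e : nat -> fn) (w : nat -> 'I_m -> fn).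
Hypothesis e_off : forall i, vanishes_off Om (e i).
Hypothesis w_off : forall i l, vanishes_off Om (w i l).
Hypothesis e_h10 : forall i, h10 Om (e i) (w i).
Hypothesis e_weak : forall i, weak_poisson Om (w i) (lam i *: e i).
Hypothesis e_orthonormal : forall i j, << e i, e j >> = (i == j)%:R.
Hypothesis e_complete : forall f, L2 setT f -> vanishes_off Om f ->
  forall eps, 0 < eps -> exists N, forall n, (N <= n)%N ->
    `N (f - \sum_(i < n) << f, e i >> *: e i) <= eps.

Definition basis_sum (c : nat -> R) (n : nat) : fn := \sum_(i < n) c i *: e i.
Local Notation S := basis_sum.

Lemma e_L2 i : L2 setT (e i). Proof. by have [] := e_h10 i. Qed.

Lemma w_L2 i l : L2 setT (w i l). Proof. by have [_ + _] := e_h10 i; exact. Qed.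

Lemma basis_sum_L2 c n : L2 setT (S c n).
Proof. by apply: (L2_sum measurableT) => i _; exact: (L2Z measurableT _ (e_L2 i)). Qed.

Lemma basis_sum_off c n : vanishes_off Om (S c n).
Proof. by apply: vanishes_off_sum => i _; apply: vanishes_offZ; exact: e_off. Qed.

Lemma inner_basis_sum f c n : L2 setT f -> << f, S c n >> = \sum_(i < n) c i * << f, e i >>.
Proof.
move=> f2; rewrite (L2_inner_sumr measurableT (F := fun i : 'I_n => c i *: e i) _ _ f2).
  by apply: eq_bigr => i _; exact: (L2_innerZr measurableT _ (e_L2 i) f2).
by move=> i _; exact: (L2Z measurableT _ (e_L2 i)).
Qed.

Lemma basis_sum_coord c n j : << S c n, e j >> = if (j < n)%N then c j else 0.
Proof.
rewrite L2_innerC (inner_basis_sum _ _ (e_L2 j)).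
rewrite (eq_bigr (fun i : 'I_n => if i == j :> nat then c i else 0)); last first.
  by move=> i _; rewrite e_orthonormal eq_sym; case: eqP; rewrite ?mulr1 ?mulr0.
case: ifPn => [jn|jn].
  rewrite (bigD1 (Ordinal jn))//= eqxx big1 ?addr0// => i.
  by rewrite -val_eqE /= => /negbTE ->.
rewrite big1// => i _; case: eqP => // ij.
by rewrite -ij ltn_ord in jn.
Qed.

Lemma inner_basis_sums c d p q : (q <= p)%N -> << S c p, S d q >> = \sum_(i < q) d i * c i.
Proof.
move=> qp; rewrite (inner_basis_sum _ _ (basis_sum_L2 c p)); apply: eq_bigr => i _.
by rewrite basis_sum_coord (leq_trans (ltn_ord i) qp).
Qed.

Lemma sqr_norm_basis_sum c n : `N (S c n) ^+ 2 = \sum_(i < n) c i ^+ 2.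
Proof. by rewrite sqr_L2_norm inner_basis_sums. Qed.

Lemma sqr_norm_basis_sumB c p q : (q <= p)%N ->
  `N (S c p - S c q) ^+ 2 = \sum_(i < p) c i ^+ 2 - \sum_(i < q) c i ^+ 2.
Proof.
move=> qp; have p2 := basis_sum_L2 c p; have q2 := basis_sum_L2 c q.
have d2 := L2B measurableT p2 q2.
rewrite sqr_L2_norm (L2_innerBl measurableT p2 q2 d2).
rewrite (L2_innerBr measurableT p2 q2 p2) (L2_innerBr measurableT p2 q2 q2).
rewrite [<< S c q, S c p >>]L2_innerC !inner_basis_sums//.
have E n : \sum_(i < n) c i * c i = \sum_(i < n) c i ^+ 2 by [].
by rewrite !E subrr subr0.
Qed.

(** The sums of squares are nondecreasing and bounded, and their increments are the squared
    distances between the partial sums. *)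
Lemma riesz_fischer_basis c K : (forall n, \sum_(i < n) c i ^+ 2 <= K) ->
  exists f, [/\ L2 setT f, vanishes_off Om f & forall eps, 0 < eps ->
    exists N, forall n, (N <= n)%N -> `N (S c n - f) <= eps].
Proof.
move=> cK; apply: (L2_complete_vanish mOm Om_fin) => [n|n|eps eps0].
- exact: basis_sum_L2.
- exact: basis_sum_off.
pose s n := \sum_(i < n) c i ^+ 2.
have sn p q : (q <= p)%N -> s q <= s p.
  move=> qp; rewrite -subr_ge0 -sqr_norm_basis_sumB//; exact: sqr_ge0.
have hs : has_sup (range s).
  by split; [exists (s 0%N); exists 0%N|exists K => _ [n _ <-]; exact: cK].
have [_ [N _ <-] sN] := sup_adherent (exprn_gt0 2 eps0) hs.
exists N => p q pN qN; wlog qp : p q pN qN / (q <= p)%N => [H|].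
  have [qp|/ltnW pq] := leqP q p; first exact: H.
  rewrite (L2_norm_distC measurableT (basis_sum_L2 c p) (basis_sum_L2 c q)).
  exact: H.
rewrite -ler_sqr ?nnegrE ?L2_norm_ge0 ?(ltW eps0)// sqr_norm_basis_sumB//.
have sp : s p <= sup (range s) by apply: (sup_upper_bound hs); exists p.
have := sn q N qN; rewrite -/(s p) -/(s q); move: sN sp.
by move: (s p) (s q) (s N) (sup _) (eps ^+ 2) => a b x y z; lra.
Qed.

(** By the energy identity, the sum over l of |W p l - W q l|^2 is <S b p - S b q, S c p - S c q>,
    so convergence of the expansions of u and F in L^2 forces that of the gradients. *)
Lemma weak_solution u F : L2 setT u -> vanishes_off Om u -> L2 setT F -> vanishes_off Om F ->
  (forall i, << F, e i >> = lam i * << u, e i >>) ->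
  exists w', [/\ forall l, vanishes_off Om (w' l), h10 Om u w' & weak_poisson Om w' F].
Proof.
move=> u2 u0 F2 F0 uF; pose c i := << u, e i >>; pose b i := << F, e i >>.
pose W n l := \sum_(i < n) c i *: w i l.
have hW n : h10 Om (S c n) (W n) by exact: (h10_lin n c e_h10).
have W2 n l : L2 setT (W n l) by have [_ + _] := hW n; exact.
have pW n : weak_poisson Om (W n) (S b n).
  have := weak_poisson_lin n c w_L2 (fun i => L2Z measurableT (lam i) (e_L2 i)) e_weak.
  congr (weak_poisson _ _ _); apply: eq_bigr => i _.
  by rewrite scalerA /b uF mulrC.
have cu := e_complete u2 u0; have cF := e_complete F2 F0.
have cauchyW l : forall eps, 0 < eps -> exists N, forall p q, (N <= p)%N -> (N <= q)%N ->
    `N (W p l - W q l) <= eps.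
  move=> eps eps0; have eps2 : 0 < eps / 2 by rewrite divr_gt0.
  have [N1 H1] := cu _ eps2; have [N2 H2] := cF _ eps2.
  exists (maxn N1 N2) => p q; rewrite !geq_max => /andP[p1 p2] /andP[q1 q2].
  pose v := S c p - S c q; pose G := S b p - S b q.
  have v2 := L2B measurableT (basis_sum_L2 c p) (basis_sum_L2 c q).
  have G2 := L2B measurableT (basis_sum_L2 b p) (basis_sum_L2 b q).
  have dist (f : fn) (g : nat -> fn) : L2 setT f -> (forall n, L2 setT (g n)) ->
      `N (f - g p) <= eps / 2 -> `N (f - g q) <= eps / 2 -> `N (g p - g q) <= eps.
    move=> f2 g2 fp fq; rewrite (splitr eps).
    apply: le_trans (ler_L2_norm_dist measurableT (g2 p) f2 (g2 q)) _.
    by rewrite (L2_norm_distC measurableT (g2 p) f2) lerD.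
  have vn := dist u (S c) u2 (basis_sum_L2 c) (H1 p p1) (H1 q q1).
  have Gn := dist F (S b) F2 (basis_sum_L2 b) (H2 p p2) (H2 q q2).
  have hd : h10 Om v (fun l => W p l - W q l).
    have := h10D (hW p) (h10Z (-1) (hW q)); rewrite scaleN1r.
    by congr (h10 _ _ _); apply/funext => l'; rewrite scaleN1r.
  have d2 l' := L2B measurableT (W2 p l') (W2 q l').
  have pd : weak_poisson Om (fun l => W p l - W q l) G.
    move=> chi tc; have c2 := test_L2 tc; have dc2 l' := test_L2 (test_partial l' tc).
    rewrite (L2_innerBl measurableT (basis_sum_L2 b p) (basis_sum_L2 b q) c2).
    rewrite -(pW p chi tc) -(pW q chi tc) -sumrB; apply: eq_bigr => l' _.
    exact: (L2_innerBl measurableT (W2 p l') (W2 q l') (dc2 l')).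
  have en := weak_poisson_h10 hd d2 G2 pd.
  rewrite -ler_sqr ?nnegrE ?L2_norm_ge0 ?(ltW eps0)// sqr_L2_norm.
  apply: (@le_trans _ _ (\sum_l << W p l - W q l, W p l - W q l >>)).
    by rewrite (bigD1 l)//= lerDl sumr_ge0// => l' _; exact: L2_inner_ge0.
  rewrite en; apply: le_trans (le_cauchy_schwarz measurableT G2 v2) _.
  rewrite expr2; apply: ler_pM; [exact: L2_norm_ge0|exact: L2_norm_ge0|exact: Gn|exact: vn].
have W0 n l : vanishes_off Om (W n l).
  by apply: vanishes_off_sum => i _; apply: vanishes_offZ; exact: w_off.
have /choice[w' w'P] l : exists v, [/\ L2 setT v, vanishes_off Om v & forall eps, 0 < eps ->
    exists N, forall n, (N <= n)%N -> `N (W n l - v) <= eps].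
  exact: (L2_complete_vanish mOm Om_fin (W2 ^~ l) (W0 ^~ l) (cauchyW l)).
have w'2 l : L2 setT (w' l) by have [] := w'P l.
have unif eps : 0 < eps -> exists n, [/\ `N (S c n - u) <= eps, `N (S b n - F) <= eps &
    forall l, `N (W n l - w' l) <= eps].
  move=> eps0; have [N1 H1] := cu _ eps0; have [N2 H2] := cF _ eps0.
  have /choice[N3 H3] l : exists N, forall n, (N <= n)%N -> `N (W n l - w' l) <= eps.
    by have [_ _] := w'P l; exact.
  pose n := (N1 + N2 + \sum_l N3 l)%N; exists n.
  have n1 : (N1 <= n)%N by rewrite /n -addnA leq_addr.
  have n2 : (N2 <= n)%N by rewrite /n addnAC leq_addl.
  have n3 l : (N3 l <= n)%N by rewrite /n (bigD1 l)//= addnCA leq_addr.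
  split=> [||l]; last exact: H3.
    by rewrite (L2_norm_distC measurableT (basis_sum_L2 c n) u2) H1.
  by rewrite (L2_norm_distC measurableT (basis_sum_L2 b n) F2) H2.
exists w'; split; first by move=> l; have [] := w'P l.
  apply: h10_closed => // eps /unif[n [n1 _ n3]].
  by exists (S c n), (W n).
apply: weak_poisson_closed => // eps /unif[n [_ n2 n3]].
exists (W n), (S b n); split => //; exact: basis_sum_L2.
Qed.

(** * Riesz representation of functionals on test functions *)

Section riesz.
Variables (ell : fn -> R) (K : R).
Hypothesis ellD : forall chi chi', test_function Om chi -> test_function Om chi' ->
  ell (chi + chi') = ell chi + ell chi'.
Hypothesis ellZ : forall a chi, test_function Om chi -> ell (a *: chi) = a * ell chi.
Hypothesis K_ge0 : 0 <= K.
Hypothesis ellK : forall chi, test_function Om chi -> `|ell chi| <= K * `N chi.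

Let ell_dist chi chi' : test_function Om chi -> test_function Om chi' ->
  `|ell chi - ell chi'| <= K * `N (chi - chi').
Proof.
move=> t1 t2; have <- : ell (chi - chi') = ell chi - ell chi'.
  by rewrite -scaleN1r ellD ?ellZ ?mulN1r//; exact: testZ.
by apply: ellK; exact: testB.
Qed.

Let ell_sum n d (chi : nat -> fn) : (forall i, test_function Om (chi i)) ->
  ell (\sum_(i < n) d i *: chi i) = \sum_(i < n) d i * ell (chi i).
Proof.
move=> tc; elim: n => [|n IH].
  by rewrite !big_ord0 -(scale0r (0 : fn)) ellZ ?mul0r//; exact: test0.
rewrite !big_ord_recr /= ellD ?IH ?ellZ//; last exact: testZ.
by apply: test_sum => i _; exact: testZ.
Qed.

(* McShane's formula for an extension of ell that does not need f to be
   approximated by test functions. *)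
Let ell_ext f : L2 setT f -> exists c : R, forall chi, test_function Om chi ->
  `|ell chi - c| <= K * `N (chi - f).
Proof.
move=> f2; pose A := [set y | exists2 chi, test_function Om chi & y = ell chi - K * `N (chi - f)].
have ubA chi : test_function Om chi -> ubound A (ell chi + K * `N (chi - f)).
  move=> tc _ [chi' tc' ->]; rewrite lerBlDr -addrA -lerBlDl.
  apply: le_trans (ler_norm _) _; apply: le_trans (ell_dist tc' tc) _.
  rewrite -mulrDr ler_wpM2l// (L2_norm_distC measurableT (test_L2 tc') (test_L2 tc)).
  apply: le_trans (ler_L2_norm_dist measurableT (test_L2 tc) f2 (test_L2 tc')) _.
  by rewrite (L2_norm_distC measurableT f2 (test_L2 tc')).
have A0 : A !=set0 by exists (ell 0 - K * `N (0 - f)); exists 0 => //; exact: test0.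
have hA : has_ubound A by exists (ell 0 + K * `N (0 - f)); apply: ubA; exact: test0.
exists (sup A) => chi tc; rewrite ler_distlC; apply/andP; split.
  by apply: ub_le_sup => //; exists chi.
exact: (ge_sup A0 (ubA chi tc)).
Qed.

(** ell is only defined to be controlled on test functions, so [c i] is the value at e i of an
    extension of ell. [key], proved by approximating the e i by test functions, shows that these
    values fit together linearly; the function with coefficients c then represents ell. *)
Lemma riesz : exists f, [/\ L2 setT f, vanishes_off Om f & forall chi,
  test_function Om chi -> ell chi = << f, chi >>].
Proof.
have /choice[c cP] i := ell_ext (e_L2 i).
have key n d chi : test_function Om chi ->
    `|ell chi - \sum_(i < n) d i * c i| <= K * `N (chi - S d n).
  move=> tc; have c2 := test_L2 tc; have S2 := basis_sum_L2 d n.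
  pose D := \sum_(i < n) `|d i|.
  have D0 : 0 <= D by rewrite sumr_ge0.
  have KD0 : 0 <= K * D + K * D by rewrite addr_ge0// mulr_ge0.
  apply: (le_of_eps KD0) => eps eps0 _.
  have /choice[x xP] i : exists x, test_function Om x /\ `N (x - e i) <= eps.
    by have [_ _ /(_ eps eps0)[x [tx xe _]]] := e_h10 i; exists x.
  have tx i : test_function Om (x i) by have [] := xP i.
  have x2 i := test_L2 (tx i).
  pose T : fn := \sum_(i < n) d i *: x i.
  have tT : test_function Om T by apply: test_sum => i _; exact: testZ.
  have TS : `N (S d n - T) <= eps * D.
    rewrite (L2_norm_distC measurableT S2 (test_L2 tT)) /T /S -sumrB.
    have xe2 i := L2B measurableT (x2 i) (e_L2 i).
    apply: le_trans (ler_L2_norm_sum measurableT _ (P := xpredT) _) _.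
      by move=> i _; apply: (L2B measurableT); apply: (L2Z measurableT) => //; exact: e_L2.
    rewrite mulr_sumr; apply: ler_sum => i _.
    by rewrite -scalerBr (L2_normZ measurableT _ (xe2 i)) mulrC ler_wpM2r// (xP i).2.
  have b1 : `|ell chi - ell T| <= K * (`N (chi - S d n) + eps * D).
    apply: le_trans (ell_dist tc tT) _; apply: ler_wpM2l => //.
    apply: le_trans (ler_L2_norm_dist measurableT c2 S2 (test_L2 tT)) _.
    by rewrite lerD2l.
  have b2 : `|ell T - \sum_(i < n) d i * c i| <= K * (eps * D).
    rewrite ell_sum// -sumrB; apply: le_trans (ler_norm_sum _ _ _) _.
    rewrite !mulr_sumr; apply: ler_sum => i _.
    rewrite -mulrBr normrM mulrC mulrA ler_wpM2r//.
    by apply: le_trans (cP i _ (tx i)) _; rewrite ler_wpM2l// (xP i).2.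
  have -> : ell chi - \sum_(i < n) d i * c i = (ell chi - ell T) + (ell T - \sum_(i < n) d i * c i).
    by rewrite addrA subrK.
  apply: le_trans (ler_normD _ _) _; apply: le_trans (lerD b1 b2) _.
  by rewrite le_eqVlt; apply/orP; left; apply/eqP; ring.
(* [key] with chi = 0 and d = c bounds the sum of squares by K times its own square root. *)
have cK n : \sum_(i < n) c i ^+ 2 <= K ^+ 2.
  have := key n c 0 (test0 Om); have -> : ell 0 = 0.
    by rewrite -(scale0r (0 : fn)) ellZ ?mul0r//; exact: test0.
  rewrite !sub0r normrN (L2_normN measurableT (basis_sum_L2 c n)).
  have -> : \sum_(i < n) c i * c i = \sum_(i < n) c i ^+ 2 by [].
  rewrite -sqr_norm_basis_sum; have := L2_norm_ge0 setT (S c n).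
  move: (`N (S c n)) => x x0; rewrite ger0_norm ?sqr_ge0// => xK.
  rewrite ler_sqr ?nnegrE//; move: x0; rewrite le_eqVlt => /predU1P[<-//|x0].
  by move: xK; rewrite expr2 ler_pM2r.
have [f [f2 f0 fP]] := riesz_fischer_basis cK.
exists f; split => // chi tc; have c2 := test_L2 tc.
have c0 : vanishes_off Om chi by move=> x; exact: test_off.
have KN0 : 0 <= K + `N chi by rewrite addr_ge0// L2_norm_ge0.
apply: (eq_of_eps KN0) => eps eps0 _.
have [N1 H1] := e_complete c2 c0 eps0; have [N2 H2] := fP _ eps0.
pose n := maxn N1 N2; pose d i := << chi, e i >>.
have b1 : `|ell chi - \sum_(i < n) d i * c i| <= eps * K.
  apply: le_trans (key n d chi tc) _; rewrite mulrC ler_wpM2r//.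
  by apply: H1; rewrite leq_maxl.
have S2 := basis_sum_L2 c n.
have b2 : `|\sum_(i < n) d i * c i - << f, chi >>| <= eps * `N chi.
  have -> : \sum_(i < n) d i * c i = << S c n, chi >>.
    rewrite L2_innerC (inner_basis_sum _ _ c2); apply: eq_bigr => i _.
    by rewrite mulrC.
  rewrite -(L2_innerBl measurableT S2 f2 c2).
  apply: le_trans (cauchy_schwarz measurableT (L2B measurableT S2 f2) c2) _.
  by rewrite ler_wpM2r ?L2_norm_ge0// H2// leq_maxr.
have -> : ell chi - << f, chi >> =
    (ell chi - \sum_(i < n) d i * c i) + (\sum_(i < n) d i * c i - << f, chi >>).
  by rewrite addrA subrK.
rewrite mulrDr; apply: le_trans (ler_normD _ _) _.
exact: lerD.
Qed.

End riesz.

End spectral.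

Transparent L2 partial L2_norm L2_inner.

(** * The Landesman-Lazer condition *)

Lemma limf_esup_lt0 (R : realType) (h : R -> R) (F : set_system R) :
  (limf_esup (fun y => (h y)%:E) F < 0)%E ->
  exists V d, [/\ F V, 0 < d & forall x, V x -> h x <= - d].
Proof.
move=> /ereal_inf_lt[_ [V FV <-]] sV.
have hV x : V x -> ((h x)%:E <= ereal_sup [set (h y)%:E | y in V])%E.
  by move=> Vx; apply: ereal_sup_ubound; exists x.
case: (ereal_sup _) sV hV => [s|//|] s0 hV.
  exists V, (- s); split => //; first by rewrite oppr_gt0 -lte_fin.
  by move=> x /hV; rewrite lee_fin opprK.
(* Here the supremum is -oo, so V has no points and any positive d will do. *)
by exists V, 1; split => // x /hV; rewrite leNgt ltNyr.
Qed.

(** * The superposition operator and its sign at large amplitude *)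

Section superposition.
Context {R : realType} {m : nat} (Om : set 'rV[R]_m).
Hypothesis mOm : measurable Om.
Hypothesis Om_fin : (@rV_lebesgue R m Om < +oo)%E.
Local Notation mu := (@rV_lebesgue R m).
Local Notation fn := ('rV[R]_m -> R).
Implicit Types (u v f : fn) (g : R -> R).
Local Notation "`N u" := (L2_norm setT u) (at level 9).
Local Notation "<< u , v >>" := (L2_inner setT u v).

Definition superpos g u : fn := zext Om (g \o u).

Section bounded.
Variables (g : R -> R) (M : R).
Hypotheses (cg : continuous g) (gM : forall y, `|g y| <= M).

Let M0 : 0 <= M. Proof. exact: le_trans (normr_ge0 _) (gM 0). Qed.

Let mgu u : measurable_fun setT u -> measurable_fun setT (g \o u).
Proof. by move=> mu_; apply: measurableT_comp mu_; exact: continuous_measurable_fun. Qed.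

Let gu2 u : measurable_fun setT u -> L2 Om (g \o u).
Proof.
move=> mu_; apply: (L2_bounded mOm Om_fin (a := M)) => [|x _]; last exact: gM.
exact: measurable_funS (mgu mu_).
Qed.

Lemma superpos_L2 u : measurable_fun setT u -> L2 setT (superpos g u).
Proof. by move=> mu_; apply: L2_zext => //; exact: gu2. Qed.

Lemma superpos_off u : vanishes_off Om (superpos g u).
Proof. exact: zext_off. Qed.

Lemma norm_superpos u : measurable_fun setT u ->
  `N (superpos g u) <= M * L2_norm Om (cst 1).
Proof.
move=> mu_; rewrite -L2_norm_zext; apply: L2_norm_bounded => // [|x _]; [exact: (gu2 mu_).1|exact: gM].
Qed.

(** Dominated convergence with majorant M |f|, which is integrable because Om has finite measure. *)
Lemma superpos_cvg (u : nat -> fn) v f : (forall n, measurable_fun setT (u n)) ->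
  measurable_fun setT v -> L2 setT f ->
  {ae mu, forall x, Om x -> (fun n => u n x) @ \oo --> v x} ->
  (fun n => << superpos g (u n), f >>) @ \oo --> << superpos g v, f >>.
Proof.
move=> mu_ mv f2 uv; have f2' := L2_restrict mOm f2.
have inE' u' : << superpos g u', f >> = fine (\int[mu]_(x in Om) (g (u' x) * f x)%:E)%E.
  by rewrite /superpos -L2_inner_zext.
under eq_fun do rewrite inE'; rewrite inE'.
have mgf u' : measurable_fun setT u' ->
    measurable_fun Om (EFin \o (fun x => g (u' x) * f x)).
  move=> mu'; apply/measurable_EFinP/measurable_funM; last exact: f2'.1.
  exact: (gu2 mu').1.
have iM : mu.-integrable Om (EFin \o (fun x => cst M x * f x)).
  by apply: L2_integrableM => //; exact: L2_cst.
have [] // := @dominated_convergence _ _ _ mu Om mOm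
    (fun n x => (g (u n x) * f x)%:E) (fun x => (g (v x) * f x)%:E) _ _ _ _
    (integrable_abse iM) _.
- by move=> n; exact: mgf.
- exact: mgf.
- apply: filterS uv => x ux Ox; apply/cvg_EFin; first exact: nearW.
  apply: cvgM; last exact: cvg_cst.
  by apply: (@cvg_comp _ _ _ (fun n => u n x) g _ (nbhs (v x))); [exact: ux|exact: cg].
- apply: aeW => x n Ox /=; rewrite lee_fin !normrM ler_wpM2r//.
  by rewrite (le_trans (gM _))// ler_norm.
move=> igf _ cgf; apply: fine_cvg; apply: cvg_trans cgf _; rewrite fineK//.
by apply: integrable_fin_num => //.
Qed.

End bounded.

Lemma le_L2_inner u v u' v' : L2 setT u -> L2 setT v -> L2 setT u' -> L2 setT v' ->
  (forall x, u x * v x <= u' x * v' x) -> << u, v >> <= << u', v' >>.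
Proof.
move=> u2 v2 u2' v2' h; apply: le_Rintegral => //; exact: L2_integrableM.
Qed.

Lemma L2_abs u : L2 setT u -> L2 setT (fun x => `|u x|).
Proof.
move=> u2; apply: (L2_le measurableT (a := 1) _ u2); last by move=> x _; rewrite normr_id mul1r.
by apply: measurableT_comp => //; exact: u2.1.
Qed.

Lemma norm_abs u : `N (fun x => `|u x|) = `N u.
Proof. by congr Num.sqrt; apply: eq_L2_inner => x _; rewrite -!expr2 real_normK ?num_real. Qed.

Local Notation one := (zext Om (cst 1)).

Lemma one_L2 : L2 setT one.
Proof. by apply: L2_zext => //; exact: L2_cst. Qed.

(** f may be unbounded, but a test function psi at distance at most 1/2 is bounded: 1/2 <= <f, psi>,
    and <f, psi> is at most a bound of |psi| times the integral of |f|. *)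
Lemma inner_abs_gt0 f w : h10 Om f w -> << f, f >> = 1 -> 0 < << fun x => `|f x|, one >>.
Proof.
move=> [f2 _ fa] f1.
have a2 := L2_abs f2; have fn1 : `N f = 1 by rewrite /L2_norm f1 sqrtr1.
have [psi [tp pf _]] := fa _ (divr_gt0 ltr01 (ltr0Sn R 1)).
have p2 := test_L2 tp; have [K K0 pK] := test_bounded tp.
have d2 := L2B measurableT p2 f2.
have e : << f, psi >> = 1 + << f, psi - f >>.
  by rewrite (L2_innerBr measurableT p2 f2 f2) f1 addrC subrK.
have b1 : `|<< f, psi - f >>| <= 2^-1.
  by apply: le_trans (cauchy_schwarz measurableT f2 d2) _; rewrite fn1 mul1r -div1r.
have b2 : << f, psi >> <= K * << fun x => `|f x|, one >>.
  rewrite -(L2_innerZr measurableT K one_L2 a2).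
  apply: (le_L2_inner f2 p2 a2 (L2Z measurableT K one_L2)) => x.
  have [Ox|Ox] := pselect (Om x); last first.
    rewrite (test_off tp Ox) mulr0 mulr_ge0//; have -> : (K *: one) x = K * one x by [].
    by rewrite mulr_ge0// /zext; case: ifP.
  have -> : (K *: one) x = K * one x by [].
  rewrite zextT// mulr1.
  rewrite (le_trans (ler_norm _))// normrM ler_wpM2l//.
have : 2^-1 <= << f, psi >>.
  by rewrite e; move: b1; rewrite ler_norml => /andP[b1 _]; lra.
move=> /le_trans/(_ b2); rewrite ltNge => h; apply/negP => h0.
have : K * << fun x => `|f x|, one >> <= 0 by rewrite mulr_ge0_le0.
by move: h; move: (K * _) => z; lra.
Qed.

(* The pointwise bound phi g(xi phi + U) >= d |phi| - (d + M)(|U| + y0)/xi holds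
   because the first term alone is a bound where xi |phi| >= |U| + y0, and
   |phi| < (|U| + y0)/xi elsewhere. *)
Lemma landesman_lazer (g : R -> R) (M d y0 rho : R) f w : continuous g ->
  (forall y, `|g y| <= M) -> 0 < d -> 0 <= y0 -> 0 <= rho ->
  (forall y, y0 <= y -> d <= g y) -> (forall y, y <= - y0 -> g y <= - d) ->
  h10 Om f w -> << f, f >> = 1 ->
  exists2 r, 0 < r & forall xi U, r <= xi -> L2 setT U -> `N U <= rho ->
    0 < << superpos g (xi *: f + U), f >>.
Proof.
move=> cg gM d0 y00 rho0 gpos gneg hf f1; have [f2 _ _] := hf.
have M0 : 0 <= M by exact: le_trans (normr_ge0 _) (gM 0).
have d0' := ltW d0; have dM0 : 0 <= d + M by exact: addr_ge0.
have a0 := inner_abs_gt0 hf f1; set a := << _, _ >> in a0.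
(* B / xi bounds the integral of the error term. For xi > B / (d * a) it is smaller than d * a, the
   integral of the main term. *)
pose B := (d + M) * (rho * `N one + y0 * << one, one >>).
have one0 : 0 <= `N one by exact: L2_norm_ge0.
have one1 : 0 <= << one, one >> by exact: L2_inner_ge0.
have B0 : 0 <= B by rewrite mulr_ge0 ?addr_ge0 ?mulr_ge0.
have da : 0 < d * a by exact: mulr_gt0.
have Bda : 0 <= B / (d * a) by rewrite divr_ge0// ltW.
exists (B / (d * a) + 1) => [|xi U rxi U2 Urho].
  by rewrite ltr_wpDl.
have xi0 : 0 < xi.
  by apply: lt_le_trans rxi; rewrite ltr_wpDl.
have xi0' := ltW xi0.
have aU2 := L2_abs U2; have af2 := L2_abs f2; have o2 := one_L2.
pose k := (d + M) / xi.
have k0 : 0 <= k by rewrite divr_ge0.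
have xf2 := L2D measurableT (L2Z measurableT xi f2) U2.
have g2 := superpos_L2 cg gM xf2.1.
pose p1 : fn := d *: (fun x => `|f x|).
pose p2 : fn := k *: (fun x => `|U x|).
pose p3 : fn := (k * y0) *: one.
have p12 : L2 setT p1 by exact: L2Z.
have p22 : L2 setT p2 by exact: L2Z.
have p32 : L2 setT p3 by exact: L2Z.
have b : << p1 - p2 - p3, one >> <= << superpos g (xi *: f + U), f >>.
  apply: le_L2_inner => //; first by apply: L2B => //; exact: L2B.
  move=> x; have [Ox|Ox] := pselect (Om x); last first.
    by rewrite (zext_off (cst 1) Ox) mulr0 /superpos (zext_off _ Ox) mul0r.
  have -> : (p1 - p2 - p3) x = d * `|f x| - k * `|U x| - k * y0 * one x by [].
  have -> : superpos g (xi *: f + U) x = g (xi * f x + U x) by rewrite /superpos zextT.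
  rewrite zextT// !mulr1.
  have kE : k * (`|U x| + y0) = (d + M) * ((`|U x| + y0) / xi) by rewrite /k mulrAC mulrA.
  rewrite -addrA -opprD -mulrDr kE.
  have q0 : 0 <= (`|U x| + y0) / xi by rewrite divr_ge0// addr_ge0.
  have [fl|fl] := leP ((`|U x| + y0) / xi) `|f x|.
    apply: (@le_trans _ _ (d * `|f x|)).
      by rewrite gerBl mulr_ge0.
    move: fl; rewrite ler_pdivrMr// => fl.
    have [fx|fx] := leP 0 (f x).
      rewrite ger0_norm// ler_wpM2r// gpos//.
      move: fl; rewrite (ger0_norm fx) => fl; have := ler_norm (- U x); rewrite normrN.
      by move: (f x * xi) (xi * f x) (mulrC (f x) xi) fl => z z' <-; lra.
    rewrite ltr0_norm// mulrN -mulNr ler_wnM2r ?(ltW fx)// gneg//.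
    move: fl; rewrite (ltr0_norm fx) mulNr => fl; have := ler_norm (U x).
    by move: (f x * xi) (xi * f x) (mulrC (f x) xi) fl => z z' <-; lra.
  have h1 : - (M * `|f x|) <= g (xi * f x + U x) * f x.
    rewrite lerNl; apply: le_trans (ler_norm _) _; rewrite normrN normrM.
    by rewrite ler_wpM2r.
  apply: le_trans h1; rewrite lerBlDr addrC -lerBlDr opprK -mulrDl.
  by rewrite ler_wpM2l// ltW.
apply: lt_le_trans b.
have p122 : L2 setT (p1 - p2) by exact: L2B.
rewrite (L2_innerBl measurableT p122 p32 o2) (L2_innerBl measurableT p12 p22 o2).
rewrite (L2_innerZl measurableT d af2 o2) (L2_innerZl measurableT k aU2 o2).
rewrite (L2_innerZl measurableT (k * y0) o2 o2) -/a.
have c : << fun x => `|U x|, one >> <= rho * `N one.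
  apply: le_trans (le_cauchy_schwarz measurableT aU2 o2) _.
  by rewrite norm_abs ler_wpM2r.
have kc := ler_wpM2l k0 c.
suff : k * (rho * `N one) + k * y0 * << one, one >> < d * a.
  move: kc; move: (k * _) (k * _) (k * y0 * _) (d * a) => x y z t; lra.
have -> : k * (rho * `N one) + k * y0 * << one, one >> = B / xi.
  by rewrite -[k * y0 * _]mulrA -mulrDr /k /B mulrAC.
rewrite ltr_pdivrMr// mulrC -ltr_pdivrMr//.
by apply: lt_le_trans rxi; rewrite ltrDl.
Qed.

End superposition.

(** * Galerkin approximation *)

Lemma cvg_sum_ord (R : realType) (N : nat) (u : nat -> nat -> R) (a : nat -> R) :
  (forall i, (fun n => u n i) @ \oo --> a i) ->
  (fun n => \sum_(i < N) u n i) @ \oo --> \sum_(i < N) a i.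
Proof.
move=> ua; elim: N => [|N IH].
  by under eq_fun do rewrite big_ord0; rewrite big_ord0; exact: cvg_cst.
under eq_fun do rewrite big_ord_recr /=; rewrite big_ord_recr /=.
exact: cvgD.
Qed.

(** Dominated convergence speaks of sequences, whereas [poincare_miranda] asks for continuity along
    the neighbourhood filter. *)
Lemma sequentially_continuous (R : realType) n (f : 'rV[R]_n -> R) (x : 'rV[R]_n) :
  (forall y : nat -> 'rV[R]_n, (forall i, ball x i.+1%:R^-1 (y i)) ->
     (fun i => f (y i)) @ \oo --> f x) -> f @ x --> f x.
Proof.
move=> fy; apply/(@cvgrPdist_lt _ _ _ (nbhs x)) => eps eps0; apply: contrapT => nn.
have /choice[y yP] (i : nat) : exists y, ball x i.+1%:R^-1 y /\ eps <= `|f x - f y|.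
  apply: contrapT => /forallNP H; apply: nn.
  have : nbhs x (ball x (i.+1%:R^-1 : R)) by apply: nbhsx_ballx; rewrite invr_gt0.
  apply: filterS => y xy; have /not_andP[//|/negP] := H y.
  by rewrite -ltNge.
have /cvgrPdist_lt/(_ eps eps0)[N _ HN] := fy y (fun i => (yP i).1).
by have := HN N (leqnn N); rewrite /= ltNge (yP N).2.
Qed.

(* A diagonal subsequence, obtained as a cluster point in the product topology. *)
Lemma coordinatewise_cluster (R : realType) (c : nat -> nat -> R) (b : R) :
  (forall N j, `|c N j| <= b) ->
  exists z, forall J eps N0, 0 < eps -> exists N, (N0 <= N)%N /\
    forall j, (j < J)%N -> `|c N j - z j| <= eps.
Proof.
move=> cb.
have [|z [_ zc]] := @tychonoff nat (fun=> R) (fun=> `[- b, b]%classic)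
  (fun=> @segment_compact _ _ _) (c @ \oo) _ _.
  by exists 0%N => // N _ j; rewrite /= in_itv /= -ler_norml.
exists z => J eps N0 eps0.
pose B J : set (nat -> R) := [set f | forall j, (j < J)%N -> `|f j - z j| < eps].
have FF : Filter (@nbhs _ (prod_topology (fun _ : nat => R)) z) by exact: nbhs_filter.
have zB : @nbhs _ (prod_topology (fun _ : nat => R)) z (B J).
  elim: J => [|J IH]; first by apply: (@filterS _ _ FF _ _ _ (@filterT _ _ FF)) => f _ j.
  have : @nbhs _ (prod_topology (fun _ : nat => R)) z [set f | `|f J - z J| < eps].
    have := @proj_continuous nat (fun=> R) J z.
    move=> /cvgrPdist_lt/(_ eps eps0); apply: filterS => f /=.
    by rewrite distrC.
  apply: (@filterS2 _ _ FF) IH => f fJ fj j; rewrite ltnS leq_eqVlt => /predU1P[->//|].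
  exact: fJ.
have [|_ [[N NN0 <-] NB]] := zc [set f | exists2 N, (N0 <= N)%N & c N = f] (B J) _ zB.
  by exists N0 => // N NN0; exists N.
by exists N; split => // j jJ; apply/ltW/NB.
Qed.

Section galerkin.
Context {R : realType} {m : nat} (Om : set 'rV[R]_m).
Local Notation fn := ('rV[R]_m -> R).
Local Notation mu := (@rV_lebesgue R m).
Implicit Types (u v h : fn) (l : 'I_m) (c d : nat -> R) (n p q N : nat).
Local Notation "`N u" := (L2_norm setT u) (at level 9).
Local Notation "<< u , v >>" := (L2_inner setT u v).
Hypothesis mOm : measurable Om.
Hypothesis Om_fin : (mu Om < +oo)%E.
Variables (lam : nat -> R) (e : nat -> fn) (w : nat -> 'I_m -> fn).
Hypothesis e_off : forall i, vanishes_off Om (e i).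
Hypothesis e_h10 : forall i, h10 Om (e i) (w i).
Hypothesis e_orthonormal : forall i j, << e i, e j >> = (i == j)%:R.
Local Notation S := (basis_sum e).
Let e2 i : L2 setT (e i). Proof. exact: e_L2 e_h10 i. Qed.
Let S2 c n : L2 setT (S c n). Proof. exact: basis_sum_L2 e_h10 c n. Qed.

Lemma norm_e i : `N (e i) = 1.
Proof. by rewrite /L2_norm e_orthonormal eqxx sqrtr1. Qed.

Opaque L2 partial L2_norm L2_inner.

Lemma basis_sumE c n x : S c n x = \sum_(i < n) c i * e i x.
Proof.
elim: n => [|n IH]; rewrite /basis_sum ?big_ord0// !big_ord_recr /=.
by rewrite addrfctE -IH.
Qed.

Lemma eq_basis_sum c d n : (forall i, (i < n)%N -> c i = d i) -> S c n = S d n.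
Proof. by move=> cd; apply: eq_bigr => i _; rewrite cd. Qed.

Lemma basis_sumB c d n : S c n - S d n = S (fun i => c i - d i) n.
Proof. by rewrite /basis_sum -sumrB; apply: eq_bigr => i _; rewrite scalerBl. Qed.

Lemma norm_basis_sum_le c n : `N (S c n) <= \sum_(i < n) `|c i|.
Proof.
apply: le_trans (ler_L2_norm_sum measurableT _ (P := xpredT) _) _.
  by move=> i _; exact: (L2Z measurableT _ (e2 i)).
by apply: ler_sum => i _; rewrite (L2_normZ measurableT _ (e2 i)) norm_e mulr1.
Qed.

Lemma basis_sum_pick c n k : (k < n)%N ->
  S c n = c k *: e k + S (fun j => if j == k then 0 else c j) n.
Proof.
move=> kn; rewrite /basis_sum (bigD1 (Ordinal kn))//=; congr (_ + _).
rewrite [RHS](bigD1 (Ordinal kn))//= eqxx scale0r add0r; apply: eq_bigr => i.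
by rewrite -val_eqE /= => /negbTE ->.
Qed.

Lemma bessel h n : L2 setT h -> \sum_(i < n) << h, e i >> ^+ 2 <= `N h ^+ 2.
Proof.
move=> h2; pose c i := << h, e i >>; have Sc := S2 c n.
have d2 := L2B measurableT h2 Sc.
have := L2_inner_ge0 setT (h - S c n).
rewrite (L2_innerBl measurableT h2 Sc d2) (L2_innerBr measurableT h2 Sc h2).
rewrite (L2_innerBr measurableT h2 Sc Sc) [<< S c n, h >>]L2_innerC.
rewrite (inner_basis_sum e_h10 c n h2) -(sqr_L2_norm _ (S c n)).
rewrite (sqr_norm_basis_sum e_h10 e_orthonormal) -(sqr_L2_norm _ h).
have -> : \sum_(i < n) c i * << h, e i >> = \sum_(i < n) << h, e i >> ^+ 2 by [].
by rewrite subrr subr0 subr_ge0.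
Qed.

Variables (k : nat) (g : R -> R) (M d0 y0 : R) (f : fn).
Hypothesis lam_simple : forall j, j != k -> lam j != lam k.
Hypothesis lam_infty : forall A, exists J, forall j, (J <= j)%N -> A <= lam j.
Hypotheses (cg : continuous g) (gM : forall y, `|g y| <= M).
Hypotheses (d0_gt0 : 0 < d0) (y0_ge0 : 0 <= y0).
Hypothesis gpos : forall y, y0 <= y -> d0 <= g y.
Hypothesis gneg : forall y, y <= - y0 -> g y <= - d0.
Hypotheses (f2 : L2 setT f) (f_orth : << f, e k >> = 0).
Local Notation G := (superpos Om g).
Local Notation gap j := (lam k - lam j).

(** It bounds the norm of the residual g(u) - f uniformly in u, see [norm_residual]. *)
Definition galerkin_bound : R := M * L2_norm Om (cst 1) + `N f.
Local Notation B := galerkin_bound.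

Lemma galerkin_bound_ge0 : 0 <= B.
Proof.
by rewrite addr_ge0 ?mulr_ge0 ?L2_norm_ge0// (le_trans _ (gM 0)).
Qed.

Let L2m u : L2 setT u -> measurable_fun setT u. Proof. exact: L2_measurable. Qed.

Let Gf2 u : L2 setT u -> L2 setT (G u - f).
Proof. by move=> u2; exact: (L2B measurableT (superpos_L2 mOm Om_fin cg gM (L2m u2)) f2). Qed.

Lemma norm_residual u : L2 setT u -> `N (G u - f) <= B.
Proof.
move=> u2; have g2 := superpos_L2 mOm Om_fin cg gM (L2m u2).
apply: le_trans (ler_L2_normD measurableT g2 (L2N measurableT f2)) _.
rewrite (L2_normN measurableT f2) lerD2r; exact: norm_superpos (L2m u2).
Qed.

Lemma residual_le u j : L2 setT u -> `|<< G u - f, e j >>| <= B.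
Proof.
move=> u2; apply: le_trans (cauchy_schwarz measurableT (Gf2 u2) (e2 j)) _.
by rewrite norm_e mulr1; exact: norm_residual.
Qed.

Lemma residual_k u : L2 setT u -> << G u - f, e k >> = << G u, e k >>.
Proof.
move=> u2; have g2 := superpos_L2 mOm Om_fin cg gM (L2m u2).
by rewrite (L2_innerBl measurableT g2 f2 (e2 k)) f_orth subr0.
Qed.

Lemma gap_neq0 j : j != k -> 0 < `|gap j|.
Proof. by move=> jk; rewrite normr_gt0 subr_eq0 eq_sym lam_simple. Qed.

Lemma gap_large A : exists J, forall j, (J <= j)%N -> A <= `|gap j|.
Proof.
have [J HJ] := lam_infty (lam k + A); exists J => j /HJ h.
by rewrite distrC (le_trans _ (ler_norm _))// lerBrDl.
Qed.

(** All but finitely many gaps are at least 1 in absolute value, and the others are nonzero for j !=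
    k by simplicity. *)
Lemma gap_lower : exists2 delta, 0 < delta & forall j, j != k -> delta <= `|gap j|.
Proof.
have [J HJ] := gap_large 1.
suff [delta d0' dP] : exists2 delta, 0 < delta & forall j, (j < J)%N -> j != k -> delta <= `|gap j|.
  exists (Num.min delta 1); first by rewrite lt_min d0' ltr01.
  move=> j jk; rewrite ge_min; have [jJ|/HJ ->] := ltnP j J; last by rewrite orbT.
  by rewrite dP.
elim: J {HJ} => [|J [delta d0' dP]]; first by exists 1.
have [Jk|Jk] := eqVneq J k.
  exists delta => // j; rewrite ltnS leq_eqVlt => /predU1P[->|jJ] jk; last exact: dP.
  by rewrite Jk eqxx in jk.
exists (Num.min delta `|gap J|); first by rewrite lt_min d0' gap_neq0.
move=> j; rewrite ltnS leq_eqVlt ge_min => /predU1P[->|jJ] jk; first by rewrite lexx orbT.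
by rewrite dP.
Qed.

(** The second inequality is the first one for the reflected nonlinearity y |-> - g (- y) and for -
    U. *)
Lemma landesman_lazer2 rho : 0 <= rho -> exists2 r, 0 < r & forall xi U, r <= xi ->
  L2 setT U -> `N U <= rho ->
  0 < << G (xi *: e k + U), e k >> /\ << G (- xi *: e k + U), e k >> < 0.
Proof.
move=> rho0; have ek1 : << e k, e k >> = 1 by rewrite e_orthonormal eqxx.
have [r1 r10 H1] := landesman_lazer mOm Om_fin cg gM d0_gt0 y0_ge0 rho0 gpos gneg (e_h10 k) ek1.
pose gr y := - g (- y).
have cgr : continuous gr.
  move=> y; apply: (@cvgN _ _ _ (nbhs y)); apply: (@continuous_comp _ _ _ -%R g).
    exact: oppr_continuous.
  exact: cg.
have grM y : `|gr y| <= M by rewrite normrN.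
have grpos y : y0 <= y -> d0 <= gr y by move=> yy; rewrite lerNr gneg// lerN2.
have grneg y : y <= - y0 -> gr y <= - d0 by move=> yy; rewrite lerN2 gpos// lerNr.
have [r2 r20 H2] := landesman_lazer mOm Om_fin cgr grM d0_gt0 y0_ge0 rho0 grpos grneg (e_h10 k) ek1.
exists (Num.max r1 r2) => [|xi U]; first by rewrite lt_max r10.
rewrite ge_max => /andP[x1 x2] U2 Ur; split; first exact: H1.
have UN2 := L2N measurableT U2.
have := H2 xi (- U) x2 UN2; rewrite (L2_normN measurableT U2) => /(_ Ur).
have u2 := L2D measurableT (L2Z measurableT (- xi) (e2 k)) U2.
have g2 := superpos_L2 mOm Om_fin cg gM (L2m u2).
have -> : superpos Om gr (xi *: e k - U) = - G (- xi *: e k + U).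
  apply/funext => x; have -> : (- G (- xi *: e k + U)) x = - G (- xi *: e k + U) x by [].
  have [Ox|Ox] := pselect (Om x); last first.
    by rewrite (superpos_off gr _ Ox) (superpos_off g _ Ox) oppr0.
  rewrite /superpos !zextT//= /gr; congr (- g _).
  have -> : (xi *: e k - U) x = xi * e k x - U x by [].
  have -> : (- xi *: e k + U) x = - xi * e k x + U x by [].
  by rewrite opprB mulNr addrC.
by rewrite (L2_innerNl measurableT g2 (e2 k)) oppr_gt0.
Qed.

(** On the faces of a direction j != k, |gap j * c j| is B + 1 and outweighs the residual. On the
    faces of direction k the linear term is 0 and the sign comes from [landesman_lazer2]; its radius
    rk is chosen after rho, which bounds the other components. *)
Lemma galerkin_dim N : (k <= N)%N -> exists c, forall j, (j <= N)%N ->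
  gap j * c j + << G (S c N.+1) - f, e j >> = 0.
Proof.
move=> kN; have B0 := galerkin_bound_ge0.
(* For j = k this is a division by 0 with value 0, so that r0 k adds nothing to rho. *)
pose r0 j : R := (B + 1) / `|gap j|.
have r00 j : 0 <= r0 j by rewrite divr_ge0// addr_ge0.
pose rho := \sum_(j < N.+1) r0 j.
have rho0 : 0 <= rho by exact: sumr_ge0.
have [rk rk0 LL] := landesman_lazer2 rho0.
pose r (i : 'I_N.+1) := if i == k :> nat then rk else r0 i.
pose coef (x : 'rV[R]_N.+1) (j : nat) : R := x ord0 (inord j).
have coefE x (i : 'I_N.+1) : coef x i = x ord0 i by rewrite /coef inord_val.
(* These signs orient the equations so that F is negative on left faces and positive on right
   ones. *)
pose s j : R := if j == k then 1 else Num.sg (gap j).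
have s0 j : s j != 0.
  rewrite /s; case: (boolP (j == k)) => jk; first by rewrite oner_eq0.
  by have := gap_neq0 jk; rewrite normr_gt0 sgr_eq0.
pose F (x : 'rV[R]_N.+1) (i : 'I_N.+1) : R :=
  s i * (gap i * x ord0 i + << G (S (coef x) N.+1) - f, e i >>).
have rpos i : 0 < r i.
  rewrite /r; case: eqVneq => // /gap_neq0 gi.
  by rewrite divr_gt0// ltr_wpDl.
have small (x : 'rV[R]_N.+1) : (forall i, - r i <= x ord0 i <= r i) ->
    `N (S (fun j => if j == k then 0 else coef x j) N.+1) <= rho.
  move=> xr; apply: le_trans (norm_basis_sum_le _ _) _; apply: ler_sum => i _.
  have := xr i; rewrite -ler_norml /r; case: eqVneq => _; first by rewrite normr0.
  by rewrite coefE.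
have side (x : 'rV[R]_N.+1) (i : 'I_N.+1) t : (forall i, - r i <= x ord0 i <= r i) -> i != k :> nat ->
    x ord0 i = t * r i -> `|t| = 1 -> F x i = (B + 1) * t + s i * << G (S (coef x) N.+1) - f, e i >>.
  move=> xr ik xi t1; rewrite /F mulrDr; congr (_ + _).
  have := gap_neq0 ik; rewrite normr_gt0 => g0.
  rewrite xi /r /s (negbTE ik) /r0 mulrA -normrEsg; field.
  by rewrite normr_eq0.
have [|||x xr xF] := @poincare_miranda R N F r rpos.
- move=> i x; apply: sequentially_continuous => y yx; rewrite /F.
  have cy j : (fun n => coef (y n) j) @ \oo --> coef x j.
    apply/cvgrPdist_lt => eps eps0; have := near_infty_natSinv_lt (PosNum eps0).
    apply: filterS => n /=; apply: le_lt_trans.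
    by have /ball_rV[_ /(_ (inord j))] := yx n; exact: ltW.
  apply: cvgM; first exact: cvg_cst.
  apply: cvgD.
    by apply: cvgM; [exact: cvg_cst|rewrite -coefE; under eq_fun do rewrite -coefE; exact: cy].
  have gS u : L2 setT u -> << G u - f, e i >> = << G u, e i >> - << f, e i >>.
    move=> u2; have g2 := superpos_L2 mOm Om_fin cg gM (L2m u2).
    exact: (L2_innerBl measurableT g2 f2 (e2 i)).
  rewrite gS//; under eq_fun do rewrite gS//.
  apply: cvgB; last exact: cvg_cst.
  apply: (superpos_cvg mOm Om_fin cg gM) => //.
    by move=> n; exact: L2m.
    exact: L2m.
  apply: aeW => z _; rewrite basis_sumE; under eq_fun do rewrite basis_sumE.
  by apply: (@cvg_sum_ord R N.+1 (fun n i => coef (y n) i * e i z) (fun i => coef x i * e i z)) => j;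
    apply: cvgM; [exact: cy|exact: cvg_cst].
- move=> x i xr xi; have [ik|ik] := eqVneq (i : nat) k.
    rewrite /F /s ik eqxx subrr mul0r add0r mul1r residual_k// (basis_sum_pick (coef x) (kN : (k < N.+1)%N)).
    have -> : coef x k = - rk by rewrite -ik coefE xi /r ik eqxx.
    by apply: (LL rk _ (lexx _) _ (small x xr)).2; exact: S2.
  rewrite (side x i (-1) xr ik) ?mulN1r ?normrN1//.
  have := residual_le i (S2 (coef x) N.+1).
  rewrite /s (negbTE ik); move: (<< _, _ >>) => y yB.
  have : `|Num.sg (gap i) * y| <= B by rewrite normrM normr_sg subr_eq0 eq_sym lam_simple// mul1r.
  by move=> /(le_trans (ler_norm _)); rewrite mulrN1; lra.
- move=> x i xr xi; have [ik|ik] := eqVneq (i : nat) k.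
    rewrite /F /s ik eqxx subrr mul0r add0r mul1r residual_k// (basis_sum_pick (coef x) (kN : (k < N.+1)%N)).
    have -> : coef x k = rk by rewrite -ik coefE xi /r ik eqxx.
    by apply: (LL rk _ (lexx _) _ (small x xr)).1; exact: S2.
  rewrite (side x i 1 xr ik) ?mul1r ?normr1//.
  have := residual_le i (S2 (coef x) N.+1).
  rewrite /s (negbTE ik); move: (<< _, _ >>) => y yB.
  have : `|Num.sg (gap i) * y| <= B by rewrite normrM normr_sg subr_eq0 eq_sym lam_simple// mul1r.
  by rewrite -normrN => /(le_trans (ler_norm _)); rewrite mulr1; lra.
exists (coef x) => j jN; have jN' : (j < N.+1)%N by [].
have := xF (Ordinal jN'); rewrite /F => /eqP; rewrite mulf_eq0 (negbTE (s0 _)) /= => /eqP.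
by rewrite -coefE.
Qed.

(** The coefficients form a full sequence, padded with zeros, so that solutions for different N can
    be compared coordinate by coordinate. *)
Definition galerkin_solution c N : Prop :=
  (forall j, (j <= N)%N -> gap j * c j + << G (S c N.+1) - f, e j >> = 0) /\
  (forall j, (N < j)%N -> c j = 0).

Lemma exists_galerkin_solution N : (k <= N)%N -> exists c, galerkin_solution c N.
Proof.
move=> /galerkin_dim[c cP]; exists (fun j => if (j <= N)%N then c j else 0); split.
  move=> j jN; rewrite jN -(cP j jN); congr (_ + << G _ - f, _ >>).
  by apply: eq_basis_sum => i; rewrite ltnS => ->.
by move=> j; rewrite ltnNge => /negbTE ->.
Qed.

(** The equations say that gap j * c j is minus the j-th coefficient of the residual, to which
    Bessel's inequality applies. *)
Lemma galerkin_energy c N n : galerkin_solution c N ->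
  \sum_(j < n) (gap j * c j) ^+ 2 <= B ^+ 2.
Proof.
move=> [cN c0]; pose h := G (S c N.+1) - f; have h2 : L2 setT h by exact: Gf2.
apply: le_trans (_ : \sum_(j < n) << h, e j >> ^+ 2 <= _).
  apply: ler_sum => j _; have [jN|jN] := leqP j N; last by rewrite c0// mulr0 expr0n sqr_ge0.
  by have /eqP := cN j jN; rewrite addr_eq0 => /eqP ->; rewrite sqrrN.
apply: le_trans (bessel n h2) _.
by rewrite ler_sqr ?nnegrE ?L2_norm_ge0 ?galerkin_bound_ge0//; exact: norm_residual.
Qed.

(** The bound is the same for all N; this makes the family of approximations precompact in L^2 once
    the coefficients are bounded. *)
Lemma galerkin_tail c N A p q : galerkin_solution c N -> 0 < A ->
  (forall j, (q <= j)%N -> A <= `|gap j|) -> (q <= p)%N ->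
  `N (S c p - S c q) <= B / A.
Proof.
move=> cN A0 hA qp.
have BA0 : 0 <= B / A by rewrite divr_ge0 ?galerkin_bound_ge0// ltW.
rewrite -ler_sqr ?nnegrE ?L2_norm_ge0// (sqr_norm_basis_sumB e_h10 e_orthonormal _ qp).
rewrite expr_div_n ler_pdivlMr ?exprn_gt0//.
apply: le_trans (galerkin_energy p cN).
have : 0 <= \sum_(j < q) (gap j * c j) ^+ 2 by apply: sumr_ge0 => j _; exact: sqr_ge0.
suff : (\sum_(i < p) c i ^+ 2 - \sum_(i < q) c i ^+ 2) * A ^+ 2 <=
   \sum_(j < p) (gap j * c j) ^+ 2 - \sum_(j < q) (gap j * c j) ^+ 2.
  by move: (\sum_(j < q) (gap j * c j) ^+ 2) => x; lra.
rewrite -(subnKC qp); elim: (p - q)%N => [|t IH]; first by rewrite addn0 !subrr mul0r.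
rewrite addnS !big_ord_recr /=; set j := (q + t)%N in IH *.
have : c j ^+ 2 * A ^+ 2 <= (gap j * c j) ^+ 2.
  rewrite exprMn mulrC ler_wpM2r ?sqr_ge0// -[leRHS]real_normK ?num_real//.
  by rewrite ler_sqr ?nnegrE ?(ltW A0)// hA// leq_addr.
move: IH; move: (gap j * c j) (\sum_(_ < j) c _ ^+ 2) (\sum_(_ < q) c _ ^+ 2).
move: (\sum_(_ < j) (gap _ * c _) ^+ 2) (\sum_(_ < q) (gap _ * c _) ^+ 2) (c j ^+ 2) (A ^+ 2).
by move=> x1 x2 x3 x4 x5 x6 x7; lra.
Qed.

(** The energy bounds the components other than k by B / delta. The k-th equation reads <g(u), e k>
    = 0, which [landesman_lazer2] excludes when |c k| > r. *)
Lemma galerkin_coord_bound : exists b, forall c N, (k <= N)%N -> galerkin_solution c N ->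
  (forall j, `|c j| <= b) /\ forall n, \sum_(j < n) c j ^+ 2 <= b.
Proof.
have [delta delta0 dP] := gap_lower.
have Bd0 : 0 <= B / delta by rewrite divr_ge0 ?galerkin_bound_ge0// ltW.
have [r r0 LL] := landesman_lazer2 Bd0.
have b0 : 0 <= r + B / delta by rewrite addr_ge0// ltW.
(* The first part, r + B / delta, bounds the coordinates, the square bounds the sums of squares, and
   one constant covers both. *)
exists (r + B / delta + (r + B / delta) ^+ 2) => c N kN cN.
pose c' j := if j == k then 0 else c j.
have c'n n : \sum_(j < n) c' j ^+ 2 <= (B / delta) ^+ 2.
  rewrite expr_div_n ler_pdivlMr ?exprn_gt0//.
  apply: le_trans (galerkin_energy n cN); rewrite mulr_suml; apply: ler_sum => j _.
  rewrite /c'; case: eqVneq => [_|jk]; first by rewrite expr0n mul0r sqr_ge0.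
  rewrite exprMn mulrC ler_wpM2r ?sqr_ge0// -[leRHS]real_normK ?num_real//.
  by rewrite ler_sqr ?nnegrE ?(ltW delta0)// dP.
have U2 := S2 c' N.+1.
have UB : `N (S c' N.+1) <= B / delta.
  rewrite -ler_sqr ?nnegrE ?L2_norm_ge0//.
  by rewrite (sqr_norm_basis_sum e_h10 e_orthonormal).
have ckr : `|c k| <= r.
  have := cN.1 k kN; rewrite subrr mul0r add0r (residual_k (S2 _ _)).
  rewrite (basis_sum_pick _ (kN : (k < N.+1)%N)) -/c' => ek.
  rewrite leNgt; apply/negP => rc.
  have [ck|ck] := leP 0 (c k).
    have rc' : r <= c k by apply: ltW; move: rc; rewrite ger0_norm.
    by have [+ _] := LL (c k) _ rc' U2 UB; rewrite ek ltxx.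
  have rc' : r <= - c k by apply: ltW; move: rc; rewrite ltr0_norm.
  by have [_ +] := LL (- c k) _ rc' U2 UB; rewrite opprK ek ltxx.
have sq n : \sum_(j < n) c j ^+ 2 <= (r + B / delta) ^+ 2.
  apply: (@le_trans _ _ (r ^+ 2 + (B / delta) ^+ 2)); last first.
    by rewrite sqrrD; have := mulr_ge0 (ltW r0) Bd0; lra.
  apply: (@le_trans _ _ (\sum_(j < n) (if j == k :> nat then c k ^+ 2 else 0) + \sum_(j < n) c' j ^+ 2)).
    rewrite -big_split /=; apply: ler_sum => j _; rewrite /c'; case: eqVneq => [->|_].
      by rewrite expr0n addr0.
    by rewrite add0r.
  apply: lerD => //; apply: (@le_trans _ _ (c k ^+ 2)); last first.
    by rewrite -[leLHS]real_normK ?num_real// ler_sqr ?nnegrE// ltW.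
  have [kn|kn] := ltnP k n.
    rewrite (bigD1 (Ordinal kn))//= eqxx big1 ?addr0// => i.
    by rewrite -val_eqE /= => /negbTE ->.
  rewrite big1 ?sqr_ge0// => i _; case: eqP => // ik.
  by have := ltn_ord i; rewrite ik ltnNge kn.
split=> [j|n]; last by rewrite (le_trans (sq n))// lerDr.
apply: (@le_trans _ _ (r + B / delta)); last by rewrite lerDl sqr_ge0.
rewrite -ler_sqr ?nnegrE// real_normK ?num_real//; apply: le_trans (sq j.+1).
by rewrite big_ord_recr /= lerDr sumr_ge0// => i _; exact: sqr_ge0.
Qed.

(** g is nonlinear, so the limit is taken along a subsequence that converges almost everywhere as
    well as in L^2. *)
Theorem galerkin_limit : exists u, [/\ L2 setT u, vanishes_off Om u &
  forall j, gap j * << u, e j >> + << G u - f, e j >> = 0].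
Proof.
have /choice[c cP] N := exists_galerkin_solution (leq_addr N k).
have [b bP] := galerkin_coord_bound.
have cb N j : `|c N j| <= b by have [+ _] := bP _ _ (leq_addr N k) (cP N); exact.
have cs N n : \sum_(j < n) c N j ^+ 2 <= b by have [_] := bP _ _ (leq_addr N k) (cP N).
have [z zP] := coordinatewise_cluster cb.
(* From z^2 <= 2 c^2 + 2 (c - z)^2, with an N for which the n squares (c - z)^2 are at most 1/(n+1)
   each. *)
have zs n : \sum_(j < n) z j ^+ 2 <= 2 * b + 2.
  have n0 : 0 < n.+1%:R^-1 :> R by rewrite invr_gt0.
  have [N [_ HN]] := zP n n.+1%:R^-1 0%N n0.
  have h1 (j : 'I_n) : z j ^+ 2 <= 2 * c N j ^+ 2 + 2 * n.+1%:R^-1.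
    have zj : (c N j - z j) ^+ 2 <= n.+1%:R^-1.
      rewrite -real_normK ?num_real// (le_trans (_ : _ <= n.+1%:R^-1 ^+ 2))//.
        by rewrite ler_sqr ?nnegrE ?(ltW n0)// HN.
      by rewrite expr2 ger_pMl// invf_le1// ler1n.
    have : 0 <= (c N j + (c N j - z j)) ^+ 2 by exact: sqr_ge0.
    by move: zj; move: (c N j) (z j) (n.+1%:R^-1) => x y t; nra.
  apply: le_trans (ler_sum _ (fun j _ => h1 j)) _; rewrite big_split /= -mulr_sumr.
  apply: lerD; first by rewrite ler_wpM2l ?cs.
  rewrite sumr_const card_ord -mulrnAr -[leRHS]mulr1 ler_wpM2l// -mulr_natl.
  by rewrite ler_pdivrMr ?ltr0n// mul1r ler_nat leqnSn.
have [v [v2 v0 vP]] := riesz_fischer_basis mOm Om_fin e_off e_h10 e_orthonormal zs.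
pose x N := S (c N) (k + N).+1.
have x2 N : L2 setT (x N) by exact: S2.
(* Three errors of eta / 3: the tail of [x N] beyond J, the first J coefficients, and the tail of
   v. *)
have close eta N0 : 0 < eta -> exists2 N, (N0 <= N)%N & `N (x N - v) <= eta.
  move=> eta0; have e3 : 0 < eta / 3 by rewrite divr_gt0.
  have B1 : 0 < B + 1 by rewrite ltr_wpDl ?galerkin_bound_ge0.
  pose A := (B + 1) / (eta / 3); have A0 : 0 < A by rewrite divr_gt0.
  have BA : B / A <= eta / 3.
    rewrite /A invf_div mulrA ler_pdivrMr// mulrC ler_wpM2l ?(ltW e3)//.
    by rewrite lerDl.
  have [J1 H1] := gap_large A; have [J2 H2] := vP _ e3.
  pose J := maxn J1 J2.
  have J0 : 0 < J.+1%:R :> R by rewrite ltr0n.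
  have [N [NN HN]] := zP J (eta / 3 / J.+1%:R) (maxn N0 J) (divr_gt0 e3 J0).
  have JN : (J <= (k + N).+1)%N.
    by rewrite leqW// (leq_trans _ (leq_addl _ _))// (leq_trans _ NN)// leq_maxr.
  exists N; first by rewrite (leq_trans _ NN)// leq_maxl.
  have b1 : `N (x N - S (c N) J) <= eta / 3.
    apply: le_trans (galerkin_tail (cP N) A0 _ JN) BA => j Jj.
    by apply: H1; rewrite (leq_trans _ Jj)// leq_maxl.
  have b2 : `N (S (c N) J - S z J) <= eta / 3.
    rewrite basis_sumB; apply: le_trans (norm_basis_sum_le _ _) _.
    apply: (@le_trans _ _ (\sum_(j < J) (eta / 3 / J.+1%:R))).
      by apply: ler_sum => j _; exact: HN.
    rewrite sumr_const card_ord -[leLHS]mulr_natl mulrCA -[leRHS]mulr1.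
    by rewrite ler_wpM2l ?(ltW e3)// ler_pdivrMr// mul1r ler_nat.
  have b3 : `N (S z J - v) <= eta / 3 by apply: H2; rewrite leq_maxr.
  apply: le_trans (ler_L2_norm_dist measurableT (x2 N) (S2 (c N) J) v2) _.
  apply: le_trans (lerD b1 (ler_L2_norm_dist measurableT (S2 (c N) J) (S2 z J) v2)) _.
  by move: b2 b3; move: (`N _) (`N _) => s t; lra.
(* The factor 1/4 brings consecutive terms of the subsequence within 2^-p of each other, as
   [riesz_fischer] requires. *)
have h0 p : 0 < 2^-1 ^+ p / 4 :> R by rewrite divr_gt0// exprn_gt0.
have /choice[Np NpP] p : exists N, (p <= N)%N /\ `N (x N - v) <= 2^-1 ^+ p / 4.
  by have [N ? ?] := close _ p (h0 p); exists N.
pose y p := x (Np p).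
have y2 p : L2 setT (y p) by exact: x2.
have y0' p : vanishes_off Om (y p) by exact: basis_sum_off.
have dy p : L2_norm Om (y p.+1 - y p) <= 2^-1 ^+ p.
  rewrite L2_norm_vanish; last exact: vanishes_offB.
  apply: le_trans (ler_L2_norm_dist measurableT (y2 p.+1) v2 (y2 p)) _.
  rewrite (L2_norm_distC measurableT v2 (y2 p)).
  have := (NpP p).2; have := (NpP p.+1).2; rewrite -/(y p) -/(y p.+1) exprS.
  have := h0 p; move: (`N _) (`N _) (2^-1 ^+ p) => s t q; lra.
have [u [u2 yu uN]] := riesz_fischer mOm Om_fin (fun p => L2_restrict mOm (y2 p)) dy.
pose U := zext Om u.
have U2 : L2 setT U by exact: L2_zext.
have U0 : vanishes_off Om U by exact: zext_off.
exists U; split => // j.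
have yUae : {ae mu, forall x, Om x -> (fun p => y p x) @ \oo --> U x}.
  by apply: filterS yu => t yt Ot; rewrite /U zextT//; exact: yt.
have yUN p : `N (y p - U) <= 2 * 2^-1 ^+ p.
  by have := uN p; rewrite L2_norm_zext zextB (zext_id (y0' p)).
have c1 : (fun p => << y p, e j >>) @ \oo --> << U, e j >>.
  apply/cvgrPdist_le => eps eps0.
  have [p0 p0e] := exists_half_pow_le (divr_gt0 eps0 (ltr0Sn R 1)).
  exists p0 => // p /= pp; rewrite distrC -(L2_innerBl measurableT (y2 p) U2 (e2 j)).
  have d2 := L2B measurableT (y2 p) U2.
  apply: le_trans (cauchy_schwarz measurableT d2 (e2 j)) _; rewrite norm_e mulr1.
  apply: le_trans (yUN p) _; rewrite -ler_pdivlMl//.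
  have : 2^-1 ^+ p <= 2^-1 ^+ p0 :> R by rewrite ler_wiXn2l ?invr_ge0 ?invf_le1 ?ler1n.
  by move: p0e; rewrite [2^-1 * eps]mulrC; move: (2^-1 ^+ p) (2^-1 ^+ p0) => s t; lra.
have gS (q : fn) : L2 setT q -> << G q - f, e j >> = << G q, e j >> - << f, e j >>.
  move=> q2; have g2 := superpos_L2 mOm Om_fin cg gM (L2m q2).
  exact: (L2_innerBl measurableT g2 f2 (e2 j)).
have c2 : (fun p => << G (y p) - f, e j >>) @ \oo --> << G U - f, e j >>.
  rewrite gS//; under eq_fun do rewrite gS//.
  apply: cvgB; last exact: cvg_cst.
  by apply: (superpos_cvg mOm Om_fin cg gM) => // [p|]; exact: L2m.
have c3 : (fun p => gap j * << y p, e j >> + << G (y p) - f, e j >>) @ \oo -->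
    gap j * << U, e j >> + << G U - f, e j >>.
  by apply: cvgD => //; apply: cvgM => //; exact: cvg_cst.
(* For p >= j the dimension is large enough for the j-th equation to hold exactly, so the sequence
   is eventually 0. *)
apply: (cvg_unique _ c3) => //; apply: cvg_near_cst; exists j => // p /= jp.
have jN : (j <= k + Np p)%N by rewrite (leq_trans jp)// (leq_trans (NpP p).1)// leq_addl.
have := (cP (Np p)).1 j jN; rewrite -/(x (Np p)) -/(y p) => <-; congr (_ * _ + _).
by rewrite /y /x (basis_sum_coord e_h10 e_orthonormal) ltnS jN.
Qed.

End galerkin.

Transparent L2 partial L2_norm L2_inner.

(** * Passage between the two formulations of the boundary value problem *)

Section weak_formulation.
Context {R : realType} {m : nat} (Om : set 'rV[R]_m).
Hypothesis mOm : measurable Om.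
Local Notation fn := ('rV[R]_m -> R).
Local Notation mu := (@rV_lebesgue R m).
Implicit Types (u v f chi : fn) (l : 'I_m).
Local Notation "`N u" := (L2_norm setT u) (at level 9).
Local Notation "<< u , v >>" := (L2_inner setT u v).

Lemma integral_sqrD u (v : 'I_m -> fn) : L2 Om u -> (forall l, L2 Om (v l)) ->
  (\int[mu]_(x in Om) (u x ^+ 2 + \sum_(l < m) v l x ^+ 2)%:E =
   (L2_norm Om u ^+ 2 + \sum_(l < m) L2_norm Om (v l) ^+ 2)%:E)%E.
Proof.
move=> u2 v2.
under eq_integral do rewrite EFinD -sumEFin.
rewrite ge0_integralD//=.
- rewrite ge0_integral_sum//.
  + rewrite EFinD -sumEFin L2_innerE// sqr_L2_norm; congr (_ + _)%E.
    by apply: eq_bigr => l _; rewrite L2_innerE// sqr_L2_norm.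
  + by move=> l; exact: measurable_sqr (v2 l).1.
  + by move=> l x _; rewrite lee_fin sqr_ge0.
- by move=> x _; rewrite lee_fin sqr_ge0.
- exact: measurable_sqr u2.1.
- by move=> x _; apply: sume_ge0 => l _; rewrite lee_fin sqr_ge0.
- by apply: emeasurable_sum => l; exact: measurable_sqr (v2 l).1.
Qed.

Lemma norm_sub_test chi u : test_function Om chi -> `N (chi - zext Om u) = L2_norm Om (chi - u).
Proof. by move=> tc; rewrite [RHS]L2_norm_zext zextB (test_zext tc). Qed.

(** Both derivatives are moved to chi and back: <Du l, d_l chi> = - <u, d_l d_l chi> = - <v l, chi>,
    and the sum of the v l is - lam u almost everywhere. *)
Lemma eigenfunction_h10 lam u : dirichlet_solution Om (fun y => lam * y) (cst 0) u ->
  exists w, [/\ forall l, vanishes_off Om (w l), h10 Om (zext Om u) w &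
    weak_poisson Om w (lam *: zext Om u)].
Proof.
move=> [[u2 _] [_ [Du [DuP Dud]]] [wl [[v [vP vE]] wlE]]].
have D2 l : L2 Om (Du l) by have [] := DuP l.
have h : h10 Om (zext Om u) (fun l => zext Om (Du l)).
  split=> [|l|e e0]; [exact: L2_zext|exact: L2_zext|].
  have [psi [tp pe]] := Dud (e ^+ 2) (exprn_gt0 2 e0); exists psi.
  have p2 := L2_restrict mOm (test_L2 tp).
  have dp2 l := L2_restrict mOm (test_L2 (test_partial l tp)).
  have d2 := L2B mOm u2 p2; have dd2 l := L2B mOm (D2 l) (dp2 l).
  move: pe; rewrite (@integral_sqrD (u - psi) (fun l => Du l - partial l psi))// lte_fin => pe.
  have s0 : 0 <= \sum_(l < m) L2_norm Om (Du l - partial l psi) ^+ 2.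
    by apply: sumr_ge0 => l _; exact: sqr_ge0.
  split => // [|l].
    rewrite norm_sub_test// (L2_norm_distC mOm p2 u2).
    rewrite -ler_sqr ?nnegrE ?L2_norm_ge0 ?(ltW e0)//.
    by move: pe s0; move: (_ ^+ 2) (\sum_(_ < _) _) (e ^+ 2) => x y z; lra.
  rewrite (norm_sub_test _ (test_partial l tp)) (L2_norm_distC mOm (dp2 l) (D2 l)).
  rewrite -ler_sqr ?nnegrE ?L2_norm_ge0 ?(ltW e0)//.
  apply: le_trans (ltW pe); rewrite (bigD1 l)//=.
  rewrite addrCA lerDl addr_ge0 ?sqr_ge0// sumr_ge0// => l' _; exact: sqr_ge0.
exists (fun l => zext Om (Du l)); split => // [l|chi tc]; first exact: zext_off.
have v2 l : L2 Om (v l) by have [] := vP l.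
have c2 := L2_restrict mOm (test_L2 tc).
have cT : test_function setT chi by exact: test_function_mono tc.
have -> : \sum_l << zext Om (Du l), partial l chi >> = \sum_l - L2_inner Om (v l) chi.
  apply: eq_bigr => l _.
  rewrite (h10_parts l h (test_partial l cT)) -L2_inner_zext; congr (- _).
  by have [_ /(_ chi tc)] := vP l; rewrite /= sqrrN expr1n mul1r.
rewrite sumrN -(L2_inner_suml mOm (F := v) _ _ c2)//.
have u2' : L2 setT (zext Om u) by exact: L2_zext.
rewrite (L2_innerZl measurableT lam u2' (test_L2 tc)) -L2_inner_zext.
rewrite -(L2_innerZl mOm lam u2 c2) -(L2_innerNl mOm _ c2); last by apply: L2_sum.
apply: ae_eq_L2_inner => //; first by apply: L2N => //; exact: L2_sum.
  exact: L2Z.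
apply: filterS wlE => x + Ox => /(_ Ox); rewrite vE /= => /eqP.
have -> : (- \sum_l v l) x = - \sum_l v l x.
  by rewrite [LHS]/(- _); congr (- _); elim/big_ind2 : _ => // a b c d <- <-.
by rewrite addr_eq0 => /eqP ->; rewrite opprK.
Qed.

Lemma dirichlet_solution_of_h10 u w (D2 : 'I_m -> 'I_m -> fn) (P : R -> R) f :
  L2 setT u -> vanishes_off Om u -> h10 Om u w ->
  (forall l, vanishes_off Om (w l)) ->
  (forall a b, L2 setT (D2 a b) /\ forall chi, test_function Om chi ->
     L2_inner Om u (partial a (partial b chi)) = L2_inner Om (D2 a b) chi) ->
  {ae mu, forall x, Om x -> \sum_a D2 a a x + P (u x) = f x} ->
  dirichlet_solution Om P f u.
Proof.
move=> u2 u0 h w0 D2P ae.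
have [_ w2 hd] := h; have u2' := L2_restrict mOm u2.
have w2' l := L2_restrict mOm (w2 l).
have wp l : weak_partials Om [:: l] u (w l).
  move=> chi tc; have cT : test_function setT chi by exact: test_function_mono tc.
  rewrite /= expr1 mulN1r; have := h10_parts l h cT.
  have -> : << w l, chi >> = L2_inner Om (w l) chi.
    by symmetry; apply: L2_inner_vanish; exact: w0.
  have -> : << u, partial l chi >> = L2_inner Om u (partial l chi).
    by symmetry; exact: L2_inner_vanish.
  by rewrite /L2_inner => ->; rewrite opprK.
have wpp a b : weak_partials Om [:: a; b] u (D2 a b).
  by move=> chi tc; rewrite /= sqrrN expr1n mul1r; exact: (D2P a b).2.
have sob2 : sobolev Om 2 u.
  split => // -[|a [|b [|//]]] _.
  - by exists u; split => // chi _; rewrite /= expr0 mul1r.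
  - by exists (w a).
  - by exists (D2 a b); split => //; apply: L2_restrict => //; exact: (D2P a b).1.
split => //.
- split; first by have [_ sob] := sob2; split => // s s1; apply: sob; exact: leqW.
  exists w; split => // eps eps0.
  (* Each of the M = m + 1 squares is at most d^2 <= d <= eps / (M + 1), because d <= 1; their sum
     is then strictly below eps. *)
  pose M : R := m.+1%:R; have M0 : 0 < M by rewrite ltr0n.
  have d0 : 0 < Num.min 1 (eps / (M + 1)) by rewrite lt_min ltr01 divr_gt0// addr_gt0.
  set d := Num.min _ _ in d0.
  have [psi [tp pu pw]] := hd d d0; exists psi; split => //.
  have p2 := L2_restrict mOm (test_L2 tp).
  have dp2 l := L2_restrict mOm (test_L2 (test_partial l tp)).
  have d2 := L2B mOm u2' p2; have dd2 l := L2B mOm (w2' l) (dp2 l).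
  rewrite (@integral_sqrD (u - psi) (fun l => w l - partial l psi))// lte_fin.
  have dd : d ^+ 2 <= eps / (M + 1).
    rewrite expr2 (le_trans (_ : _ <= 1 * d))//; last by rewrite mul1r ge_min lexx orbT.
    by rewrite ler_wpM2r ?(ltW d0)// ge_min lexx.
  have b v : L2_norm Om v <= d -> L2_norm Om v ^+ 2 <= eps / (M + 1).
    by move=> vd; apply: le_trans dd; rewrite ler_sqr ?nnegrE ?L2_norm_ge0 ?(ltW d0).
  apply: (@le_lt_trans _ _ (eps / (M + 1) + \sum_(l < m) eps / (M + 1))).
    apply: lerD.
      by apply: b; rewrite (L2_norm_distC mOm u2' p2) -norm_sub_test// (zext_id u0).
    apply: ler_sum => l _; apply: b; rewrite (L2_norm_distC mOm (w2' l) (dp2 l)).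
    by rewrite -(norm_sub_test _ (test_partial l tp)) (zext_id (w0 l)).
  rewrite sumr_const card_ord -mulrS -[ltLHS]mulr_natl -/M mulrA ltr_pdivrMr ?addr_gt0//.
  by rewrite mulrC ltr_pM2l// ltrDl.
- exists (fun x => \sum_a D2 a a x); split => //.
  exists (fun a => D2 a a); split => // a; split; last exact: wpp.
  by apply: L2_restrict => //; exact: (D2P a a).1.
Qed.

End weak_formulation.

(** * Construction of the solution *)

Theorem theorem5p1 (R : realType) (m : nat) (Omega : set 'rV[R]_m)
    (lam : nat -> R) (phi : nat -> 'rV[R]_m -> R) (k : nat)
    (g : R -> R) (f : 'rV[R]_m -> R)
    (hm : (0 < m)%N)
    (hOmega : smooth_bounded_domain Omega)
    (hspec : dirichlet_eigenbasis Omega lam phi)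
    (hsimple : simple_eigenvalue Omega (lam k))
    (hgC1 : C1 g)
    (hgbounded : exists M : R, forall y, `|g y| <= M)
    (hgsign : forall y : R, y != 0 -> 0 < y * g y)
    (hgderiv : exists2 c0 : R, 0 < c0 & forall y : R, derive1 g y <= c0)
    (hgpos : (0 < limf_einf (fun y => (g y)%:E) (pinfty_nbhs R))%E)
    (hgneg : (limf_esup (fun y => (g y)%:E) (ninfty_nbhs R) < 0)%E)
    (hf : L2 Omega f)
    (hforth : L2_inner Omega f (phi k) = 0) :
  exists u : 'rV[R]_m -> R,
    dirichlet_solution Omega (fun y => lam k * y + g y) f u.
Proof.
have [oO _ _ bO _] := hOmega.
have mO : measurable Omega by exact: open_measurable_rV.
have Ofin : (rV_lebesgue m Omega < +oo)%E.
  have [rho _ Or] := bounded_set_cbox bO.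
  apply: le_lt_trans (cbox_fin rho); apply: le_measure => //; rewrite inE//.
  exact: measurable_cbox.
have [_ _ lam_oo eig [phi2 phi_on phi_complete]] := hspec.
pose e i := zext Omega (phi i).
have e_off i : vanishes_off Omega (e i) by exact: zext_off.
have /choice[w wP] i := eigenfunction_h10 mO (eig i).1.
have w_off i l : vanishes_off Omega (w i l) by have [+ _ _] := wP i; exact.
have e_h10 i : h10 Omega (e i) (w i) by have [_ + _] := wP i.
have e_weak i : weak_poisson Omega (w i) (lam i *: e i) by have [_ _] := wP i.
have inner_e v i : vanishes_off Omega v -> L2_inner setT v (e i) = L2_inner Omega v (phi i).
  move=> v0; rewrite L2_innerC -L2_inner_zext L2_innerC.
  by [].
have e_on i j : L2_inner setT (e i) (e j) = (i == j)%:R.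
  rewrite inner_e// -phi_on; apply: eq_L2_inner => x Ox.
  by rewrite /e zextT.
have e_complete v : L2 setT v -> vanishes_off Omega v -> forall eps, 0 < eps ->
    exists N, forall n, (N <= n)%N ->
    L2_norm setT (v - \sum_(i < n) L2_inner setT v (e i) *: e i) <= eps.
  move=> v2 v0 eps eps0; have v2' := L2_restrict mO v2.
  have cv := phi_complete v v2'.
  pose S n := \sum_(i < n) L2_inner setT v (e i) *: e i.
  have S2 n : L2 setT (S n) by exact: (basis_sum_L2 e_h10 (fun i => L2_inner setT v (e i)) n).
  have vS2 n := L2_restrict mO (L2B measurableT v2 (S2 n)).
  have vSE n : (\int[rV_lebesgue m]_(x in Omega)
      ((v x - \sum_(i < n) L2_inner Omega v (phi i) * phi i x) ^+ 2)%:E =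
      (L2_norm setT (v - S n) ^+ 2)%:E)%E.
    rewrite -(L2_norm_vanish (Om := Omega)); last first.
      apply: vanishes_offB => //; apply: vanishes_off_sum => i _.
      by apply: vanishes_offZ; exact: e_off.
    rewrite sqr_L2_norm -L2_innerE//; apply: eq_integral => x; rewrite inE => Ox.
    have -> : (v - S n) x = v x - S n x by [].
    have -> : S n x = \sum_(i < n) L2_inner setT v (e i) * e i x.
      exact: (basis_sumE e (fun i => L2_inner setT v (e i)) n x).
    congr ((_ - _) ^+ 2)%:E; apply: eq_bigr => i _.
    by rewrite inner_e// /e zextT.
  have {}cv : (fun n => L2_norm setT (v - S n) ^+ 2) @ \oo --> 0.
    have : (fun n => (L2_norm setT (v - S n) ^+ 2)%:E) @ \oo --> 0%E.
      by under eq_fun do rewrite -vSE.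
    exact: fine_cvg.
  have /cvgrPdist_le/(_ (eps ^+ 2) (exprn_gt0 2 eps0))[N _ HN] := cv.
  exists N => n Nn; have := HN n Nn; rewrite /= sub0r normrN ger0_norm ?sqr_ge0//.
  by rewrite ler_sqr ?nnegrE ?L2_norm_ge0 ?(ltW eps0).
have lam_infty A : exists J, forall j, (J <= j)%N -> A <= lam j.
  by have /cvgryPge/(_ A)[J _ HJ] := lam_oo; exists J => j; exact: HJ.
(* Multiples of one function u cannot be orthonormal: equality in the Cauchy-Schwarz inequality for
   phi j and phi k would give 0 = 1. *)
have lam_simple j : j != k -> lam j != lam k.
  move=> jk; apply/eqP => ljk; have [u [[[u2 _] _ _] _] uP] := hsimple.
  have [ck ckE] := uP _ (eig k).
  have [cj cjE] : exists c : R, {ae rV_lebesgue m, forall x, Omega x -> phi j x = c * u x}.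
    by apply: uP; rewrite -ljk; exact: eig.
  have cE i c v : {ae rV_lebesgue m, forall x, Omega x -> phi i x = c * u x} -> L2 Omega v ->
      L2_inner Omega (phi i) v = c * L2_inner Omega u v.
    move=> h v2; rewrite -(L2_innerZl mO c u2 v2); apply: ae_eq_L2_inner => //.
    exact: L2Z.
  have q i c c' : {ae rV_lebesgue m, forall x, Omega x -> phi i x = c * u x} ->
      forall i', {ae rV_lebesgue m, forall x, Omega x -> phi i' x = c' * u x} ->
      L2_inner Omega (phi i) (phi i') = c * c' * L2_inner Omega u u.
    move=> h i' h'; rewrite (cE i c)// L2_innerC (cE i' c')//.
    by rewrite mulrA.
  have := q j cj ck cjE k ckE; have := q j cj cj cjE j cjE; have := q k ck ck ckE k ckE.
  rewrite !phi_on !eqxx (negbTE jk) /=; move: (L2_inner _ _ _) => t h1 h2 h3.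
  have : (cj * ck * t) ^+ 2 = (ck * ck * t) * (cj * cj * t) by ring.
  by rewrite -h1 -h2 -h3 mulr1 expr0n /= => /eqP; rewrite eq_sym oner_eq0.
have cg : continuous g.
  move=> y; apply/differentiable_continuous/derivable1_diffP.
  by have [dg _] := hgC1; exact: dg.
have [M gM] := hgbounded.
have [V1 [d1 [[M1 [_ VM1]] d10 H1]]] := limf_esup_lt0 hgneg.
(* The lower limit is by definition the opposite of the upper limit of - g. *)
have hgpos' : (limf_esup (fun y => (- g y)%:E) (pinfty_nbhs R) < 0)%E.
  by move: hgpos; rewrite /limf_einf oppe_gt0.
have [V2 [d2 [[M2 [_ VM2]] d20 H2]]] := limf_esup_lt0 hgpos'.
(* The summand 1 yields the strict inequalities that define the two half-lines. *)
pose d0 := Num.min d1 d2; pose y0 := `|M1| + `|M2| + 1.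
have d00 : 0 < d0 by rewrite lt_min d10.
have y00 : 0 <= y0 by rewrite !addr_ge0.
have gpos y : y0 <= y -> d0 <= g y.
  move=> yy; have : - g y <= - d2.
    apply/H2/VM2; apply: lt_le_trans yy.
    by have := ler_norm M2; have := normr_ge0 M1; rewrite /y0; lra.
  by rewrite lerN2; apply: le_trans; rewrite ge_min lexx orbT.
have gneg y : y <= - y0 -> g y <= - d0.
  move=> yy; have : g y <= - d1.
    apply/H1/VM1; apply: le_lt_trans yy _.
    by have := ler_norm (- M1); have := normr_ge0 M2; rewrite normrN /y0; lra.
  by move=> /le_trans; apply; rewrite lerN2 ge_min lexx.
pose f' := zext Omega f.
have f2 : L2 setT f' by exact: L2_zext.
have f_off : vanishes_off Omega f' by exact: zext_off.
have f_orth : L2_inner setT f' (e k) = 0.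
  rewrite inner_e// -hforth; apply: eq_L2_inner => x Ox.
  by rewrite /f' zextT.
have [u [u2 u0 uP]] := galerkin_limit mO Ofin e_off e_h10 e_on lam_simple lam_infty cg gM
  d00 y00 gpos gneg f2 f_orth.
have g2 : L2 setT (superpos Omega g u).
  by apply: (superpos_L2 mO Ofin cg gM); exact: L2_measurable u2.
(* The equation reads -Delta u = F, and the limits of the projected equations state that the
   coefficients of F are lam i times those of u. *)
pose F := lam k *: u + (superpos Omega g u - f').
have gf2 := L2B measurableT g2 f2.
have lu2 := L2Z measurableT (lam k) u2.
have F2 : L2 setT F by exact: L2D.
have F0 : vanishes_off Omega F.
  apply: vanishes_offD; first exact: vanishes_offZ.
  by apply: vanishes_offB => //; exact: superpos_off.
have uF i : L2_inner setT F (e i) = lam i * L2_inner setT u (e i).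
  have e2 : L2 setT (e i) by have [] := e_h10 i.
  rewrite (L2_innerDl measurableT lu2 gf2 e2) (L2_innerZl measurableT (lam k) u2 e2).
  apply/eqP; rewrite -subr_eq0 -[X in _ == X](uP i); apply/eqP.
  by rewrite mulrBl addrAC.
have [w' [w'_off uw wF]] := weak_solution mO Ofin w_off e_h10 e_weak e_complete u2 u0 F2 F0 uF.
have [_ w'2 _] := uw.
(* D (a, b) represents chi |-> <d_a u, d_b chi>, so that - D (a, b) is the weak second derivative of
   u. *)
have /choice[D DP] (ab : 'I_m * 'I_m) : exists v, [/\ L2 setT v, vanishes_off Omega v &
    forall chi, test_function Omega chi ->
      L2_inner setT (w' ab.1) (partial ab.2 chi) = L2_inner setT v chi].
  have [K K0 bK] := second_derivatives ab.1 ab.2 hOmega uw F2 wF.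
  apply: (riesz mO Ofin e_off e_h10 e_on e_complete _ _ K0 bK) => [chi chi' t1 t2|c chi tc].
    rewrite partialD; [|exact: test_Cinfty t1|exact: test_Cinfty t2].
    exact: (L2_innerDr measurableT (test_L2 (test_partial ab.2 t1))
      (test_L2 (test_partial ab.2 t2)) (w'2 ab.1)).
  rewrite partialZ; last exact: test_Cinfty tc.
  exact: (L2_innerZr measurableT c (test_L2 (test_partial ab.2 tc)) (w'2 ab.1)).
have D2 a b : L2 setT (D (a, b)) by have [] := DP (a, b).
have DN2 a b : L2 setT (- D (a, b)) by exact: L2N.
have Doff a b : vanishes_off Omega (- D (a, b)).
  have [_ D0 _] := DP (a, b); move=> x Ox.
  by rewrite -[LHS]/(- D (a, b) x) D0// oppr0.
exists u; apply: (dirichlet_solution_of_h10 mO u2 u0 uw w'_off (D2 := fun a b => - D (a, b))).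
  move=> a b; split => // chi tc.
  have cT : test_function setT chi by exact: test_function_mono tc.
  rewrite !L2_inner_vanish// (L2_innerNl measurableT (D2 a b) (test_L2 tc)).
  have [_ _ /(_ chi tc) /= <-] := DP (a, b).
  by rewrite (h10_parts a uw (test_partial b cT)) opprK.
(* h is the defect of the equation. It is orthogonal to test functions, hence to their L^2 limits e
   i, and completeness of the e i makes it vanish almost everywhere. *)
pose h := \sum_a - D (a, a) + F.
have sD2 : L2 setT (\sum_a - D (a, a)) by apply: L2_sum => // a _; exact: DN2.
have h2 : L2 setT h by exact: L2D.
have h_off : vanishes_off Omega h.
  by apply: vanishes_offD => //; apply: vanishes_off_sum => a _; exact: Doff.
have h_test chi : test_function Omega chi -> L2_inner setT h chi = 0.
  move=> tc; have c2 := test_L2 tc.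
  rewrite (L2_innerDl measurableT sD2 F2 c2) -(wF chi tc).
  rewrite (L2_inner_suml measurableT (F := fun a => - D (a, a)) _ _ c2) => [|a _]; last exact: DN2.
  rewrite -big_split /= big1// => a _.
  rewrite (L2_innerNl measurableT (D2 a a) c2).
  by have [_ _ /(_ chi tc) /= <-] := DP (a, a); rewrite addNr.
have h_e i : L2_inner setT h (e i) = 0.
  have [e2 _ ed] := e_h10 i.
  apply: (eq_of_eps (L2_norm_ge0 setT h)) => eps eps0 _.
  have [psi [tp pe _]] := ed eps eps0; have p2 := test_L2 tp.
  rewrite subr0 -normrN -[- _]add0r -(h_test psi tp).
  rewrite -(L2_innerBr measurableT p2 e2 h2).
  apply: le_trans (cauchy_schwarz measurableT h2 (L2B measurableT p2 e2)) _.
  by rewrite mulrC ler_wpM2r ?L2_norm_ge0.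
have h0 : L2_norm setT h = 0.
  apply: (eq_of_eps ler01) => eps eps0 _; rewrite subr0 mulr1 ger0_norm ?L2_norm_ge0//.
  have [N /(_ N (leqnn N))] := e_complete h h2 h_off eps eps0.
  rewrite big1 ?subr0// => i _.
  by rewrite h_e scale0r.
have := L2_norm_eq0 measurableT h2 h0; apply: filterS => x /(_ I) hx Ox.
move: hx; rewrite /h /F; set s := \sum_a - D (a, a).
have -> : (s + (lam k *: u + (superpos Omega g u - f'))) x =
  s x + (lam k * u x + (superpos Omega g u x - f' x)) by [].
have -> : s x = \sum_a (- D (a, a)) x by rewrite /s fct_sumE.
rewrite /superpos /f' !zextT//= => hx.
by apply/eqP; rewrite -subr_eq0 -!addrA hx.
Qed.
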